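(* Consider the periodic differential system $\dot x=f(t,x)$, $(t,x)\in\mathbb S^1\times(\mathbb C^n,0)$, where $f(t,x)$ is analytic in its variables, periodic of period $2\pi$ in $t$, and $f(t,0)=0$. Write it as $\dot x=A(t)x+g(t,x)$ with $A(t)$ and $g(t,x)=O(x^2)$ $2\pi$-periodic in $t$. Let $\mu=(\mu_1,\ldots,\mu_n)$ be the eigenvalues of the monodromy operator (i.e. the characteristic multipliers) of the linear equation $\dot x=A(t)x$. Then the number of functionally independent generalized rational first integrals of the system $\dot x=f(t,x)$ is at most the maximum number of linearly independent vectors in $\mathbb R^n$ of the set $$\Xi:=\{\mathbf k\in\mathbb Z^n:\ \mu^{\mathbf k}=1,\ \mathbf k\ne 0\}\subset\mathbb Z^n.$$
   Context: $\mathbb S^1=\mathbb R/(2\pi\mathbb Z)$, and $(\mathbb C^n,0)$ denotes a neighborhood of the origin in $\mathbb C^n$. For $\mu=(\mu_1,\ldots,\mu_n)$ and $\mathbf k=(k_1,\ldots,k_n)$, $\mu^{\mathbf k}=\mu_1^{k_1}\cdots\mu_n^{k_n}$. $\langle u,v\rangle=\sum_i u_iv_i$ and $\partial_xF$ is the gradient of $F$ with respect to $x$. Monodromy operator: for $x_0\in(\mathbb C^n,0)$ let $x_0(t)$ be the solution of $\dot x=A(t)x$ with $x_0(0)=x_0$; the monodromy operator is the map $\mathcal P:(\mathbb C^n,0)\to(\mathbb C^n,0)$, $\mathcal P(x_0)=x_0(2\pi)$. A non-constant function $F(t,x)$ is a generalized rational first integral of $\dot x=f(t,x)$ if $F(t,x)=G(t,x)/H(t,x)$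 with $G$ and $H$ analytic in their variables and $2\pi$-periodic in $t$, and $$\frac{\partial F(t,x)}{\partial t}+\langle\partial_xF(t,x),f(t,x)\rangle\equiv 0\quad\text{in } \mathbb S^1\times(\mathbb C^n,0).$$ Functions $F_1(t,x),\ldots,F_m(t,x)$ are functionally independent in $\mathbb S^1\times(\mathbb C^n,0)$ if $\partial_xF_1(t,x),\ldots,\partial_xF_m(t,x)$ have rank $m$ in a full Lebesgue measure subset of $\mathbb S^1\times(\mathbb C^n,0)$. *)

(* Defs.v *)
From HB Require Import structures.
From mathcomp Require Import all_boot all_order all_algebra.
From mathcomp Require Import complex.
From mathcomp Require Import all_classical all_reals all_analysis.

Set Implicit Arguments.
Unset Strict Implicit.
Unset Printing Implicit Defensive.

Import Order.TTheory GRing.Theory Num.Theory.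
Import numFieldNormedType.Exports.

Local Open Scope classical_set_scope.
Local Open Scope ring_scope.

(* The complex numbers.  The type constraint is what gives access to the
   topology and norm that the library puts on every numFieldType; the bare type
   R[i] has no such instances.  The norm of cplx R takes its values in cplx R,
   so real bounds are injected by rtoc. *)
Definition cplx (R : realType) : numClosedFieldType := R[i].

Definition rtoc (R : realType) (a : R) : cplx R := Complex a 0.

Section Tubes.
Variables (R : realType) (n : nat).
Local Notation C := (cplx R).

(* Functions on S^1 x (C^n,0) are represented by functions on the tube
   R x {|x| < r}, for some r > 0, that are 2pi-periodic in t.  Since S^1 is
   compact these tubes form a basis of neighbourhoods of S^1 x {0}.  The norm
   on 'cV[C]_n is the maximum norm, so that {|x| < r} is a polydisc. *)
Definition periodic_on (T : Type) (r : R) (F : R -> 'cV[C]_n -> T) : Prop :=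
  forall (t : R) (x : 'cV[C]_n), `|x| < rtoc r -> F (t + 2 * pi) x = F t x.

Definition ps_term (c : nat -> {ffun 'I_n -> nat} -> C) (t : R) (x : 'cV[C]_n)
    (j : nat) (k : {ffun 'I_n -> nat}) : C :=
  c j k * rtoc t ^+ j * \prod_(i < n) x i 0 ^+ k i.

(* Sum of a family indexed by N x N^n over the box of all exponents < N. *)
Definition box_sum (a : nat -> {ffun 'I_n -> nat} -> C) (N : nat) : C :=
  \sum_(j < N) \sum_(k : {ffun 'I_n -> 'I_N}) a j [ffun i => k i : nat].

(* F is, near (t0, x0), the sum of an absolutely convergent power series in the
   n + 1 variables (t - t0, x - x0): F is jointly analytic in the real variable
   t and the complex variables x. *)
Definition analytic_at (F : R -> 'cV[C]_n -> C) (t0 : R) (x0 : 'cV[C]_n)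
    : Prop :=
  exists (c : nat -> {ffun 'I_n -> nat} -> C) (d : R), 0 < d /\
    forall (t : R) (x : 'cV[C]_n), `|t - t0| < d -> `|x - x0| < rtoc d ->
      let a := ps_term c (t - t0) (x - x0) in
      (exists M : R, forall N : nat,
         box_sum (fun j k => `|a j k|) N <= rtoc M) /\
      box_sum a N @[N --> \oo] --> F t x.

Definition analytic_on (r : R) (F : R -> 'cV[C]_n -> C) : Prop :=
  forall (t : R) (x : 'cV[C]_n), `|x| < rtoc r -> analytic_at F t x.

(* g(t,x) = O(x^2) as x -> 0, uniformly on the compact circle. *)
Definition big_O_square (g : R -> 'cV[C]_n -> 'cV[C]_n) : Prop :=
  exists K d : R, 0 < d /\
    forall (t : R) (x : 'cV[C]_n), `|x| < rtoc d ->
      `|g t x| <= rtoc K * `|x| ^+ 2.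

Definition tderivable (u : R -> C) (t : R) : Prop :=
  derivable (fun s => complex.Re (u s) : R) t 1 /\
  derivable (fun s => complex.Im (u s) : R) t 1.

Definition tderive (u : R -> C) (t : R) : C :=
  Complex ('D_1 (fun s => complex.Re (u s) : R) t)
          ('D_1 (fun s => complex.Im (u s) : R) t).

(* Complex partial derivative with respect to the j-th coordinate of x. *)
Definition xpartial (F : R -> 'cV[C]_n -> C) (j : 'I_n) (t : R)
    (x : 'cV[C]_n) : C :=
  'D_(delta_mx j 0 : 'cV[C]_n) (F t) x.

Definition linear_solution (A : R -> 'M[C]_n) (x : R -> 'cV[C]_n) : Prop :=
  forall (t : R) (i : 'I_n),
    tderivable (fun s => x s i 0) t /\
    tderive (fun s => x s i 0) t = (A t *m x t) i 0.

(* Solutions of a linear equation with continuous coefficients exist and are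
   unique, so the solution below is "the" solution with x(0) = x0. *)
Definition monodromy_operator (A : R -> 'M[C]_n) (P : 'cV[C]_n -> 'cV[C]_n)
    : Prop :=
  forall x0 : 'cV[C]_n, exists x : R -> 'cV[C]_n,
    [/\ linear_solution A x, x 0 = x0 & P x0 = x (2 * pi)].

(* F is only meaningful where the denominator H does not vanish. *)
Definition generalized_rational_first_integral
    (f : R -> 'cV[C]_n -> 'cV[C]_n) (r : R) (F : R -> 'cV[C]_n -> C) : Prop :=
  exists G H : R -> 'cV[C]_n -> C,
    let dom (t : R) (x : 'cV[C]_n) := `|x| < rtoc r /\ H t x != 0 in
    [/\ [/\ analytic_on r G, analytic_on r H, periodic_on r G
          & periodic_on r H],
        (exists t x, dom t x),
        (forall t x, dom t x -> F t x = G t x / H t x),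
        (exists t x s y, [/\ dom t x, dom s y & F t x <> F s y])
      & (forall t x, dom t x ->
           tderive (fun s => F s x) t
             + \sum_(j < n) xpartial F j t x * f t x j 0 = 0)].

(* Lebesgue null subsets of R x C^n = R^(2n+1): outer measure zero, computed
   with countable coverings by cubes of side 2 * s k. *)
Definition lebesgue_null (E : set (R * 'cV[C]_n)) : Prop :=
  forall e : R, 0 < e ->
    exists (q : nat -> R * 'cV[C]_n) (s : nat -> R),
      [/\ (forall k, 0 <= s k),
          (forall p, E p -> exists k, `|p.1 - (q k).1| <= s k /\
             forall i : 'I_n,
               `|complex.Re (p.2 i 0) - complex.Re ((q k).2 i 0)| <= s k /\
               `|complex.Im (p.2 i 0) - complex.Im ((q k).2 i 0)| <= s k)
        & (\sum_(0 <= k <oo) ((2 * s k) ^+ (2 * n).+1)%:E <= e%:E)%E].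

(* The gradients have rank m at almost every point; [0, 2pi[ is a fundamental
   domain of the circle. *)
Definition functionally_independent (r : R) (m : nat)
    (F : 'I_m -> R -> 'cV[C]_n -> C) : Prop :=
  lebesgue_null [set p : R * 'cV[C]_n |
    [/\ 0 <= p.1, p.1 < 2 * pi, `|p.2| < rtoc r
      & \rank (\matrix_(i < m, j < n) xpartial (F i) j p.1 p.2) <> m]].

End Tubes.

Definition resonances (R : realType) (n : nat) (mu : 'I_n -> cplx R)
    : set 'rV[int]_n :=
  [set k : 'rV[int]_n | \prod_(i < n) mu i ^ k 0 i = 1 /\ k <> 0].

(* Largest d such that some d vectors of X are linearly independent in R^n; no
   d > n qualifies, so the range of d loses nothing. *)
Definition max_linearly_independent (R : realType) (n : nat)
    (X : set 'rV[int]_n) : nat :=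
  (\max_(d < n.+1 | `[< exists K : 'M[int]_(d, n),
       (forall i, X (row i K)) /\
       row_free (map_mx intr K : 'M[R]_(d, n)) >]) d)%N.

(* Main.v *)
Require Import Defs.
From HB Require Import structures.
From mathcomp Require Import all_boot all_order all_algebra.
From mathcomp Require Import complex.
From mathcomp Require Import all_classical all_reals all_analysis.
From mathcomp Require Import zify ring lra.
From mathcomp Require Import -(notations) mpoly.

(** Put the first integrals G_i / H_i over a common denominator H.  For a
    polynomial p of degree at most D in m variables, consider the homogenization
    p^ = H^D p(G_1 / H, ..., G_m / H); then p^ / H^D is again a first integral.

    Resonance.  Let u and h be the homogeneous parts of lowest degree in x of p^
    and H at the equilibrium x = 0.  Since the nonlinear part of the system raises
    the degree, u / h^D is a first integral of the linear equation
    ([leading_equation], [transport]).  Over one period a fundamental matrix X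
    satisfies X (t + 2 pi) = X t P, so u / h^D is invariant under the monodromy P.
    In coordinates in which P is triangular, with the multipliers mu on the
    diagonal, P maps a monomial x^a to mu^a x^a plus smaller monomials; hence the
    largest exponent a of u satisfies mu^a = c, where c depends only on h and D
    ([semi_invariant_mlead], [leading_exponent]).  Two such exponents differ by a
    resonance, so at most (N + 1)^s of them have degree at most N, where s is the
    number of independent resonances ([card_resonant_exponents]).

    Independence.  At a point where the gradients have rank m, some Jacobian
    minor of the first integrals does not vanish, so its expansion at x = 0 has a
    finite order e.  Differentiating p down to a constant then shows that the order
    of p^ is at most D (1 + e + kappa), where kappa is the order of H: a bound
    linear in D ([zero_estimate]).

    Counting.  The (d + 1)^m monomials of degree at most d in each variable give,
    with D = m d, homogenizations whose leading exponents are among O(d^s)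
    resonant ones.  If m > s and d is large, linear algebra produces p <> 0 for
    which all coefficients of p^ at these exponents vanish, which contradicts the
    resonance of its largest exponent ([count_exponents]).

    Analysis.  The leading forms depend on time, and their nonvanishing is only
    generic; a suitable base point (t0, x0) is found outside the null set where
    the rank drops ([generic_off_null]), and what is known near t0 is carried to
    t0 + 2 pi by the identity theorem for analytic functions of time
    ([identity_line]).  For this the coefficients of the expansions in x must be
    analytic in time ([analytic_jets]), as must the solutions of the linear
    equation ([linear_ode_analytic]). *)

Set Implicit Arguments.
Unset Strict Implicit.
Unset Printing Implicit Defensive.

Import Order.TTheory GRing.Theory Num.Theory.
Import numFieldNormedType.Exports.

Local Open Scope classical_set_scope.
Local Open Scope ring_scope.

Local Notation "p @_ m" := (mcoeff m p)
  (at level 3, m at level 2, left associativity, format "p @_ m").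

(** * Order of vanishing and leading forms of polynomials *)

Section Order.
Variables (n : nat) (K : idomainType).
Implicit Types (p q : mpoly n K) (m : multinom n) (k l N : nat).

Definition ordge N p : bool := all (fun m => N <= mdeg m)%N (msupp p).

Lemma ordgeP N p :
  reflect (forall m, (mdeg m < N)%N -> p@_m = 0) (ordge N p).
Proof.
apply: (iffP allP) => [h m ltm|h m].
  by move: ltm; apply: contraTeq; rewrite -mcoeff_msupp -leqNgt; apply: h.
rewrite mcoeff_msupp leqNgt; apply: contra => /h ->; exact: eqxx.
Qed.

Lemma ordge0 N : ordge N 0.
Proof. by apply/ordgeP => m _; rewrite mcoeff0. Qed.

Lemma ordge0n p : ordge 0 p.
Proof. exact/ordgeP. Qed.

Lemma ordgeD N p q : ordge N p -> ordge N q -> ordge N (p + q).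
Proof.
move=> /ordgeP hp /ordgeP hq; apply/ordgeP => m lm.
by rewrite mcoeffD hp ?hq ?addr0.
Qed.

Lemma ordgeN N p : ordge N p -> ordge N (- p).
Proof. by move=> /ordgeP hp; apply/ordgeP => m lm; rewrite mcoeffN hp ?oppr0. Qed.

Lemma ordgeB N p q : ordge N p -> ordge N q -> ordge N (p - q).
Proof. by move=> hp hq; apply: ordgeD => //; apply: ordgeN. Qed.

Lemma ordgeZ N c p : ordge N p -> ordge N (c *: p).
Proof. by move=> /ordgeP hp; apply/ordgeP => m lm; rewrite mcoeffZ hp ?mulr0. Qed.

Lemma ordge_sum N (I : Type) (r : seq I) (P : pred I) (F : I -> mpoly n K) :
  (forall i, P i -> ordge N (F i)) -> ordge N (\sum_(i <- r | P i) F i).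
Proof. move=> h; by elim/big_ind: _ => // [|x y]; [apply: ordge0|apply: ordgeD]. Qed.

Lemma ordgeMn N p i : ordge N p -> ordge N (p *+ i).
Proof. by move=> hp; rewrite -scaler_nat; apply: ordgeZ. Qed.

Lemma ordge_leq N k p : (k <= N)%N -> ordge N p -> ordge k p.
Proof.
by move=> kN /ordgeP hp; apply/ordgeP => m lm; apply: hp; apply: leq_trans kN.
Qed.

Lemma ordgeM k l p q : ordge k p -> ordge l q -> ordge (k + l) (p * q).
Proof.
move=> /ordgeP hp /ordgeP hq; apply/ordgeP => m lm; rewrite mcoeffM big1 // => -[a b] /=.
move=> /eqP em; have := congr1 (@mdeg n) em; rewrite mdegD => ed.
have [la|la] := ltnP (mdeg a) k; first by rewrite hp ?mul0r.
rewrite hq ?mulr0 //; lia.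
Qed.

Lemma ordgeMl N p q : ordge N p -> ordge N (p * q).
Proof. by move=> hp; rewrite -[N]addn0; apply: ordgeM => //; apply: ordge0n. Qed.

Lemma ordgeMr N p q : ordge N q -> ordge N (p * q).
Proof. by rewrite mulrC; apply: ordgeMl. Qed.

Lemma ordge_mderiv N i p : ordge N.+1 p -> ordge N (mderiv i p).
Proof.
move=> /ordgeP hp; apply/ordgeP => m lm.
by rewrite mcoeff_deriv hp ?mul0rn // mdegD mdeg1 addn1.
Qed.

Definition hpart k p : mpoly n K := pihomog mdeg k p.

Lemma mcoeff_hpart k p m : (hpart k p)@_m = if mdeg m == k then p@_m else 0.
Proof.
have [e|ne] := eqVneq (mdeg m) k; last first.
  by rewrite (dhomog_nemf_coeff (pihomogP mdeg k p)).
rewrite /hpart pihomogE raddf_sum /= [in RHS](mpolyE p) raddf_sum /= big_mkcond.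
apply: eq_bigr => a _; case: eqP => // ne.
rewrite mcoeffZ mcoeffX; case: eqP => [ea|]; last by rewrite mulr0.
by case: ne; rewrite ea.
Qed.

Lemma hpartD k p q : hpart k (p + q) = hpart k p + hpart k q.
Proof. exact: raddfD. Qed.

Lemma hpartZ k c p : hpart k (c *: p) = c *: hpart k p.
Proof. exact: linearZ. Qed.

Lemma hpart_id k p : hpart k (hpart k p) = hpart k p.
Proof. exact: pihomog_id. Qed.

Lemma hpart_ordge k p : ordge k.+1 p -> hpart k p = 0.
Proof.
move=> /ordgeP hp; apply/mpolyP => m; rewrite mcoeff_hpart mcoeff0.
by case: eqP => // em; rewrite hp ?em.
Qed.

Lemma ordge_hpart k p : ordge k (hpart k p).
Proof. by apply/ordgeP => m lm; rewrite mcoeff_hpart ltn_eqF. Qed.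

Lemma ordge_sub_hpart k p : ordge k p -> ordge k.+1 (p - hpart k p).
Proof.
move=> /ordgeP hp; apply/ordgeP => m; rewrite ltnS leq_eqVlt mcoeffB mcoeff_hpart.
by case: eqP => [|_ /= lm]; rewrite ?subrr // hp // subrr.
Qed.

Lemma hpart_eq0 k p : ordge k p -> hpart k p = 0 -> ordge k.+1 p.
Proof. by move=> hp h0; have := ordge_sub_hpart hp; rewrite h0 subr0. Qed.

(** The leading form of a product is the product of the leading forms: modulo
    higher order both factors may be replaced by their leading forms, whose
    product is homogeneous. *)
Lemma hpartM k l p q : ordge k p -> ordge l q ->
  hpart (k + l) (p * q) = hpart k p * hpart l q.
Proof.
move=> hp hq.
have hom : hpart (k + l) (hpart k p * hpart l q) = hpart k p * hpart l q.
  by apply: pihomog_dE; apply: dhomogM; apply: pihomogP.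
rewrite -[RHS]hom; apply/eqP; rewrite -subr_eq0 -raddfB /=; apply/eqP.
apply: hpart_ordge.
have -> : p * q - hpart k p * hpart l q =
    (p - hpart k p) * q + hpart k p * (q - hpart l q) by ring.
apply: ordgeD.
  by rewrite -addSn; apply: ordgeM => //; apply: ordge_sub_hpart.
by rewrite -addnS; apply: ordgeM; [exact: ordge_hpart|exact: ordge_sub_hpart].
Qed.

Lemma order_exists N p : ~~ ordge N p ->
  exists k, [/\ (k < N)%N, ordge k p & ~~ ordge k.+1 p].
Proof.
elim: N => [|N ih] h; first by rewrite ordge0n in h.
case: (boolP (ordge N p)) => [hN|/ih [k [kN h1 h2]]]; first by exists N.
by exists k; split=> //; apply: ltnW.
Qed.

(** Orders add, as leading forms over an integral domain have a nonzero product. *)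
Lemma order_mul a b p q : ~~ ordge a.+1 p -> ~~ ordge b.+1 q ->
  ~~ ordge (a + b).+1 (p * q).
Proof.
move=> /order_exists [k [ka pk pk1]] /order_exists [l [lb ql ql1]].
apply/negP => /(@ordge_leq _ (k + l).+1) h.
have {}h : ordge (k + l).+1 (p * q) by apply: h; lia.
have := hpart_ordge h; rewrite hpartM // => /eqP; rewrite mulf_eq0.
case/orP => /eqP /hpart_eq0; by [move=> /(_ pk); rewrite (negPf pk1)|
  move=> /(_ ql); rewrite (negPf ql1)].
Qed.

Lemma order_exp a p D : ~~ ordge a.+1 p -> ~~ ordge (D * a).+1 (p ^+ D).
Proof.
move=> hp; elim: D => [|D ih]; last by rewrite exprS mulSn; apply: order_mul.
by apply/negP => /ordgeP/(_ (@mnm0 n)); rewrite mdeg0 mcoeff1 eqxx => /(_ isT)/eqP; rewrite oner_eq0.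
Qed.

Lemma ordge_cancel N e p q : ordge N (p * q) -> ~~ ordge e.+1 q ->
  ordge (N - e) p.
Proof.
move=> hpq hq; apply: contraLR hpq; case E: (N - e)%N => [|j]; first by rewrite ordge0n.
move=> hp; have := order_mul hp hq; apply: contra; apply: ordge_leq; lia.
Qed.

End Order.

(** * A zero estimate for polynomials in quotients *)

Section ZeroEstimate.
Variables (n m : nat) (K : numFieldType).
Variables (G : 'I_m -> mpoly n K) (H : mpoly n K).

(** The homogenization of a monomial in the quotients G i / H: the product of
    H ^ D with the monomial evaluated at these quotients. *)
Definition hmon D (a : multinom m) : mpoly n K :=
  \prod_(i < m) G i ^+ a i * H ^+ (D - mdeg a).

Definition homogenize D (p : mpoly m K) : mpoly n K :=
  \sum_(a : bmultinom m D.+1) p@_a *: hmon D a.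

Definition wronskian (j : 'I_n) (i : 'I_m) : mpoly n K :=
  H * mderiv j (G i) - G i * mderiv j H.

Lemma homogenizeD D p q : homogenize D (p + q) = homogenize D p + homogenize D q.
Proof.
by rewrite -big_split; apply: eq_bigr => a _ /=; rewrite mcoeffD scalerDl.
Qed.

Lemma homogenizeZ D c p : homogenize D (c *: p) = c *: homogenize D p.
Proof.
by rewrite scaler_sumr; apply: eq_bigr => a _ /=; rewrite mcoeffZ scalerA.
Qed.

Lemma homogenize_sum D (I : Type) (r : seq I) (F : I -> mpoly m K) :
  homogenize D (\sum_(i <- r) F i) = \sum_(i <- r) homogenize D (F i).
Proof.
elim: r => [|x r ih]; last by rewrite !big_cons homogenizeD ih.
by rewrite !big_nil /homogenize big1 // => a _; rewrite mcoeff0 scale0r.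
Qed.

Lemma homogenizeX D a : (mdeg a <= D)%N -> homogenize D (mpolyX K a) = hmon D a.
Proof.
move=> ha; have ha' : (mdeg a < D.+1)%N by [].
rewrite /homogenize (bigD1 (BMultinom ha')) //= mcoeffX eqxx scale1r big1 ?addr0 //.
move=> b nb; rewrite mcoeffX; case: eqP => [e|_]; last by rewrite scale0r.
by case/eqP: nb; apply: val_inj; rewrite /= e.
Qed.

(** The product rule for the quotients G i / H, whose derivatives are the
    Wronskians divided by H ^ 2, after multiplication by H ^ (D + 1). *)
Lemma hmon_deriv j D a : (mdeg a <= D)%N ->
  H * mderiv j (hmon D a) = (mderiv j H * hmon D a) *+ D +
    \sum_(i < m) (hmon D.-1 (mnm_sub a (mnm1 i)) * wronskian j i) *+ a i.
Proof.
elim: D a => [|D ih] a ha.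
  have -> : a = @mnm0 m by apply/eqP; rewrite -mdeg_eq0 -leqn0.
  rewrite mulr0n big1 => [|i _]; last by rewrite mnmE.
  rewrite /hmon sub0n big1 => [|i _]; last by rewrite mnmE.
  by rewrite mul1r expr0 -[1]/(mpolyC n 1) mderivC; ring.
have [ha0|[i ai]] : a = @mnm0 m \/ exists i, (0 < a i)%N.
  have [e|ne] := eqVneq a (@mnm0 m); [by left|right].
  apply/existsP; apply: contraNT ne => /existsPn h; apply/eqP/mnmP => i.
  by rewrite mnmE; apply/eqP; rewrite -leqn0 leqNgt; apply: h.
  rewrite ha0 [X in _ + X]big1 => [|i _]; last by rewrite mnmE.
  rewrite /hmon mdeg0 subn0 big1 => [|i _]; last by rewrite mnmE.
  rewrite mul1r addr0.
  elim: D.+1 => [|E iE]; first by rewrite expr0 -[1]/(mpolyC n 1) mderivC mulr0n; ring.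
  rewrite exprS mderivM mulrDr [H * (H * _)]mulrCA iE mulrSr; ring.
pose b := mnm_sub a (mnm1 i).
have ab : a = mnm_add b (mnm1 i).
  by apply/mnmP => l; rewrite !mnmE subnK //; case: eqP => // <-.
clearbody b.
have hb : (mdeg b <= D)%N by move: ha; rewrite ab mdegD mdeg1; lia.
have step E c : hmon E.+1 (mnm_add c (mnm1 i)) = G i * hmon E c.
  rewrite /hmon mdegD mdeg1 addn1 subSS mulrA; congr (_ * _).
  rewrite (bigD1 i) //= [in RHS](bigD1 i) //= !mnmE eqxx addn1 exprS -!mulrA.
  congr (_ * (_ * _)); apply: eq_bigr => l nl; rewrite !mnmE eq_sym (negPf nl) addn0 //.
rewrite [in LHS]ab step mderivM mulrDr.
rewrite [H * (G i * _)]mulrCA (ih _ hb) [in X in _ = X *+ _ + _]ab step.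
have -> : \sum_(l < m) (hmon D (mnm_sub a (mnm1 l)) * wronskian j l) *+ a l =
   hmon D b * wronskian j i +
   G i * \sum_(l < m) (hmon D.-1 (mnm_sub b (mnm1 l)) * wronskian j l) *+ b l.
  rewrite mulr_sumr.
  have term l : (hmon D (mnm_sub a (mnm1 l)) * wronskian j l) *+ b l =
      G i * (hmon D.-1 (mnm_sub b (mnm1 l)) * wronskian j l *+ b l).
    have [->|bl] := posnP (b l); first by rewrite !mulr0n mulr0.
    have Dp : (0 < D)%N.
      apply: leq_trans hb; rewrite lt0n mdeg_eq0; apply: contraTneq bl => ->.
      by rewrite mnmE.
    have -> : mnm_sub a (mnm1 l) = mnm_add (mnm_sub b (mnm1 l)) (mnm1 i).
      apply/mnmP => h; rewrite ab !mnmE.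
      by case: (eqVneq l h) bl => [->|_] /=; lia.
    by rewrite -{1}(prednK Dp) step -mulrA mulrnAr.
  rewrite (bigD1 i) //= [in RHS](bigD1 i) //= addrA; congr (_ + _); last first.
    apply: eq_bigr => l nl; rewrite -term ab mnmDE mnm1E eq_sym (negPf nl) addn0 //.
  have eb : mnm_sub a (mnm1 i) = b by rewrite ab addmK.
  have ea : a i = (b i).+1 by rewrite ab mnmDE mnm1E eqxx addn1.
  by rewrite -term eb ea mulrSr addrC.
rewrite mulrSr mulrDr /wronskian; ring.
Qed.

Lemma mdeg_subU i (a : multinom m) : (0 < a i)%N ->
  mdeg a = (mdeg (mnm_sub a (mnm1 i))).+1.
Proof.
move=> ai; rewrite -addn1 -(mdeg1 i) -mdegD; congr mdeg.
by apply/mnmP => l; rewrite !mnmE subnK //; case: eqP => // <-.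
Qed.

Lemma homogenize_deriv j D p : (msize p <= D.+1)%N ->
  H * mderiv j (homogenize D p) = (mderiv j H * homogenize D p) *+ D +
    \sum_(i < m) homogenize D.-1 (mderiv i p) * wronskian j i.
Proof.
move=> /mpolywE ep.
have lin : homogenize D p = \sum_(a : bmultinom m D.+1) p@_a *: hmon D a by [].
rewrite lin linear_sum mulr_sumr /=.
under eq_bigr => a _.
  rewrite linearZ /= -scalerAr (hmon_deriv j (a := a)); last by rewrite -ltnS bmdeg.
  over.
rewrite mulr_sumr -sumrMnl.
have -> : \sum_(i < m) homogenize D.-1 (mderiv i p) * wronskian j i =
    \sum_(a : bmultinom m D.+1) p@_a *: \sum_(i < m)
      (hmon D.-1 (mnm_sub a (mnm1 i)) * wronskian j i) *+ a i.
  under [RHS]eq_bigr => a _ do rewrite scaler_sumr.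
  rewrite exchange_big /=; apply: eq_bigr => i _.
  rewrite {1}ep linear_sum homogenize_sum mulr_suml; apply: eq_bigr => a _.
  rewrite /= mderivZ mderivX !homogenizeZ -scalerAl.
  have [->|ai] := posnP ((a : multinom m) i); first by rewrite !(mulr0n, scale0r, mul0r, scaler0).
  rewrite homogenizeX; first by rewrite -scalerAl scaler_nat.
  by have := bmdeg a; rewrite (mdeg_subU ai); lia.
by rewrite -big_split; apply: eq_bigr => a _; rewrite /= scalerDr -scalerAr scalerMnr.
Qed.

Lemma mderiv_eq0_const (p : mpoly m K) :
  (forall i, mderiv i p = 0) -> p = p@_(@mnm0 m) *: mpolyX K (@mnm0 m).
Proof.
move=> hd; apply/mpolyP => a; rewrite mcoeffZ mcoeffX.
have [<-|ne] := eqVneq (@mnm0 m) a; first by rewrite mulr1.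
rewrite mulr0; have [i ai] : exists i, (0 < a i)%N.
  apply/existsP; apply: contraNT ne => /existsPn h; apply/eqP/mnmP => i.
  by rewrite mnmE; apply/esym/eqP; rewrite -leqn0 leqNgt; apply: h.
have ea : a = mnm_add (mnm_sub a (mnm1 i)) (mnm1 i).
  by apply/mnmP => l; rewrite !mnmE subnK //; case: eqP => // <-.
have := mcoeff_deriv i (mnm_sub a (mnm1 i)) p; rewrite hd mcoeff0 -ea.
by move=> /esym/eqP; rewrite mulrn_eq0 /= => /eqP.
Qed.

Lemma msize_mderiv D i (p : mpoly m K) : (msize p <= D.+2)%N ->
  (msize (mderiv i p) <= D.+1)%N.
Proof.
move=> hp; rewrite msizeE; apply/bigmax_leqP_seq => a; rewrite mcoeff_msupp => ha _.
rewrite ltnS leqNgt; apply: contra ha => ha; rewrite mcoeff_deriv.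
rewrite memN_msupp_eq0 ?mul0rn //; apply: msize_mdeg_ge; apply: leq_trans hp _.
by rewrite mdegD mdeg1 addn1 ltnS.
Qed.

Variables (sigma : 'I_m -> 'I_n) (e kappa : nat).
Hypothesis order_H : ~~ ordge kappa.+1 H.
Hypothesis order_det :
  ~~ ordge e.+1 (\det (\matrix_(i, j) wronskian (sigma j) i)).

(** Differentiating a nonzero polynomial of degree D in the quotients G i / H
    lowers its degree; by Cramer's rule each differentiation lowers the order of
    vanishing by at most 1 + e, where e is the order of a nonzero Jacobian minor.
    After D steps a nonzero constant times a power of H is left. *)
Lemma zero_estimate D (p : mpoly m K) : p != 0 -> (msize p <= D.+1)%N ->
  ~~ ordge (D * (1 + e + kappa)).+1 (homogenize D p).
Proof.
have const E (c : mpoly m K) : c != 0 -> (forall i, mderiv i c = 0) ->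
    ~~ ordge (E * (1 + e + kappa)).+1 (homogenize E c).
  move=> c0 /mderiv_eq0_const ec; have cn : c@_(@mnm0 m) != 0.
    by apply: contraNneq c0 => h; rewrite ec h scale0r.
  rewrite ec homogenizeZ homogenizeX ?mdeg0 //.
  rewrite /hmon mdeg0 subn0 big1 => [|i _]; last by rewrite mnmE.
  rewrite mul1r; apply: contra (order_exp E order_H) => h.
  apply: (@ordge_leq _ _ (E * (1 + e + kappa)).+1); first by rewrite ltnS leq_mul2l; lia.
  by rewrite -[H ^+ E](scalerK cn) scalerA mulrC -scalerA scalerA mulrC -scalerA; apply: ordgeZ.
elim: D p => [|D ih] p p0 sp.
  apply: const => // i; have := msize1_polyC sp => ->; exact: mderivC.
have [/forallP h|/forallPn [i hi]] := boolP [forall i, mderiv i p == 0].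
  by apply: const => // i; apply/eqP.
apply/negP => hord; have /negP := ih _ hi (msize_mderiv i sp); apply.
pose W := \matrix_(l < m, j < m) wronskian (sigma j) l.
pose r := \row_(l < m) homogenize D (mderiv l p).
have hrW j : ordge (D.+1 * (1 + e + kappa)) ((r *m W) 0 j).
  have -> : (r *m W) 0 j =
      H * mderiv (sigma j) (homogenize D.+1 p) -
      (mderiv (sigma j) H * homogenize D.+1 p) *+ D.+1.
    rewrite homogenize_deriv // addrC addKr !mxE.
    by apply: eq_bigr => l _; rewrite !mxE.
  apply: ordgeB; first by apply: ordgeMr; apply: ordge_mderiv.
  by apply: ordgeMn; apply: ordgeMr; apply: ordge_leq hord.
have hdet : ordge (D.+1 * (1 + e + kappa)) (homogenize D (mderiv i p) * \det W).
  have -> : homogenize D (mderiv i p) * \det W = (r *m W *m \adj W) 0 i.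
    by rewrite -mulmxA mul_mx_adj mul_mx_scalar !mxE mulrC.
  by rewrite mxE; apply: ordge_sum => j _; apply: ordgeMl.
apply: ordge_leq (ordge_cancel hdet order_det); rewrite mulSn; lia.
Qed.

End ZeroEstimate.

(** * Evaluation and linear substitutions *)

Section Evaluation.
Variables (n : nat) (K : numFieldType).
Implicit Types (p q : mpoly n K) (m : multinom n) (x : 'cV[K]_n).

Definition pev p x : K := meval (fun i => x i 0) p.

Lemma pevD p q x : pev (p + q) x = pev p x + pev q x. Proof. exact: mevalD. Qed.
Lemma pevN p x : pev (- p) x = - pev p x. Proof. exact: mevalN. Qed.
Lemma pevB p q x : pev (p - q) x = pev p x - pev q x. Proof. exact: mevalB. Qed.
Lemma pevM p q x : pev (p * q) x = pev p x * pev q x. Proof. exact: mevalM. Qed.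
Lemma pevZ c p x : pev (c *: p) x = c * pev p x. Proof. exact: mevalZ. Qed.
Lemma pevX m x : pev (mpolyX K m) x = \prod_(i < n) x i 0 ^+ m i.
Proof. exact: mevalX. Qed.
Lemma pev0 x : pev 0 x = 0. Proof. exact: meval0. Qed.
Lemma pev1 x : pev 1 x = 1. Proof. exact: meval1. Qed.
Lemma pev_sum (I : Type) (r : seq I) (P : pred I) F x :
  pev (\sum_(i <- r | P i) F i) x = \sum_(i <- r | P i) pev (F i) x.
Proof. exact: raddf_sum. Qed.
Lemma pev_exp p k x : pev (p ^+ k) x = pev p x ^+ k.
Proof. by elim: k => [|k ih]; rewrite ?pev1 // !exprS pevM ih. Qed.

Lemma pevwE k p x : (msize p <= k)%N ->
  pev p x = \sum_(a : bmultinom n k) p@_a * \prod_(i < n) x i 0 ^+ (a : multinom n) i.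
Proof.
move=> hp; rewrite {1}(mpolywE hp) pev_sum; apply: eq_bigr => a _.
by rewrite pevZ pevX.
Qed.

Lemma digits_inj B k (u v : nat -> nat) :
  (forall i, u i < B)%N -> (forall i, v i < B)%N ->
  (\sum_(i < k) u i * B ^ i = \sum_(i < k) v i * B ^ i)%N ->
  forall i, (i < k)%N -> u i = v i.
Proof.
elim: k u v => [|k ih] u v hu hv; first by [].
rewrite !big_ord_recl !expn0 !muln1 => e.
have E w : (\sum_(i < k) w (bump 0 i) * B ^ bump 0 i =
    (\sum_(i < k) w i.+1 * B ^ i) * B)%N.
  by rewrite big_distrl; apply: eq_bigr => i _; rewrite /bump /= add1n expnSr mulnA.
move: e; rewrite !E => e.
have e0 : u 0%N = v 0%N.
  by have := congr1 (modn^~ B) e; rewrite /= ![(_ + _ * B)%N]addnC !modnMDl !modn_small.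
have B0 : (0 < B)%N by apply: leq_trans (hu 0%N).
move: e; rewrite e0 => /addnI/eqP; rewrite eqn_pmul2r // => /eqP e.
case=> [|i] hi //; exact: (ih (fun i => u i.+1) (fun i => v i.+1)).
Qed.

(** Kronecker substitution: at the points (z, z ^ B, z ^ (B ^ 2), ...) distinct
    monomials of small degree become distinct powers of z. *)
Lemma pev_eq0 p : (forall x, pev p x = 0) -> p = 0.
Proof.
move=> h; pose B := msize p; pose w m := (\sum_(i < n) m i * B ^ i)%N.
pose q : {poly K} := \sum_(a : bmultinom n B) p@_a *: 'X^(w a).
have q0 : q = 0.
  apply: (@roots_geq_poly_eq0 _ q [seq i%:R | i <- iota 0 (size q)]).
  - apply/allP => z /mapP [i _ ->]; rewrite rootE.
    rewrite horner_sum; apply/eqP; rewrite -[RHS](h (\col_l i%:R ^+ (B ^ l))).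
    rewrite (@pevwE B) //; apply: eq_bigr => a _; rewrite !hornerE; congr (_ * _).
    rewrite /w expr_sum; apply: eq_bigr => l _; by rewrite mxE mulnC exprM.
  - by rewrite map_inj_uniq ?iota_uniq // => i j /eqP; rewrite eqr_nat => /eqP.
  - by rewrite size_map size_iota.
apply/mpolyP => m; rewrite mcoeff0.
have [ltm|] := ltnP (mdeg m) B; last by move=> ?; rewrite memN_msupp_eq0 ?msize_mdeg_ge.
have := congr1 (fun q : {poly K} => q`_(w m)) q0; rewrite coef0 coef_sum.
rewrite (bigD1 (BMultinom ltm)) //= coefZ coefXn eqxx mulr1 big1 ?addr0 // => a na.
rewrite coefZ coefXn; case: eqP => [e|_]; last by rewrite mulr0.
case/eqP: na; apply: val_inj; apply/mnmP => i /=.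
have le l b : (mdeg b < B)%N -> (b l < B)%N.
  move=> hb; apply: leq_ltn_trans hb; rewrite mdegE (bigD1 l) //=; exact: leq_addr.
pose ext b (l : nat) := if insub l is Some i then (b : multinom n) i else 0%N.
have extE b (l : 'I_n) : ext b l = b l by rewrite /ext valK.
have extB b l : (mdeg b < B)%N -> (ext b l < B)%N.
  move=> hb; rewrite /ext; case: insub => [j|]; [exact: le|exact: leq_trans hb].
have := @digits_inj B n (ext a) (ext m) (fun l => extB a l (bmdeg a))
  (fun l => extB m l ltm) _ i (ltn_ord i).
rewrite !extE; apply; move: e; rewrite /w => e.
by under eq_bigr do rewrite extE; rewrite -e; under [RHS]eq_bigr do rewrite extE.
Qed.

Lemma pev_inj p q : (forall x, pev p x = pev q x) -> p = q.
Proof.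
by move=> h; apply/eqP; rewrite -subr_eq0; apply/eqP/pev_eq0 => x; rewrite pevB h subrr.
Qed.

Definition linear_form (M : 'M[K]_n) i : mpoly n K :=
  \sum_j M i j *: mpolyX K (mnm1 j).

Definition lsubst (M : 'M[K]_n) p : mpoly n K :=
  comp_mpoly [tuple linear_form M i | i < n] p.

Lemma pev_lsubst M p x : pev (lsubst M p) x = pev p (M *m x).
Proof.
rewrite /pev /lsubst comp_mpoly_meval; apply: meval_eq => i.
rewrite tnth_mktuple -/(pev _ _) pev_sum mxE; apply: eq_bigr => j _.
by rewrite pevZ /pev mevalXU.
Qed.

Lemma lsubstD M p q : lsubst M (p + q) = lsubst M p + lsubst M q.
Proof. exact: comp_mpolyD. Qed.
Lemma lsubstZ M c p : lsubst M (c *: p) = c *: lsubst M p.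
Proof. exact: comp_mpolyZ. Qed.
Lemma lsubst_sum M (I : Type) (r : seq I) (P : pred I) F :
  lsubst M (\sum_(i <- r | P i) F i) = \sum_(i <- r | P i) lsubst M (F i).
Proof. exact: raddf_sum. Qed.
Lemma lsubstX M m : lsubst M (mpolyX K m) = \prod_(i < n) linear_form M i ^+ m i.
Proof. by rewrite /lsubst comp_mpolyX; apply: eq_bigr => i _; rewrite tnth_mktuple. Qed.

Lemma mcoeff_lsubst M p a : (lsubst M p)@_a =
  \sum_(m <- msupp p) p@_m * (lsubst M (mpolyX K m))@_a.
Proof.
rewrite [in LHS](mpolyE p) lsubst_sum raddf_sum /=; apply: eq_bigr => m _.
by rewrite lsubstZ mcoeffZ.
Qed.

Lemma lsubst_eq0 M p : M \in unitmx -> lsubst M p = 0 -> p = 0.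
Proof.
move=> uM h; apply: pev_eq0 => x.
by rewrite -[x](mulKVmx uM) -pev_lsubst h pev0.
Qed.

Lemma mdeg_linear_form M i : hpart 1 (linear_form M i) = linear_form M i.
Proof.
apply: pihomog_dE; apply: rpred_sum => j _; apply: rpredZ.
by rewrite dhomogX /= mdeg1.
Qed.

Lemma lsubstX_homog M m : hpart (mdeg m) (lsubst M (mpolyX K m)) = lsubst M (mpolyX K m).
Proof.
rewrite lsubstX mdegE; apply: pihomog_dE.
elim/big_rec2: _ => [|i k q _ hq]; first exact: dhomog1.
apply: dhomogM => //.
rewrite -[X in ishomog1 X _]mul1n; apply: dhomogMn.
by rewrite homog_piE -/(hpart 1 _) mdeg_linear_form.
Qed.

Lemma ordge_lsubst N M p : ordge N p -> ordge N (lsubst M p).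
Proof.
move=> /ordgeP hp; rewrite (mpolyE p) lsubst_sum; apply: ordge_sum => m _.
rewrite lsubstZ; have [lt|ge] := ltnP (mdeg m) N.
  by rewrite hp // scale0r; apply: ordge0.
by apply: ordgeZ; rewrite -lsubstX_homog; apply: ordge_leq ge (ordge_hpart _ _).
Qed.

Lemma lsubst_homog k M p : hpart k p = p -> hpart k (lsubst M p) = lsubst M p.
Proof.
move=> hp; rewrite (mpolyE p) lsubst_sum [LHS]raddf_sum /=; apply: eq_big_seq => m hm.
have em : mdeg m = k.
  apply/eqP; apply: contraTT hm => ne; rewrite mcoeff_msupp negbK -hp mcoeff_hpart.
  by rewrite (negPf ne).
by rewrite lsubstZ -/(hpart _ _) hpartZ -em lsubstX_homog.
Qed.

Section Triangular.
Variable T : 'M[K]_n.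
Hypothesis T_upper : forall i j : 'I_n, (j < i)%N -> T i j = 0.
Hypothesis T_diag : forall i, T i i != 0.

Lemma mlead_linear_form i : mlead (linear_form T i) = mnm1 i.
Proof.
have ci : (linear_form T i)@_(mnm1 i) = T i i.
  rewrite /linear_form raddf_sum (bigD1 i) //= mcoeffZ mcoeffXU eqxx mulr1.
  by rewrite big1 ?addr0 // => j nj; rewrite mcoeffZ mcoeffXU (negPf nj) mulr0.
apply/le_anti/andP; split; last first.
  by apply: msupp_le_mlead; rewrite mcoeff_msupp ci.
have := mlead_supp (p := linear_form T i); rewrite mcoeff_msupp.
set m := mlead _ => /(_ _) h; have {}h : (linear_form T i)@_m != 0.
  by apply: h; apply: contraNneq (T_diag i) => h0; rewrite -ci h0 mcoeff0.
move: h; rewrite /linear_form raddf_sum /=.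
have [j|h] := pickP (fun j => (mnm1 j == m) && (T i j != 0)).
  move=> /andP [/eqP <- Tj] _.
  have := leqP i j; case=> ij; last by rewrite T_upper ?eqxx in Tj.
  move: ij; rewrite leq_eqVlt => /orP [/eqP/val_inj ->//|ij].
  apply/ltW/ltmcP; first by rewrite !mdeg1.
  exists i => [l li|]; rewrite !mnmE ?eqxx; last by case: eqP ij => // ->; rewrite ltnn.
  have -> : (j == l) = false by apply/eqP => ejl; move: li ij; rewrite ejl; lia.
  by have -> : (i == l) = false by apply/eqP => eil; move: li; rewrite eil ltnn.
rewrite big1 ?eqxx // => j _; rewrite mcoeffZ mcoeffX.
by have := h j; case: eqP => _ /=; [move/negbT; rewrite negbK => /eqP ->; rewrite mul0r|rewrite mulr0].
Qed.

Lemma mleadc_linear_form i : (linear_form T i)@_(mnm1 i) = T i i.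
Proof.
rewrite /linear_form raddf_sum (bigD1 i) //= mcoeffZ mcoeffXU eqxx mulr1.
by rewrite big1 ?addr0 // => j nj; rewrite mcoeffZ mcoeffXU (negPf nj) mulr0.
Qed.

Lemma linear_form_neq0 i : linear_form T i != 0.
Proof. by apply: contraNneq (T_diag i) => h; rewrite -mleadc_linear_form h mcoeff0. Qed.

Lemma mlead_lsubstX m : mlead (lsubst T (mpolyX K m)) = m.
Proof.
rewrite lsubstX mlead_prod => [|i _ _]; last by rewrite expf_neq0 ?linear_form_neq0.
apply/mnmP => l; rewrite mnm_sumE (bigD1 l) //= big1 => [|i ni].
  by rewrite mleadX ?linear_form_neq0 // mlead_linear_form mulmnE mnm1E eqxx mul1n addn0.
by rewrite mleadX ?linear_form_neq0 // mlead_linear_form mulmnE mnm1E (negPf ni).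
Qed.

Lemma mleadc_lsubstX m : (lsubst T (mpolyX K m))@_m = \prod_i T i i ^+ m i.
Proof.
transitivity (lsubst T (mpolyX K m))@_(mlead (lsubst T (mpolyX K m))).
  by rewrite mlead_lsubstX.
rewrite lsubstX mlead_prod => [|i _ _]; last first.
  by rewrite expf_neq0 ?linear_form_neq0.
rewrite mleadc_prod; apply: eq_bigr => i _.
by rewrite mleadX ?linear_form_neq0 // mleadcX mlead_linear_form mleadc_linear_form.
Qed.

(** An upper triangular substitution maps each monomial to a multiple of itself
    plus smaller monomials. *)
Lemma mleadc_lsubst p : p != 0 -> 
  (lsubst T p)@_(mlead p) = p@_(mlead p) * \prod_i T i i ^+ (mlead p) i.
Proof.
move=> p0; rewrite mcoeff_lsubst.
rewrite (bigD1_seq (mlead p)) ?mlead_supp ?msupp_uniq //= mleadc_lsubstX.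
rewrite [X in _ + X]big_seq_cond [X in _ + X]big1 ?addr0 // => m /andP [hm nm].
rewrite [X in _ * X]mcoeff_gt_mlead ?mulr0 // mlead_lsubstX.
by rewrite lt_neqAle nm msupp_le_mlead.
Qed.

Lemma mlead_lsubst p : p != 0 -> mlead (lsubst T p) = mlead p.
Proof.
move=> p0; apply/le_anti/andP; split; last first.
  apply: msupp_le_mlead; rewrite mcoeff_msupp mleadc_lsubst // mulf_neq0 ?mleadc_eq0 //.
  by apply/prodf_neq0 => i _; rewrite expf_neq0.
rewrite leNgt; apply/negP => hlt.
have : lsubst T p != 0.
  by apply: contraTneq hlt => ->; rewrite mlead0 -leNgt; apply: le0x.
rewrite -mleadc_eq0 => /eqP; apply.
rewrite mcoeff_lsubst big_seq big1 // => m hm.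
rewrite [X in _ * X]mcoeff_gt_mlead ?mulr0 // mlead_lsubstX.
exact: le_lt_trans (msupp_le_mlead hm) hlt.
Qed.

End Triangular.
End Evaluation.

(** * Triangularization and resonant exponents *)

Lemma perm_eq_prod_XsubC (K : idomainType) (s t : seq K) :
  \prod_(x <- s) ('X - x%:P) = \prod_(x <- t) ('X - x%:P) -> perm_eq s t.
Proof.
elim: s t => [|x s ih] t e.
  have := congr1 (fun p : {poly K} => size p) e; rewrite big_nil size_poly1.
  by rewrite size_prod_XsubC; case: t {e}.
have xt : x \in t.
  have := root_prod_XsubC t x; rewrite -e big_cons => <-.
  by rewrite rootM root_XsubC eqxx.
rewrite perm_sym (permPl (perm_to_rem xt)) perm_cons perm_sym; apply: ih.
move: e; rewrite (perm_big _ (perm_to_rem xt)) !big_cons /=.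
by apply: mulfI; rewrite polyXsubC_eq0.
Qed.

(** The diagonal of a Schur form lists the roots of the characteristic polynomial;
    [s] matches that list with the given one. *)
Lemma upper_triangularization (C : numClosedFieldType) n (P : 'M[C]_n)
    (mu : 'I_n -> C) : char_poly P = \prod_(i < n) ('X - (mu i)%:P) ->
  exists (Q T : 'M[C]_n) (s : 'I_n -> 'I_n),
    [/\ Q \in unitmx, injective s, P *m Q = Q *m T,
        forall i j : 'I_n, (j < i)%N -> T i j = 0 & forall i, T i i = mu (s i)].
Proof.
case: n P mu => [|n] P mu e.
  by exists 1%:M, 1%:M, id; split=> //; [exact: unitmx1|by apply/matrixP; case|case|case].
have [V] := Schur P^T (ltn0Sn n); move=> /unitarymx_unit uV.
rewrite /similar_to /= conjumx // => /is_trig_mxP trg.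
pose T := (V *m P^T *m invmx V)^T.
have eT : P *m V^T = V^T *m T.
  by rewrite /T !trmx_mul trmxK !mulmxA -trmx_mul mulVmx // trmx1 mul1mx.
have Tup (i j : 'I_n.+1) : (j < i)%N -> T i j = 0 by move=> ij; rewrite mxE trg.
have uVt : V^T \in unitmx by rewrite unitmx_tr.
have cT : char_poly T^T = \prod_(i < n.+1) ('X - (T i i)%:P).
  rewrite char_poly_trig; first by apply: eq_bigr => i _; rewrite mxE.
  by apply/is_trig_mxP => i j ij; rewrite mxE Tup.
have cPT : char_poly P = char_poly T^T.
  have -> : char_poly T^T = char_poly T.
    rewrite /char_poly -det_tr; congr (\det _).
    by apply/matrixP => i j; rewrite !mxE eq_sym.
  have -> : T = invmx V^T *m P *m V^T by rewrite -mulmxA eT mulKmx.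
  rewrite /char_poly /char_poly_mx !map_mxM /=.
  set W := map_mx _ V^T; set W' := map_mx _ (invmx _).
  have WW : W' *m W = 1%:M by rewrite -map_mxM mulVmx // map_mx1.
  have -> : 'X%:M - W' *m map_mx polyC P *m W = W' *m ('X%:M - map_mx polyC P) *m W.
    by rewrite mulmxBr mulmxBl mul_mx_scalar -scalemxAl WW scalemx1.
  by rewrite !det_mulmx mulrAC -det_mulmx WW det1 mul1r.
have : perm_eq [seq T i i | i <- enum 'I_n.+1] [tuple mu i | i < n.+1].
  apply: perm_eq_prod_XsubC; rewrite big_map big_enum /= -cT -cPT e.
  by rewrite big_map big_enum.
move=> /perm.tuple_permP [s es]; exists V^T, T, (perm.fun_of_perm s); split=> //.
  exact: perm.perm_inj.
move=> i.
have := congr1 (nth 0 ^~ i) es.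
rewrite (nth_map i) ?size_enum_ord // nth_ord_enum => ->.
by rewrite -tnth_nth !tnth_mktuple.
Qed.

(** If a / b ^ D is invariant under a triangular substitution, comparing the
    coefficients of the largest monomials of both sides relates the multipliers of
    the leading exponents. *)
Lemma semi_invariant_mlead (K : numFieldType) n (T : 'M[K]_n) (a b : mpoly n K) D :
  (forall i j : 'I_n, (j < i)%N -> T i j = 0) -> (forall i, T i i != 0) ->
  a != 0 -> b != 0 ->
  lsubst T a * b ^+ D = a * (lsubst T b) ^+ D ->
  \prod_i T i i ^+ mlead a i = (\prod_i T i i ^+ mlead b i) ^+ D.
Proof.
move=> Tup Td a0 b0 e.
have a1 : lsubst T a != 0.
  by rewrite -mleadc_eq0 mlead_lsubst // mleadc_lsubst // mulf_neq0 ?mleadc_eq0 //;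
     apply/prodf_neq0 => i _; rewrite expf_neq0.
have b1 : lsubst T b != 0.
  by rewrite -mleadc_eq0 mlead_lsubst // mleadc_lsubst // mulf_neq0 ?mleadc_eq0 //;
     apply/prodf_neq0 => i _; rewrite expf_neq0.
have h1 := mleadcM (lsubst T a) (b ^+ D); have h2 := mleadcM a (lsubst T b ^+ D).
move: h1 h2; rewrite e !mleadX // !mlead_lsubst // => -> /eqP.
have -> : (lsubst T b ^+ D)@_(mnm_muln (mlead b) D) = (lsubst T b)@_(mlead b) ^+ D.
  by rewrite -[in LHS](mlead_lsubst Tup Td b0) mleadcX mlead_lsubst.
rewrite mleadcX !mleadc_lsubst // exprMn.
rewrite -mulrA (inj_eq (mulfI _)) ?mleadc_eq0 // mulrC.
by rewrite (inj_eq (mulfI _)) ?expf_neq0 ?mleadc_eq0 // => /eqP.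
Qed.

Lemma row_kernel (K : fieldType) p q (B : 'M[K]_(p, q)) : (q < p)%N ->
  exists2 v : 'rV_p, v != 0 & v *m B = 0.
Proof.
move=> qp; have : kermx B != 0.
  by rewrite -mxrank_eq0 mxrank_ker subn_eq0 -ltnNge; apply: leq_ltn_trans (rank_leq_col B) qp.
move=> /rowV0Pn [v vk v0]; exists v => //; exact/sub_kermxP.
Qed.

Section Counting.
Variables (R : realType) (n : nat) (mu : 'I_n -> cplx R).
Hypothesis mu_neq0 : forall i, mu i != 0.
Let s := max_linearly_independent R (resonances mu).

Lemma max_linearly_independentP : exists K : 'M[int]_(s, n),
  (forall i, resonances mu (row i K)) /\ row_free (map_mx intr K : 'M[R]_(s, n)).
Proof.
have [|d hd es] := @eq_bigmax_cond 'I_n.+1 (fun d : 'I_n.+1 => `[< exists K : 'M[int]_(d, n),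
       (forall i, resonances mu (row i K)) /\
       row_free (map_mx intr K : 'M[R]_(d, n)) >]) (fun d => d : nat).
  apply/card_gt0P; exists ord0; apply/asboolP; exists 0; split; first by case.
  by rewrite /row_free -leqn0 rank_leq_row.
rewrite /s /max_linearly_independent es; exact/asboolP.
Qed.

Lemma max_linearly_independent_max d (K : 'M[int]_(d, n)) :
  (forall i, resonances mu (row i K)) -> row_free (map_mx intr K : 'M[R]_(d, n)) ->
  (d <= s)%N.
Proof.
move=> h1 h2; have dn : (d < n.+1)%N.
  by rewrite ltnS -(eqP h2) rank_leq_col.
rewrite /s /max_linearly_independent.
apply: (@leq_bigmax_cond _ _ (fun d : 'I_n.+1 => d : nat) (Ordinal dn)).
by apply/asboolP; exists K.
Qed.

(** Exponents with a common value of the monomial differ by resonances, so they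
    lie in a translate of a space of dimension s, and s suitably chosen
    coordinates determine them. *)
Lemma card_resonant_exponents N (c : cplx R) :
  (#|[pred a : bmultinom n N.+1 | (\prod_i mu i ^+ (a : multinom n) i == c)%R]| <= N.+1 ^ s)%N.
Proof.
have [K [KX Kfree]] := max_linearly_independentP.
pose KR := map_mx intr K : 'M[R]_(s, n).
have inK (k : 'rV[int]_n) : resonances mu k -> (map_mx intr k <= KR)%MS.
  move=> hk; apply: contraT => nk.
  have : (s + 1 <= s)%N; last by rewrite addn1 ltnn.
  apply: (@max_linearly_independent_max (s + 1) (col_mx K k)).
    move=> i; rewrite -(fintype.splitK i); case: (fintype.split i) => j /=.
      by rewrite rowKu.
    by rewrite rowKd (ord1 j) row_id.
  rewrite /row_free eqn_leq rank_leq_row map_col_mx -/KR.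
  rewrite -addsmxE addn1 /=.
  have rK : \rank KR = s by apply/eqP.
  apply: leq_ltn_trans (_ : s <= \rank KR)%N _; first by rewrite rK.
  apply: rank_ltmx.
  by rewrite ltmxE addsmxSl addsmx_sub submx_refl.
have fK : row_full KR^T by rewrite /row_full mxrank_tr.
pose f := fullrankfun fK.
have inj (k : 'rV[int]_n) : (map_mx intr k <= KR)%MS -> (forall i, k 0 (f i) = 0) -> k = 0.
  move=> /submxP [c' ek] k0.
  have uf := fullrowsub_unit fK.
  have : c' = 0.
    have : c' *m (rowsub f KR^T)^T = 0.
      apply/rowP => i; have := congr1 (fun M : 'rV[R]_n => M 0 (f i)) ek.
      rewrite !mxE k0 => /esym h; rewrite -[RHS]h.
      by apply: eq_bigr => j _; rewrite !mxE.
    move=> h; have uft : (rowsub f KR^T)^T \in unitmx by rewrite unitmx_tr.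
    by rewrite -[c'](mulmxK uft) h mul0mx.
  move=> c0; move: ek; rewrite c0 mul0mx => ek; apply/rowP => i.
  have := congr1 (fun M : 'rV[R]_n => M 0 i) ek; rewrite !mxE => /eqP.
  by rewrite intr_eq0 => /eqP.
pose phi (a : bmultinom n N.+1) : {ffun 'I_s -> 'I_N.+1} :=
  [ffun i => inord ((a : multinom n) (f i))].
have aN (a : bmultinom n N.+1) i : ((a : multinom n) i < N.+1)%N.
  by apply: leq_ltn_trans (bmdeg a); rewrite mdegE (bigD1 i) //= leq_addr.
have -> : (N.+1 ^ s = #|{ffun 'I_s -> 'I_N.+1}|)%N by rewrite card_ffun !card_ord.
rewrite -(card_in_image (f := phi)); first exact: max_card.
move=> a b; rewrite !inE => /eqP ha /eqP hb eab.
pose k : 'rV[int]_n := \row_i (((a : multinom n) i)%:Z - ((b : multinom n) i)%:Z).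
suff k0 : k = 0.
  apply: val_inj; apply/mnmP => i; have := congr1 (fun M : 'rV[int]_n => M 0 i) k0.
  by rewrite !mxE => /eqP; rewrite subr_eq0 => /eqP [].
have [//|nk] := eqVneq k 0.
apply: inj; last first.
  move=> i; rewrite mxE; have := congr1 (fun g : {ffun _ -> _} => val (g i)) eab.
  by rewrite !ffunE /= !inordK // => ->; rewrite subrr.
apply: inK; split; last exact/eqP.
have c0 : c != 0 by rewrite -ha; apply/prodf_neq0 => i _; rewrite expf_neq0.
transitivity (c * c^-1); last by rewrite mulfV.
rewrite -{1}ha -hb -prodfV -big_split; apply: eq_bigr => i _ /=.
by rewrite mxE expfzDr // -exprnP -exprnN.
Qed.

End Counting.

(** * Moduli of complex numbers and vectors as real numbers *)

Section Modulus.
Variable R : realType.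
Local Notation C := (cplx R).
Implicit Types (z w : C) (a b : R).

Import ComplexField.Normc.

Definition cmod z : R := normc z.

Lemma norm_cmod z : `|z| = rtoc (cmod z).
Proof. by rewrite normc_def /cmod; case: z. Qed.

Lemma rtocD a b : rtoc (a + b) = rtoc a + rtoc b.
Proof. exact: (rmorphD (real_complex R)). Qed.
Lemma rtocB a b : rtoc (a - b) = rtoc a - rtoc b.
Proof. exact: (rmorphB (real_complex R)). Qed.
Lemma rtocM a b : rtoc (a * b) = rtoc a * rtoc b.
Proof. exact: (rmorphM (real_complex R)). Qed.
Lemma rtocX a k : rtoc (a ^+ k) = rtoc a ^+ k.
Proof. exact: (rmorphXn (real_complex R)). Qed.
Lemma rtoc0 : rtoc 0 = 0 :> C. Proof. by []. Qed.
Lemma rtoc_sum (I : Type) (r : seq I) (P : pred I) (F : I -> R) :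
  rtoc (\sum_(i <- r | P i) F i) = \sum_(i <- r | P i) rtoc (F i).
Proof. exact: (raddf_sum (real_complex R)). Qed.
Lemma rtoc_eq0 a : (rtoc a == 0) = (a == 0).
Proof. exact: (fmorph_eq0 (real_complex R)). Qed.

Lemma le_rtoc a b : (rtoc a <= rtoc b) = (a <= b).
Proof. exact: lecR. Qed.
Lemma lt_rtoc a b : (rtoc a < rtoc b) = (a < b).
Proof. exact: ltcR. Qed.

Lemma rtoc_ge0 z : 0 <= z -> z = rtoc (complex.Re z).
Proof. by move=> /ger0_Im; case: z => x y /= ->. Qed.

Lemma cmod_ge0 z : 0 <= cmod z.
Proof. rewrite -le_rtoc -norm_cmod rtoc0; exact: normr_ge0. Qed.

Lemma cmod0 : cmod 0 = 0. Proof. exact: normc0. Qed.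
Lemma cmod1 : cmod 1 = 1. Proof. exact: normc1. Qed.
Lemma cmod_eq0 z : (cmod z == 0) = (z == 0).
Proof. by apply/eqP/eqP => [/eq0_normc //|->]; rewrite cmod0. Qed.
Lemma cmod_gt0 z : (0 < cmod z) = (z != 0).
Proof. by rewrite lt_neqAle eq_sym cmod_eq0 cmod_ge0 andbT. Qed.
Lemma cmodM z w : cmod (z * w) = cmod z * cmod w. Proof. exact: normcM. Qed.
Lemma cmodN z : cmod (- z) = cmod z. Proof. exact: normcN. Qed.
Lemma cmodB z w : cmod (z - w) = cmod (w - z). Proof. by rewrite -cmodN opprB. Qed.
Lemma cmodD z w : cmod (z + w) <= cmod z + cmod w. Proof. exact: le_normcD. Qed.
Lemma cmodV z : cmod z^-1 = (cmod z)^-1. Proof. exact: normcV. Qed.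
Lemma cmodX z k : cmod (z ^+ k) = cmod z ^+ k.
Proof.
elim: k => [|k ih]; first by rewrite !expr0 cmod1.
by rewrite !exprS cmodM ih.
Qed.
Lemma cmod_rtoc a : cmod (rtoc a) = `|a|.
Proof. by rewrite /cmod /= expr0n addr0 sqrtr_sqr. Qed.

Lemma cmod_triangle z w u : cmod (z - u) <= cmod (z - w) + cmod (w - u).
Proof. by rewrite -[z - u](subrKA w); apply: cmodD. Qed.

Lemma cmod_le_dist z w : cmod z <= cmod w + cmod (z - w).
Proof. by rewrite -{1}(subrKC w z); apply: cmodD. Qed.

Lemma cmod_sum (I : Type) (r : seq I) (P : pred I) (F : I -> C) :
  cmod (\sum_(i <- r | P i) F i) <= \sum_(i <- r | P i) cmod (F i).
Proof.
elim/big_rec2: _ => [|i x y _ h]; first by rewrite cmod0.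
by apply: le_trans (cmodD _ _) _; rewrite lerD2l.
Qed.

Lemma cmod_prod (I : Type) (r : seq I) (P : pred I) (F : I -> C) :
  cmod (\prod_(i <- r | P i) F i) = \prod_(i <- r | P i) cmod (F i).
Proof. by elim/big_rec2: _ => [|i x y _ <-]; rewrite ?cmod1 // cmodM. Qed.

Lemma Re_le_cmod z : `|complex.Re z| <= cmod z.
Proof. by rewrite -le_rtoc -norm_cmod; apply: normc_ge_Re. Qed.

Lemma Im_le_cmod z : `|complex.Im z| <= cmod z.
Proof.
case: z => x y; rewrite /cmod /= -sqrtr_sqr ler_wsqrtr // lerDr.
exact: sqr_ge0.
Qed.

Lemma cmod_le_ReIm z : cmod z <= `|complex.Re z| + `|complex.Im z|.
Proof.
case: z => x y; rewrite /cmod /= -[X in _ <= X]ger0_norm ?addr_ge0 //.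
rewrite -sqrtr_sqr ler_wsqrtr // sqrrD !real_normK ?num_real //.
by rewrite -addrA lerD2l lerDr mulrn_wge0 // mulr_ge0.
Qed.

Lemma Re_add z w : complex.Re (z + w) = complex.Re z + complex.Re w.
Proof. by case: z; case: w. Qed.
Lemma Im_add z w : complex.Im (z + w) = complex.Im z + complex.Im w.
Proof. by case: z; case: w. Qed.
Lemma Re_opp z : complex.Re (- z) = - complex.Re z. Proof. by case: z. Qed.
Lemma Im_opp z : complex.Im (- z) = - complex.Im z. Proof. by case: z. Qed.
Lemma Re_mulr z a : complex.Re (z * rtoc a) = complex.Re z * a.
Proof. by case: z => x y /=; rewrite mulr0 subr0. Qed.
Lemma Im_mulr z a : complex.Im (z * rtoc a) = complex.Im z * a.
Proof. by case: z => x y /=; rewrite mulr0 add0r. Qed.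

Lemma cmod_small_eq0 z (K : R) :
  (forall e : R, 0 < e -> cmod z <= K * e) -> z = 0.
Proof.
move=> h; apply/eqP; rewrite -cmod_eq0 eq_le cmod_ge0 andbT leNgt; apply/negP => z0.
have K1 : 0 < `|K| + 1 by rewrite ltr_wpDl.
have e0 : 0 < cmod z / 2 / (`|K| + 1) by rewrite !divr_gt0.
have := h _ e0; apply/negP; rewrite -ltNge.
have : K * (cmod z / 2 / (`|K| + 1)) <= cmod z / 2.
  rewrite mulrCA ger_pMr ?divr_gt0 // ler_pdivrMr // mul1r.
  by apply: le_trans (ler_norm K) _; rewrite lerDl.
by move=> /le_lt_trans; apply; rewrite ltr_pdivrMr // mulr_natr mulr2n ltrDl.
Qed.

End Modulus.

Arguments cmod : simpl never.

Section VectorModulus.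
Variables (R : realType) (n : nat).
Local Notation C := (cplx R).
Implicit Types (x y : 'cV[C]_n).

Definition vmod x : R := complex.Re `|x|.

Lemma norm_vmod x : `|x| = rtoc (vmod x).
Proof. exact/rtoc_ge0/normr_ge0. Qed.

Lemma lt_vmod x (d : R) : (`|x| < rtoc d) = (vmod x < d).
Proof. by rewrite norm_vmod lt_rtoc. Qed.

Lemma vmod_ge0 x : 0 <= vmod x.
Proof. rewrite -le_rtoc -norm_vmod rtoc0; exact: normr_ge0. Qed.

Lemma vmod0 : vmod 0 = 0.
Proof. by rewrite /vmod normr0. Qed.

Lemma vmodD x y : vmod (x + y) <= vmod x + vmod y.
Proof. by rewrite -le_rtoc rtocD -!norm_vmod; apply: ler_normD. Qed.

Lemma vmodZ (c : C) x : vmod (c *: x) = cmod c * vmod x.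
Proof. by apply: complexI; rewrite -[LHS]/(rtoc _) -[RHS]/(rtoc _) rtocM -!norm_vmod -norm_cmod normrZ. Qed.

Lemma cmod_le_vmod x i : cmod (x i 0) <= vmod x.
Proof.
rewrite -le_rtoc -norm_vmod -norm_cmod [X in _ <= X]/Num.norm /= mx_normE.
rewrite -[leLHS]nngE num_le; exact: (le_bigmax _ (fun j : 'I_n * 'I_1 => `|x j.1 j.2|%:nng) (i, 0)).
Qed.

Lemma vmod_le x (b : R) : 0 <= b -> (forall i, cmod (x i 0) <= b) -> vmod x <= b.
Proof.
move=> b0 h; have [->//|x0] := eqVneq (vmod x) 0.
have : mx_norm x != 0.
  by rewrite -[mx_norm x]/(`|x|) norm_vmod rtoc_eq0.
move=> /mx_norm_neq0 [[i j] /= e].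
by rewrite -le_rtoc -norm_vmod [X in X <= _]e (ord1 j) norm_cmod le_rtoc.
Qed.

End VectorModulus.

(** * Null sets have dense complement *)

Section Grid.
Variables (R : realType).

(** The grid points of step h in an interval of length 2s lie within that
    length of the first of them. *)
Lemma grid_count M (lo c h s : R) : 0 < h -> h <= 2 * s ->
  \sum_(a < M) (`|lo + a%:R * h - c| < s)%R%:R <= 4 * s / h.
Proof.
move=> h0 hs; have s20 := le_trans (ltW h0) hs.
have -> : 4 * s = 2 * s + 2 * s by ring.
set S := fun a : 'I_M => `|lo + a%:R * h - c| < s.
rewrite -natr_sum (_ : (\sum_a _)%N = #|[pred x | S x]|); last first.
  by rewrite -sum1_card [RHS]big_mkcond; apply: eq_bigr => a _; rewrite inE /S; case: (_ < _)%R.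
case: (pickP (S : pred 'I_M)) => [a0 a0S|e]; last first.
  rewrite (eq_card0 (A := [pred x | S x])) //.
  by rewrite divr_ge0 ?addr_ge0 // ltW.
have [a aS amin] := @arg_minnP _ a0 S (fun a : 'I_M => a : nat) a0S.
pose T := Num.truncn (2 * s / h).
have sub b : S b -> (b : nat) \in iota a T.+1.
  move=> bS; rewrite mem_iota amin //= addnS ltnS -leq_subLR.
  rewrite truncn_ge_nat ?divr_ge0 ?(ltW h0) // ler_pdivlMr // natrB ?amin //.
  move: aS bS; rewrite /S !ltr_norml => /andP [a1 a2] /andP [b1 b2].
  by rewrite mulrBl; lra.
have cT : (#|[pred x | S x]| <= T.+1)%N.
  rewrite cardE -(size_map (val : 'I_M -> nat)) -(size_iota a T.+1).
  apply: uniq_leq_size; first by rewrite map_inj_uniq ?enum_uniq //; exact: val_inj.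
  by move=> z /mapP [b]; rewrite mem_enum => /sub bi ->.
apply: (@le_trans _ _ T.+1%:R); first by rewrite ler_nat.
rewrite -natr1 mulrDl lerD ?truncn_le ?divr_ge0 ?(ltW h0) //.
by rewrite ler_pdivlMr // mul1r.
Qed.

(** A covering of a cube by finitely many small cubes covers its grid points;
    counting those bounds the volume of the cube. *)
Lemma cover_volume D N (L : R) (lo : 'I_D -> R) (c : nat -> 'I_D -> R) (s : nat -> R) :
  0 < L -> (forall k, 0 < s k) ->
  (forall y : 'I_D -> R, (forall i, lo i <= y i <= lo i + L) ->
     exists2 k, (k < N)%N & forall i, `|y i - c k i| < s k) ->
  L ^+ D <= \sum_(k < N) (4 * s k) ^+ D.
Proof.
move=> L0 s0 cov.
have [M hM] : exists M : nat, forall k, (k < N)%N -> L / M.+1%:R <= 2 * s k.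
  elim: N {cov} => [|N [M hM]]; first by exists 0%N.
  exists (maxn M (Num.truncn (L / (2 * s N)))) => k.
  have le1 a b : (a <= b)%N -> L / b.+1%:R <= L / a.+1%:R.
    by move=> ab; rewrite ler_wpM2l ?(ltW L0) // lef_pV2 ?posrE // ler_nat.
  rewrite ltnS leq_eqVlt => /orP [/eqP ->|kN].
    apply: le_trans (le1 _ _ (leq_maxr _ _)) _.
    rewrite ler_pdivrMr // mulrC -ler_pdivrMr ?mulr_gt0 //.
    exact/ltW/truncnS_gt.
  exact: le_trans (le1 _ _ (leq_maxl _ _)) (hM k kN).
pose h := L / M.+1%:R.
have h0 : 0 < h by rewrite divr_gt0.
pose hit k (i : 'I_D) (a : 'I_M.+1) : R := (`|lo i + a%:R * h - c k i| < s k)%R%:R.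
have count : M.+1%:R ^+ D <= \sum_(k < N) \prod_(i < D) \sum_(a < M.+1) hit k i a.
  rewrite -natrX -{1}[M.+1]card_ord -[D in (_ ^ D)%N]card_ord -card_ffun -sum1_card natr_sum.
  under [X in _ <= X]eq_bigr => k _ do rewrite bigA_distr_bigA /=.
  rewrite exchange_big /=; apply: ler_sum => phi _.
  have [i|k kN hk] := cov (fun i => lo i + (phi i)%:R * h).
    rewrite lerDl mulr_ge0 ?(ltW h0) //= lerD2l /h mulrA ler_pdivrMr // mulrC.
    by rewrite ler_wpM2l ?(ltW L0) // ler_nat ltnW.
  rewrite (bigD1 (Ordinal kN)) //= [X in X + _](_ : _ = 1); last first.
    by apply: big1 => i _; rewrite /hit hk.
  by rewrite lerDl sumr_ge0 // => *; apply: prodr_ge0 => *.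
have -> : L = M.+1%:R * h by rewrite /h mulrC divfK.
rewrite exprMn; apply: (@le_trans _ _ ((\sum_(k < N) (4 * s k / h) ^+ D) * h ^+ D)).
  rewrite ler_wpM2r ?exprn_ge0 ?(ltW h0) //; apply: le_trans count _.
  apply: ler_sum => k _; rewrite -[D in X in _ <= X]card_ord -prodr_const.
  apply: ler_prod => i _; rewrite sumr_ge0 //=.
  exact: grid_count h0 (hM k (ltn_ord k)).
rewrite mulr_suml; apply: ler_sum => k _.
by rewrite -exprMn divfK // gt_eqF.
Qed.

(** Compactness of the closed cube. *)
Lemma compact_cube_cover D (L : R) (lo : 'I_D -> R) (c : nat -> 'I_D -> R) (s : nat -> R) :
  (forall k, 0 < s k) ->
  (forall y : 'I_D -> R, (forall i, lo i <= y i <= lo i + L) ->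
     exists k, forall i, `|y i - c k i| < s k) ->
  exists N : nat, forall y : 'I_D -> R, (forall i, lo i <= y i <= lo i + L) ->
     exists2 k, (k < N)%N & forall i, `|y i - c k i| < s k.
Proof.
move=> s0 cov.
have := @rV_compact R D (fun i => `[lo i, lo i + L]%classic) (fun i => @segment_compact R _ _).
rewrite compact_cover => /(_ nat setT (fun k => ball (\row_i c k i) (s k))).
case=> [k _|y yA|X _ cX]; first exact: ball_open.
  have [i|k hk] := cov (fun i => y ord0 i); first by have := yA i; rewrite /= in_itv.
  exists k => //; split=> // i j; rewrite ord1 mxE -ball_normE /= distrC; exact: hk.
exists ((\max_(k <- finmap.enum_fset X) k)%N).+1 => y hy.
have [i|k /= kX [_ hk]] := cX (\row_i y i).
  by rewrite /= mxE in_itv /=.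
exists k => [|i]; first by rewrite ltnS; apply: (@leq_bigmax_seq nat (finmap.enum_fset X) xpredT id).
by have := hk 0 i; rewrite !mxE -ball_normE /= distrC.
Qed.

Lemma exprD_le2 (a b : R) D : 0 <= a -> 0 <= b -> (a + b) ^+ D <= 2 ^+ D * (a ^+ D + b ^+ D).
Proof.
move=> a0 b0; wlog ab : a b a0 b0 / a <= b.
  move=> h; case/orP: (le_total a b) => ab; first exact: h.
  by rewrite addrC [a ^+ D + _]addrC h.
apply: (@le_trans _ _ ((2 * b) ^+ D)).
  by apply: lerXn2r; rewrite ?nnegrE ?addr_ge0 ?mulr_ge0 // mulrDl mul1r lerD2r.
by rewrite exprMn ler_wpM2l ?exprn_ge0 // lerDr exprn_ge0.
Qed.

Lemma half_geometric_le1 N : \sum_(k < N) (2^-1 : R) ^+ k.+1 <= 1.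
Proof.
suff -> : \sum_(k < N) (2^-1 : R) ^+ k.+1 = 1 - 2^-1 ^+ N.
  by rewrite lerBlDr lerDl exprn_ge0.
elim: N => [|N IH]; first by rewrite big_ord0 expr0 subrr.
by rewrite big_ord_recr IH /= exprS; lra.
Qed.

(** Slightly enlarged, the small cubes are open and still have a small total
    volume; a finite number of them would cover the given cube, which contradicts
    the volume bound for finite coverings. *)
Lemma cubes_miss_point D (L : R) (lo : 'I_D -> R) : (0 < D)%N -> 0 < L ->
  exists2 e : R, 0 < e &
  forall (c : nat -> 'I_D -> R) (s : nat -> R), (forall k, 0 <= s k) ->
    (forall N, \sum_(k < N) (2 * s k) ^+ D <= e) ->
    exists2 y : 'I_D -> R, (forall i, lo i <= y i <= lo i + L) &
      forall k, exists i, s k < `|y i - c k i|.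
Proof.
move=> D0 L0; pose e := L ^+ D / 8 ^+ D / 3.
have e0 : 0 < e by rewrite !divr_gt0 ?exprn_gt0.
exists e => // c s s0 hs; apply: contrapT => no.
(* The enlargement of the k-th cube; its D-th power is at most eta k. *)
pose eta k := Num.min 1 (e * 2^-1 ^+ k.+1).
have eta0 k : 0 < eta k by rewrite lt_min ltr01 mulr_gt0 ?exprn_gt0 ?invr_gt0.
pose s' k := s k + eta k.
have s'0 k : 0 < s' k by rewrite ltr_wpDl.
have cov (y : 'I_D -> R) : (forall i, lo i <= y i <= lo i + L) ->
    exists k, forall i, `|y i - c k i| < s' k.
  move=> hy; apply: contrapT => nok; apply: no; exists y => // k.
  apply: contrapT => noi; apply: nok; exists k => i.
  apply: (@le_lt_trans _ _ (s k)); last by rewrite ltrDl.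
  by rewrite leNgt; apply/negP => hi; apply: noi; exists i.
have [N /(cover_volume L0 s'0)] := compact_cube_cover s'0 cov.
apply/negP; rewrite -ltNge.
have bound k : (4 * s' k) ^+ D <= 8 ^+ D * ((2 * s k) ^+ D + e * 2^-1 ^+ k.+1).
  rewrite exprMn; apply: (@le_trans _ _ (4 ^+ D * (2 ^+ D * (s k ^+ D + eta k ^+ D)))).
    by rewrite ler_wpM2l ?exprn_ge0 // exprD_le2 // ltW.
  rewrite mulrA -exprMn (_ : 4 * 2 = 8 :> R); last by ring.
  rewrite ler_wpM2l ?exprn_ge0 // lerD //.
    by rewrite exprMn ler_peMl ?exprn_ge0 // exprn_ege1 // ler1n.
  apply: (@le_trans _ _ (eta k)); last by rewrite ge_min lexx orbT.
  rewrite -(prednK D0) exprS ler_piMr ?(ltW (eta0 k)) // exprn_ile1 ?(ltW (eta0 k)) //.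
  by rewrite ge_min lexx.
apply: (@le_lt_trans _ _ (8 ^+ D * (e + e))).
  apply: (@le_trans _ _ (\sum_(k < N) 8 ^+ D * ((2 * s k) ^+ D + e * 2^-1 ^+ k.+1))).
    by apply: ler_sum => k _; apply: bound.
  rewrite -mulr_sumr ler_wpM2l ?exprn_ge0 // big_split /=; apply: lerD (hs N) _.
  rewrite -mulr_sumr.
  by rewrite ler_piMr ?(ltW e0) // half_geometric_le1.
have -> : L ^+ D = 8 ^+ D * (3 * e).
  by rewrite /e [3 * _]mulrC divfK // mulrC divfK // expf_neq0.
rewrite ltr_pM2l ?exprn_gt0 //; lra.
Qed.

End Grid.

(** A box in R x C^n contains a cube in the 2n + 1 real coordinates formed by the
    time and the real and imaginary parts. *)
Lemma null_complement_dense (R : realType) n (E : set (R * 'cV[cplx R]_n))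
    (t0 : R) (x0 : 'cV[cplx R]_n) (eta : R) : lebesgue_null E -> 0 < eta ->
  exists t x, [/\ ~ E (t, x), `|t - t0| < eta & vmod (x - x0) < eta].
Proof.
move=> nullE eta0; pose L := eta / 4.
have L0 : 0 < L by rewrite divr_gt0.
pose D := (1 + (n + n))%N.
pose coords (p : R * 'cV[cplx R]_n) : 'rV[R]_D :=
  row_mx (const_mx p.1) (row_mx (\row_i complex.Re (p.2 i 0)) (\row_i complex.Im (p.2 i 0))).
have coords_t p : coords p 0 (lshift _ 0) = p.1 by rewrite row_mxEl mxE.
have coords_re p i : coords p 0 (rshift 1 (lshift n i)) = complex.Re (p.2 i 0).
  by rewrite row_mxEr row_mxEl mxE.
have coords_im p i : coords p 0 (rshift 1 (rshift n i)) = complex.Im (p.2 i 0).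
  by rewrite !row_mxEr mxE.
have [e e0 he] := @cubes_miss_point R D L (fun i => coords (t0, x0) 0 i) isT L0.
have [q [s [s0 cov vol]]] := nullE e e0.
have [N|y hy miss] := he (fun k i => coords (q k) 0 i) s s0.
  rewrite -lee_fin; apply: le_trans vol.
  rewrite -sumEFin -(big_mkord xpredT (fun k => ((2 * s k) ^+ D)%:E)).
  rewrite /D add1n addnn -mul2n.
  apply: (@nneseries_lim_ge R (fun k => ((2 * s k) ^+ (2 * n).+1)%:E) xpredT 0 N) => k _ _.
  by rewrite lee_fin exprn_ge0 // mulr_ge0.
pose t := y (lshift _ 0).
pose x : 'cV[cplx R]_n := \col_i Complex (y (rshift 1 (lshift n i))) (y (rshift 1 (rshift n i))).
have yE i : y i = coords (t, x) 0 i.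
  case: (split_ordP i) => j ->; first by rewrite ord1 coords_t.
  by case: (split_ordP j) => l ->; rewrite ?coords_re ?coords_im /= mxE.
have close i : `|y i - coords (t0, x0) 0 i| <= L.
  have /andP [h1 h2] := hy i; rewrite ger0_norm ?subr_ge0 //; lra.
have L4 : 4 * L = eta by rewrite /L mulrC divfK.
exists t, x; split.
- move=> /cov [k [/= h1 h2]]; have [i hi] := miss k; move: hi; rewrite yE.
  case: (split_ordP i) => j ->.
    by rewrite ord1 !coords_t /= ltNge h1.
  case: (split_ordP j) => l ->; have [h3 h4] := h2 l.
    by rewrite !coords_re /= ltNge h3.
  by rewrite !coords_im /= ltNge h4.
- by have := close (lshift _ 0); rewrite coords_t -/t /=; lra.
apply: (@le_lt_trans _ _ (2 * L)); last by lra.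
apply: vmod_le; first by lra.
move=> i; apply: le_trans (cmod_le_ReIm _) _.
have := close (rshift 1 (lshift n i)); have := close (rshift 1 (rshift n i)).
rewrite coords_re coords_im /= !mxE Re_add Im_add Re_opp Im_opp /=; lra.
Qed.

(** * Analytic complex-valued functions of a real variable *)

Section DominatedPolynomials.
Variable R : realType.
Local Notation C := (cplx R).
Implicit Types (q : {poly C}) (Q : {poly R}).

Definition dominated q Q := forall k, cmod q`_k <= Q`_k.

Lemma dominated_ge0 q Q k : dominated q Q -> 0 <= Q`_k.
Proof. by move=> h; apply: le_trans (h k); apply: cmod_ge0. Qed.

Lemma dominated_size q Q : dominated q Q -> (size q <= size Q)%N.
Proof.
move=> h; apply/leq_sizeP => k hk; apply/eqP; rewrite -cmod_eq0 eq_le cmod_ge0 andbT.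
by apply: le_trans (h k) _; rewrite nth_default.
Qed.

Lemma dominatedD q1 Q1 q2 Q2 :
  dominated q1 Q1 -> dominated q2 Q2 -> dominated (q1 + q2) (Q1 + Q2).
Proof. by move=> h1 h2 k; rewrite !coefD; apply: le_trans (cmodD _ _) (lerD _ _). Qed.

Lemma dominatedM q1 Q1 q2 Q2 :
  dominated q1 Q1 -> dominated q2 Q2 -> dominated (q1 * q2) (Q1 * Q2).
Proof.
move=> h1 h2 k; rewrite !coefM; apply: le_trans (cmod_sum _ _ _) _.
by apply: ler_sum => i _; rewrite cmodM ler_pM ?cmod_ge0.
Qed.

Lemma dominatedC (c : C) : dominated c%:P (cmod c)%:P.
Proof. by move=> k; rewrite !coefC; case: eqP; rewrite ?cmod0. Qed.

Lemma dominatedXn k : dominated 'X^k 'X^k.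
Proof. by move=> l; rewrite !coefXn; case: eqP => _; rewrite ?cmod0 ?cmod1. Qed.

Lemma dominated0 : dominated 0 0.
Proof. by move=> k; rewrite !coef0 cmod0. Qed.

Lemma dominated_sum (I : Type) (r : seq I) (P : pred I) F G :
  (forall i, P i -> dominated (F i) (G i)) ->
  dominated (\sum_(i <- r | P i) F i) (\sum_(i <- r | P i) G i).
Proof.
move=> h; elim/big_rec2: _ => [|i Q q Pi ih]; first exact: dominated0.
by apply: dominatedD => //; apply: h.
Qed.

Lemma horner_ge0_le Q (a b : R) : (forall k, 0 <= Q`_k) -> 0 <= a -> a <= b ->
  Q.[a] <= Q.[b].
Proof.
move=> h a0 ab; rewrite !horner_coef; apply: ler_sum => i _.
by rewrite ler_wpM2l // lerXn2r // nnegrE // (le_trans a0).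
Qed.

Lemma horner_coefs_ge0 Q (a : R) : (forall k, 0 <= Q`_k) -> 0 <= a -> 0 <= Q.[a].
Proof.
move=> h a0; rewrite horner_coef; apply: sumr_ge0 => i _.
by rewrite mulr_ge0 // exprn_ge0.
Qed.

(** A dominated polynomial without terms of degree less than N gains a factor
    (|s| / d) ^ N over its majorant at d. *)
Lemma dominated_horner_low q Q N (s d : R) : dominated q Q ->
  (forall k, (k < N)%N -> q`_k = 0) -> 0 < d -> `|s| <= d ->
  cmod q.[rtoc s] <= (`|s| / d) ^+ N * Q.[d].
Proof.
move=> h low d0 sd; rewrite (horner_coef_wide _ (dominated_size h)) horner_coef.
apply: le_trans (cmod_sum _ _ _) _; rewrite mulr_sumr; apply: ler_sum => k _.
have t0 : 0 <= `|s| / d by rewrite divr_ge0 // ltW.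
have t1 : `|s| / d <= 1 by rewrite ler_pdivrMr // mul1r.
have [kN|Nk] := ltnP k N.
  have Qk := dominated_ge0 k h; have d0' := ltW d0.
  by rewrite low // mul0r cmod0 !mulr_ge0 ?exprn_ge0 ?invr_ge0.
rewrite cmodM cmodX cmod_rtoc.
have -> : `|s| ^+ k = (`|s| / d) ^+ k * d ^+ k.
  by rewrite -exprMn divfK // gt_eqF.
rewrite [X in _ <= X]mulrCA; apply: ler_pM.
- exact: cmod_ge0.
- by rewrite mulr_ge0 // exprn_ge0 // ltW.
- exact: h.
have d0' := ltW d0; by rewrite ler_wpM2r ?exprn_ge0 // ler_wiXn2l.
Qed.

Lemma dominated_horner q Q (s d : R) : dominated q Q -> 0 < d -> `|s| <= d ->
  cmod q.[rtoc s] <= Q.[d].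
Proof.
by move=> h d0 sd; have := @dominated_horner_low _ _ 0%N s d h; rewrite expr0 mul1r; apply.
Qed.

End DominatedPolynomials.

Section QuadraticDerivative.
Variable R : realType.
Local Notation C := (cplx R).
Implicit Types (phi psi : R -> C) (s : R).

(** Differentiability with a quadratic error term; analytic functions have it, and
    its product rule needs no limit. *)
Definition qderiv phi (s0 : R) (l : C) := exists K e : R, 0 < e /\
  forall s, `|s| < e -> cmod (phi (s0 + s) - phi s0 - l * rtoc s) <= K * s ^+ 2.

Lemma qderiv_pos phi s0 l : qderiv phi s0 l -> exists K e : R,
  [/\ 0 <= K, 0 < e, e <= 1 & forall s, `|s| < e ->
     cmod (phi (s0 + s) - phi s0 - l * rtoc s) <= K * s ^+ 2].
Proof.
move=> [K [e [e0 h]]]; exists `|K|, (Num.min e 1); split=> //.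
- by rewrite lt_min e0 ltr01.
- by rewrite ge_min lexx orbT.
- move=> s; rewrite lt_min => /andP [se _]; apply: le_trans (h _ se) _.
  by rewrite ler_wpM2r ?sqr_ge0 // ler_norm.
Qed.

Lemma qderiv_lipschitz phi s0 l : qderiv phi s0 l -> exists K e : R,
  [/\ 0 <= K, 0 < e & forall s, `|s| < e -> cmod (phi (s0 + s) - phi s0) <= K * `|s|].
Proof.
move=> /qderiv_pos [K [e [K0 e0 e1 h]]]; exists (K + cmod l), e; split=> //.
  by rewrite addr_ge0 // cmod_ge0.
move=> s se; apply: le_trans (cmod_le_dist _ (l * rtoc s)) _.
rewrite cmodM cmod_rtoc mulrDl addrC lerD2r; apply: le_trans (h _ se) _.
rewrite -real_normK ?num_real // expr2 ler_wpM2l //.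
by rewrite ler_piMr // ltW // (lt_le_trans se).
Qed.

Lemma qderiv_cst (c : C) s0 : qderiv (fun=> c) s0 0.
Proof. by exists 0, 1; split=> // s _; rewrite subrr mul0r subrr cmod0 mul0r. Qed.

Lemma qderiv_ext phi psi s0 l : (forall s, phi s = psi s) ->
  qderiv phi s0 l -> qderiv psi s0 l.
Proof.
by move=> h [K [e [e0 he]]]; exists K, e; split=> // s se; rewrite -!h; apply: he.
Qed.

Lemma qderivD phi psi s0 l1 l2 : qderiv phi s0 l1 -> qderiv psi s0 l2 ->
  qderiv (fun s => phi s + psi s) s0 (l1 + l2).
Proof.
move=> [K1 [e1 [e10 h1]]] [K2 [e2 [e20 h2]]].
exists (K1 + K2), (Num.min e1 e2); split; first by rewrite lt_min e10.
move=> s; rewrite lt_min => /andP [s1 s2].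
have -> : phi (s0 + s) + psi (s0 + s) - (phi s0 + psi s0) - (l1 + l2) * rtoc s =
  (phi (s0 + s) - phi s0 - l1 * rtoc s) + (psi (s0 + s) - psi s0 - l2 * rtoc s) by ring.
by apply: le_trans (cmodD _ _) _; rewrite mulrDl lerD ?h1 ?h2.
Qed.

Lemma qderivM phi psi s0 l1 l2 : qderiv phi s0 l1 -> qderiv psi s0 l2 ->
  qderiv (fun s => phi s * psi s) s0 (l1 * psi s0 + phi s0 * l2).
Proof.
move=> d1 d2; have [L1 [f1 [L10 f10 g1]]] := qderiv_lipschitz d1.
have [L2 [f2 [L20 f20 g2]]] := qderiv_lipschitz d2.
have [K1 [e1 [K10 e10 _ h1]]] := qderiv_pos d1.
have [K2 [e2 [K20 e20 _ h2]]] := qderiv_pos d2.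
exists (K1 * cmod (psi s0) + cmod (phi s0) * K2 + L1 * L2),
  (Num.min (Num.min e1 e2) (Num.min f1 f2)); split.
  by rewrite !lt_min e10 e20 f10 f20.
move=> s; rewrite !lt_min => /andP [/andP [s1 s2] /andP [s3 s4]].
set a := phi (s0 + s); set b := psi (s0 + s); set a0 := phi s0; set b0 := psi s0.
have -> : a * b - a0 * b0 - (l1 * b0 + a0 * l2) * rtoc s =
  (a - a0 - l1 * rtoc s) * b0 + a0 * (b - b0 - l2 * rtoc s) + (a - a0) * (b - b0).
  by ring.
apply: le_trans (cmodD _ _) _; rewrite [X in _ <= X]mulrDl [X in _ <= X + _]mulrDl.
apply: lerD.
  apply: le_trans (cmodD _ _) _; apply: lerD.
    by rewrite cmodM -mulrA [cmod b0 * _]mulrC mulrA ler_wpM2r ?cmod_ge0 ?h1.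
  by rewrite cmodM -mulrA ler_wpM2l ?cmod_ge0 ?h2.
rewrite cmodM; have -> : L1 * L2 * s ^+ 2 = (L1 * `|s|) * (L2 * `|s|).
  by rewrite -real_normK ?num_real //; ring.
by rewrite ler_pM ?cmod_ge0 ?g1 ?g2.
Qed.

Lemma qderiv_sum (I : Type) (r : seq I) (F : I -> R -> C) (l : I -> C) s0 :
  (forall i, qderiv (F i) s0 (l i)) ->
  qderiv (fun s => \sum_(i <- r) F i s) s0 (\sum_(i <- r) l i).
Proof.
move=> h; elim: r => [|i r ih].
  by rewrite big_nil; apply: qderiv_ext (qderiv_cst 0 s0) => s; rewrite big_nil.
rewrite big_cons; apply: qderiv_ext (qderivD (h i) ih) => s.
by rewrite big_cons.
Qed.

Lemma qderiv_unique phi s0 l1 l2 : qderiv phi s0 l1 -> qderiv phi s0 l2 -> l1 = l2.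
Proof.
move=> /qderiv_pos [K1 [e1 [K10 e10 _ h1]]] /qderiv_pos [K2 [e2 [K20 e20 _ h2]]].
apply/eqP; rewrite -subr_eq0; apply/eqP; apply: (@cmod_small_eq0 _ _ (K1 + K2)) => e e0.
pose s := Num.min e (Num.min e1 e2) / 2.
have m0 : 0 < Num.min e (Num.min e1 e2) by rewrite !lt_min e0 e10 e20.
have s0' : 0 < s by rewrite divr_gt0.
have sm : s < Num.min e (Num.min e1 e2) by rewrite ltr_pdivrMr // mulr_natr mulr2n ltrDl.
move: sm; rewrite !lt_min => /andP [se /andP [s1 s2]].
have sn : `|s| = s by rewrite gtr0_norm.
apply: (@le_trans _ _ ((K1 + K2) * s)); last by rewrite ler_wpM2l ?addr_ge0 // ltW.
rewrite -(ler_pM2r s0') -mulrA -expr2 -{1}sn -cmod_rtoc -cmodM.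
have -> : (l1 - l2) * rtoc s =
  (phi (s0 + s) - phi s0 - l2 * rtoc s) - (phi (s0 + s) - phi s0 - l1 * rtoc s) by ring.
apply: le_trans (cmodD _ _) _; rewrite cmodN mulrDl addrC.
by apply: lerD; [apply: h1|apply: h2]; rewrite sn.
Qed.

Lemma is_derive_quadratic (f : R -> R) (t l K e : R) : 0 < e ->
  (forall h, `|h| < e -> `|f (t + h) - f t - l * h| <= K * h ^+ 2) ->
  is_derive t 1 f l.
Proof.
move=> e0 hf.
have cv : h^-1 *: ((f \o shift t) (h *: (1 : R)) - f t) @[h --> 0^'] --> l.
  apply/cvgrPdist_le => eps eps0.
  have K1 : 0 < `|K| + 1 by rewrite ltr_wpDl.
  near=> h.
  have hn0 : h != 0 by near: h; exact: nbhs_dnbhs_neq.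
  have he : `|h| < e by near: h; exact: dnbhs0_lt.
  have hk : `|h| < eps / (`|K| + 1) by near: h; apply: dnbhs0_lt; rewrite divr_gt0.
  have -> : l - h^-1 *: ((f \o shift t) (h *: (1 : R)) - f t) =
      - (h^-1 * (f (t + h) - f t - l * h)).
    by rewrite /= /GRing.scale /= mulr1 [h + t]addrC; field.
  rewrite normrN normrM normfV.
  rewrite ler_pdivrMl ?normr_gt0 //.
  apply: le_trans (hf _ he) _; rewrite -real_normK ?num_real // expr2.
  rewrite mulrCA ler_wpM2l // .
  apply: le_trans (ler_wpM2r (normr_ge0 h) (ler_norm K)) _.
  apply: le_trans (ler_wpM2r (normr_ge0 h) (_ : _ <= `|K| + 1)) _; first by rewrite lerDl.
  by rewrite mulrC -ler_pdivlMr // ltW.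
apply: DeriveDef; first by apply/cvg_ex; exists l.
by apply: cvg_lim cv.
Unshelve. all: by end_near.
Qed.

Lemma qderiv_tderive phi t l : qderiv phi t l ->
  tderivable phi t /\ tderive phi t = l.
Proof.
move=> [K [e [e0 h]]].
have hR : is_derive t 1 (fun s => complex.Re (phi s) : R) (complex.Re l).
  apply: (is_derive_quadratic (K := K) e0) => s se.
  have := Re_le_cmod (phi (t + s) - phi t - l * rtoc s).
  by rewrite !Re_add !Re_opp Re_mulr => /le_trans; apply; apply: h.
have hI : is_derive t 1 (fun s => complex.Im (phi s) : R) (complex.Im l).
  apply: (is_derive_quadratic (K := K) e0) => s se.
  have := Im_le_cmod (phi (t + s) - phi t - l * rtoc s).
  by rewrite !Im_add !Im_opp Im_mulr => /le_trans; apply; apply: h.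
split; first by split; apply: ex_derive.
by rewrite /tderive (@derive_val _ _ _ _ _ _ _ hR) (@derive_val _ _ _ _ _ _ _ hI); case: l {h hR hI}.
Qed.

Lemma real_mean_value (f : R -> R) (a b B : R) : a <= b ->
  (forall s, a <= s <= b -> derivable f s 1) ->
  (forall s, a <= s <= b -> `|'D_1 f s| <= B) -> `|f b - f a| <= B * (b - a).
Proof.
move=> ab df hB; have [||c /= cab ->] := @MVT_segment R f ('D_1 f) a b ab.
- move=> s; rewrite in_itv /= => /andP [s1 s2]; apply: DeriveDef => //.
  by apply: df; rewrite !ltW.
- by apply: derivable_within_continuous => s; rewrite in_itv /= => /df.
rewrite normrM [X in _ * X]ger0_norm ?subr_ge0 // ler_wpM2r ?subr_ge0 //.
by apply: hB; move: cab; rewrite in_itv.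
Qed.

(** The factor 2 comes from estimating the real and imaginary parts separately. *)
Lemma mean_value phi (a b B : R) : a <= b ->
  (forall s, a <= s <= b -> tderivable phi s) ->
  (forall s, a <= s <= b -> cmod (tderive phi s) <= B) ->
  cmod (phi b - phi a) <= 2 * B * (b - a).
Proof.
move=> ab df hB; apply: le_trans (cmod_le_ReIm _) _.
rewrite !(Re_add, Im_add, Re_opp, Im_opp) -mulrA mulr_natl mulr2n; apply: lerD.
  apply: (@real_mean_value (fun s => complex.Re (phi s))) => // s sab.
    by have [] := df _ sab.
  exact: le_trans (Re_le_cmod (tderive phi s)) (hB _ sab).
apply: (@real_mean_value (fun s => complex.Im (phi s))) => // s sab.
  by have [] := df _ sab.
exact: le_trans (Im_le_cmod (tderive phi s)) (hB _ sab).
Qed.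

End QuadraticDerivative.

Section Analytic1.
Variable R : realType.
Local Notation C := (cplx R).
Implicit Types (phi psi : R -> C) (s : R).

(** Analyticity of a function of one real variable, as a family of polynomial
    approximations with geometric error whose coefficients have uniformly bounded
    weighted sum.  No truncation is prescribed, so that products of approximations
    are again approximations. *)
Definition approximable phi (t delta M : R) := forall N : nat,
  exists (q : {poly C}) (Q : {poly R}), [/\ dominated q Q, Q.[delta] <= M &
    forall s, `|s| < delta -> cmod (phi (t + s) - q.[rtoc s]) <= M * (`|s| / delta) ^+ N].

Definition analytic1 phi (t : R) := exists delta M : R,
  0 < delta /\ approximable phi t delta M.

Lemma approximable_ge0 phi t delta M : 0 < delta -> approximable phi t delta M -> 0 <= M.
Proof.
move=> d0 /(_ 0%N) [q [Q [h hM _]]]; apply: le_trans hM.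
by apply: horner_coefs_ge0 (ltW d0) => k; apply: dominated_ge0 h.
Qed.

Lemma approximable_shrink phi t delta delta' M M' : 0 < delta' -> delta' <= delta ->
  M <= M' -> approximable phi t delta M -> approximable phi t delta' M'.
Proof.
move=> d'0 dd MM h N; have d0 := lt_le_trans d'0 dd.
have M0 := approximable_ge0 d0 h; have [q [Q [dq hQ hq]]] := h N.
exists q, Q; split=> //.
  apply: le_trans MM; apply: le_trans hQ; apply: horner_ge0_le => //; last exact: ltW.
  by move=> k; apply: dominated_ge0 dq.
move=> s sd; apply: le_trans (hq _ (lt_le_trans sd dd)) _.
apply: ler_pM => //; first by rewrite exprn_ge0 // divr_ge0 // ltW.
apply: lerXn2r; rewrite ?nnegrE ?divr_ge0 ?(ltW d0) ?(ltW d'0) //.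
by rewrite ler_wpM2l // lef_pV2 ?posrE.
Qed.

Lemma approximable_bound phi t delta M s : 0 < delta -> approximable phi t delta M ->
  `|s| < delta -> cmod (phi (t + s)) <= 2 * M.
Proof.
move=> d0 /(_ 0%N) [q [Q [dq hQ hq]]] sd.
apply: le_trans (cmod_le_dist _ q.[rtoc s]) _.
rewrite mulr_natl mulr2n; apply: lerD.
  exact: le_trans (dominated_horner dq d0 (ltW sd)) hQ.
by have := hq _ sd; rewrite expr0 mulr1.
Qed.

Lemma analytic1_ext phi psi t (e : R) : 0 < e ->
  (forall s, `|s| < e -> phi (t + s) = psi (t + s)) ->
  analytic1 phi t -> analytic1 psi t.
Proof.
move=> e0 he [d [M [d0 h]]]; exists (Num.min e d), M.
have m0 : 0 < Num.min e d by rewrite lt_min e0.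
split=> //; have md : Num.min e d <= d by rewrite ge_min lexx orbT.
move=> N; have [q [Q [dq hQ hq]]] := approximable_shrink m0 md (lexx M) h N.
exists q, Q; split=> // s sd; rewrite -he; first exact: hq.
by move: sd; rewrite lt_min => /andP [].
Qed.

Lemma analytic1_cst (c : C) t : analytic1 (fun=> c) t.
Proof.
exists 1, (cmod c); split=> // N; exists c%:P, (cmod c)%:P; split.
- exact: dominatedC.
- by rewrite hornerC.
- by move=> s _; rewrite hornerC subrr cmod0 divr1 mulr_ge0 ?cmod_ge0 ?exprn_ge0.
Qed.

Lemma analytic1D phi psi t : analytic1 phi t -> analytic1 psi t ->
  analytic1 (fun s => phi s + psi s) t.
Proof.
move=> [d1 [M1 [d10 h1]]] [d2 [M2 [d20 h2]]].
have m0 : 0 < Num.min d1 d2 by rewrite lt_min d10.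
have m1 : Num.min d1 d2 <= d1 by rewrite ge_min lexx.
have m2 : Num.min d1 d2 <= d2 by rewrite ge_min lexx orbT.
have {}h1 := approximable_shrink m0 m1 (lexx _) h1.
have {}h2 := approximable_shrink m0 m2 (lexx _) h2.
exists (Num.min d1 d2), (M1 + M2); split=> // N.
have [q1 [Q1 [dq1 hQ1 hq1]]] := h1 N; have [q2 [Q2 [dq2 hQ2 hq2]]] := h2 N.
exists (q1 + q2), (Q1 + Q2); split; first exact: dominatedD.
  by rewrite hornerD lerD.
move=> s sd; rewrite hornerD.
have -> : phi (t + s) + psi (t + s) - (q1.[rtoc s] + q2.[rtoc s]) =
  (phi (t + s) - q1.[rtoc s]) + (psi (t + s) - q2.[rtoc s]) by ring.
by apply: le_trans (cmodD _ _) _; rewrite mulrDl lerD ?hq1 ?hq2.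
Qed.

Lemma analytic1M phi psi t : analytic1 phi t -> analytic1 psi t ->
  analytic1 (fun s => phi s * psi s) t.
Proof.
move=> [d1 [M1 [d10 h1]]] [d2 [M2 [d20 h2]]].
have m0 : 0 < Num.min d1 d2 by rewrite lt_min d10.
have m1 : Num.min d1 d2 <= d1 by rewrite ge_min lexx.
have m2 : Num.min d1 d2 <= d2 by rewrite ge_min lexx orbT.
have {}h1 := approximable_shrink m0 m1 (lexx _) h1.
have {}h2 := approximable_shrink m0 m2 (lexx _) h2.
have M10 := approximable_ge0 m0 h1; have M20 := approximable_ge0 m0 h2.
exists (Num.min d1 d2), (3 * (M1 * M2)); split=> // N.
have [q1 [Q1 [dq1 hQ1 hq1]]] := h1 N; have [q2 [Q2 [dq2 hQ2 hq2]]] := h2 N.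
exists (q1 * q2), (Q1 * Q2); split; first exact: dominatedM.
  rewrite hornerM; apply: (@le_trans _ _ (M1 * M2)).
    apply: ler_pM => //; apply: horner_coefs_ge0 (ltW m0) => k;
    [exact: dominated_ge0 dq1|exact: dominated_ge0 dq2].
  by rewrite ler_peMl ?mulr_ge0 // ler1n.
move=> s sd; rewrite hornerM.
have -> : phi (t + s) * psi (t + s) - q1.[rtoc s] * q2.[rtoc s] =
  (phi (t + s) - q1.[rtoc s]) * psi (t + s) +
  q1.[rtoc s] * (psi (t + s) - q2.[rtoc s]) by ring.
have th0 : 0 <= (`|s| / Num.min d1 d2) ^+ N by rewrite exprn_ge0 // divr_ge0 // ltW.
apply: le_trans (cmodD _ _) _; rewrite !cmodM.
have -> : 3 * (M1 * M2) * (`|s| / Num.min d1 d2) ^+ N =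
  (M1 * (`|s| / Num.min d1 d2) ^+ N) * (2 * M2) +
  M1 * (M2 * (`|s| / Num.min d1 d2) ^+ N) by ring.
apply: lerD; apply: ler_pM; rewrite ?cmod_ge0 ?hq1 ?hq2 //.
  exact: approximable_bound m0 h2 sd.
exact: le_trans (dominated_horner dq1 m0 (ltW sd)) hQ1.
Qed.

Lemma analytic1N phi t : analytic1 phi t -> analytic1 (fun s => - phi s) t.
Proof.
move=> h; apply: (analytic1_ext ltr01) (analytic1M (analytic1_cst (-1) t) h) => s _.
by rewrite mulN1r.
Qed.

Lemma analytic1B phi psi t : analytic1 phi t -> analytic1 psi t ->
  analytic1 (fun s => phi s - psi s) t.
Proof. by move=> h1 h2; apply: analytic1D => //; apply: analytic1N. Qed.

Lemma analytic1_sum (I : Type) (r : seq I) (P : pred I) (F : I -> R -> C) t :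
  (forall i, P i -> analytic1 (F i) t) ->
  analytic1 (fun s => \sum_(i <- r | P i) F i s) t.
Proof.
move=> h; elim: r => [|i r ih].
  by apply: (analytic1_ext ltr01) (analytic1_cst 0 t) => s _; rewrite big_nil.
have [Pi|nPi] := boolP (P i).
  by apply: (analytic1_ext ltr01) (analytic1D (h i Pi) ih) => s _; rewrite big_cons Pi.
by apply: (analytic1_ext ltr01) ih => s _; rewrite big_cons (negPf nPi).
Qed.

Lemma analytic1_prod (I : Type) (r : seq I) (P : pred I) (F : I -> R -> C) t :
  (forall i, P i -> analytic1 (F i) t) ->
  analytic1 (fun s => \prod_(i <- r | P i) F i s) t.
Proof.
move=> h; elim: r => [|i r ih].
  by apply: (analytic1_ext ltr01) (analytic1_cst 1 t) => s _; rewrite big_nil.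
have [Pi|nPi] := boolP (P i).
  by apply: (analytic1_ext ltr01) (analytic1M (h i Pi) ih) => s _; rewrite big_cons Pi.
by apply: (analytic1_ext ltr01) ih => s _; rewrite big_cons (negPf nPi).
Qed.

Lemma analytic1X phi t k : analytic1 phi t -> analytic1 (fun s => phi s ^+ k) t.
Proof.
move=> h; elim: k => [|k ih]; first exact: (analytic1_cst 1 t).
by apply: (analytic1_ext ltr01) (analytic1M h ih) => s _; rewrite exprS.
Qed.

Lemma analytic1_det k (F : 'I_k -> 'I_k -> R -> C) t :
  (forall i j, analytic1 (F i j) t) ->
  analytic1 (fun s => \det (\matrix_(i, j) F i j s)) t.
Proof.
move=> h; rewrite /determinant; apply: analytic1_sum => sg _.
apply: analytic1M; first exact: analytic1_cst.
apply: analytic1_prod => i _.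
by apply: (analytic1_ext ltr01) (h i (perm.fun_of_perm sg i)) => s _; rewrite mxE.
Qed.

Lemma analytic1_affine phi (t a b : R) : analytic1 phi (a * t + b) ->
  analytic1 (fun s => phi (a * s + b)) t.
Proof.
move=> [d [M [d0 h]]].
have a1 : 0 < `|a| + 1 by rewrite ltr_wpDl.
exists (d / (`|a| + 1)), M; split=> [|N]; first by rewrite divr_gt0.
have [q [Q [dq hQ hq]]] := h N.
have da : `|a| * (d / (`|a| + 1)) <= d.
  by rewrite mulrCA ger_pMr // ler_pdivrMr // mul1r lerDl.
exists (q \Po (rtoc a *: 'X)), (Q \Po (`|a| *: 'X)).
have cP (K : comNzRingType) (p : {poly K}) c k : (p \Po (c *: 'X))`_k = p`_k * c ^+ k.
  rewrite comp_polyE coef_sum.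
  have E i : (p`_i *: (c *: 'X) ^+ i)`_k = if i == k then p`_k * c ^+ k else 0.
    rewrite exprZn !coefZ coefXn eq_sym; case: eqP => [->|_]; by rewrite ?mulr1 ?mulr0.
  under eq_bigr => i _ do rewrite E.
  have [hk|hk] := ltnP k (size p).
    rewrite (bigD1 (Ordinal hk)) //= eqxx big1 ?addr0 // => i ni.
    by case: eqP => // e; case/eqP: ni; apply: val_inj.
  by rewrite nth_default // mul0r big1 // => i _; case: eqP.
split.
- move=> k; rewrite !cP cmodM cmodX cmod_rtoc ler_wpM2r ?exprn_ge0 //; exact: dq.
- rewrite horner_comp hornerZ hornerX; apply: le_trans hQ; apply: horner_ge0_le da.
    by move=> k; apply: dominated_ge0 dq.
  by rewrite mulr_ge0 // divr_ge0 // ltW.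
move=> s sd; rewrite horner_comp hornerZ hornerX -rtocM.
have -> : a * (t + s) + b = a * t + b + a * s by ring.
have asd : `|a * s| < d.
  rewrite normrM; apply: (@le_lt_trans _ _ ((`|a| + 1) * `|s|)).
    by rewrite ler_wpM2r // lerDl.
  by move: sd; rewrite ltr_pdivlMr // mulrC.
apply: le_trans (hq _ asd) _; rewrite ler_wpM2l ?(approximable_ge0 d0 h) //.
have -> : `|s| / (d / (`|a| + 1)) = (`|a| + 1) * `|s| / d.
  by field; rewrite !gt_eqF.
have d0' := ltW d0; have a1' := ltW a1.
apply: lerXn2r; rewrite ?nnegrE ?divr_ge0 ?mulr_ge0 // normrM.
by rewrite ler_wpM2r ?invr_ge0 // ler_wpM2r // lerDl.
Qed.

End Analytic1.

Section IdentityTheorem.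
Variable R : realType.
Local Notation C := (cplx R).
Implicit Types (phi psi : R -> C) (s : R).

Lemma expr_small (theta e : R) : 0 <= theta -> theta < 1 -> 0 < e ->
  exists N, theta ^+ N < e.
Proof.
move=> t0 t1 e0; have th : `|theta| < 1 by rewrite ger0_norm.
have /cvgrPdist_lt /(_ e e0) [N _ hN] := cvg_expr th.
exists N; have := hN N (leqnn N); rewrite sub0r normrN ger0_norm ?exprn_ge0 //.
Qed.

Lemma geometric_bound_eq0 (z : C) (K theta : R) : 0 <= K -> 0 <= theta -> theta < 1 ->
  (forall N, cmod z <= K * theta ^+ N) -> z = 0.
Proof.
move=> K0 t0 t1 h; apply: (@cmod_small_eq0 _ _ K) => e e0.
have [N hN] := expr_small t0 t1 e0.
by apply: le_trans (h N) _; rewrite ler_wpM2l // ltW.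
Qed.

Lemma poly_small_coefs (q : {poly C}) (K e : R) N : 0 <= K -> 0 < e ->
  (forall s, 0 < s -> s < e -> cmod q.[rtoc s] <= K * s ^+ N) ->
  forall k, (k < N)%N -> q`_k = 0.
Proof.
elim: N q => [//|N ih] q K0 e0 h.
pose q' := drop_poly 1 q.
have eq x : q.[x] = q`_0 + q'.[x] * x.
  have {1}-> : q = (q`_0)%:P + q' * 'X.
    apply/polyP => k; rewrite coefD coefC coefMX /q'.
    by case: k => [|k] /=; rewrite ?addr0 // coef_drop_poly add0r addn1.
  by rewrite !hornerE.
pose Q' : {poly R} := \poly_(k < size q') cmod q'`_k.
have dq' : dominated q' Q'.
  move=> k; rewrite [X in _ <= X]coef_poly; have [hk|hk] := ltnP k (size q'); first by [].
  by rewrite nth_default ?cmod0.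
have Q1 : 0 <= Q'.[1] by apply: horner_coefs_ge0 => // k; apply: dominated_ge0 dq'.
have q0 : q`_0 = 0.
  apply: (@cmod_small_eq0 _ _ (K + Q'.[1])) => eps eps0.
  pose s := Num.min (Num.min e 1) eps / 2.
  have m0 : 0 < Num.min (Num.min e 1) eps by rewrite !lt_min e0 ltr01 eps0.
  have s0 : 0 < s by rewrite divr_gt0.
  have sm : s < Num.min (Num.min e 1) eps by rewrite ltr_pdivrMr // mulr_natr mulr2n ltrDl.
  move: sm; rewrite !lt_min => /andP [/andP [se s1] seps].
  apply: (@le_trans _ _ ((K + Q'.[1]) * s)); last by rewrite ler_wpM2l ?addr_ge0 // ltW.
  have -> : q`_0 = q.[rtoc s] - q'.[rtoc s] * rtoc s by rewrite eq addrK.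
  apply: le_trans (cmodD _ _) _; rewrite mulrDl; apply: lerD.
    apply: le_trans (h _ s0 se) _; rewrite ler_wpM2l // exprS ger_pMr //.
    by rewrite exprn_ile1 // ltW.
  rewrite cmodN cmodM cmod_rtoc (gtr0_norm s0) ler_wpM2r ?(ltW s0) //.
  by apply: dominated_horner dq' _ _ => //; rewrite gtr0_norm // ltW.
have h' s : 0 < s -> s < e -> cmod q'.[rtoc s] <= K * s ^+ N.
  move=> s0 se; rewrite -(ler_pM2r s0) -mulrA -exprSr.
  by have := h _ s0 se; rewrite eq q0 add0r cmodM cmod_rtoc gtr0_norm.
case=> [_|k kN]; first by [].
by have := ih q' K0 e0 h' k kN; rewrite coef_drop_poly addn1.
Qed.

(** A function analytic at t that is flat at t from the right vanishes near t:
    its N-th approximation has no terms of degree less than N, hence is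
    geometrically small in N. *)
Lemma flat_eq0 phi t : analytic1 phi t ->
  (forall N, exists K e : R, 0 < e /\
     forall s, 0 < s -> s < e -> cmod (phi (t + s)) <= K * s ^+ N) ->
  exists e : R, 0 < e /\ forall s, `|s| < e -> phi (t + s) = 0.
Proof.
move=> [d [M [d0 h]]] flat; have M0 := approximable_ge0 d0 h.
exists d; split=> // s sd.
have t0 : 0 <= `|s| / d by rewrite divr_ge0 // ltW.
have t1 : `|s| / d < 1 by rewrite ltr_pdivrMr // mul1r.
apply: (@geometric_bound_eq0 _ (2 * M) _ _ t0 t1); first by rewrite mulr_ge0.
move=> N; have [q [Q [dq hQ hq]]] := h N; have [K [e [e0 he]]] := flat N.
have low : forall k, (k < N)%N -> q`_k = 0.
  apply: (@poly_small_coefs q (`|K| + M / d ^+ N) (Num.min e d)).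
  - by rewrite addr_ge0 // divr_ge0 // exprn_ge0 // ltW.
  - by rewrite lt_min e0.
  move=> u u0; rewrite lt_min => /andP [ue ud].
  have un : `|u| = u by rewrite gtr0_norm.
  apply: le_trans (cmod_le_dist _ (phi (t + u))) _; rewrite mulrDl cmodB; apply: lerD.
    apply: le_trans (he _ u0 ue) _; rewrite ler_wpM2r ?ler_norm // exprn_ge0 // ltW //.
  have := hq u; rewrite un => /(_ ud); rewrite expr_div_n => /le_trans; apply.
  by rewrite mulrA mulrAC.
apply: le_trans (cmod_le_dist _ q.[rtoc s]) _.
rewrite -mulrA mulr_natl mulr2n; apply: lerD; last exact: hq.
apply: le_trans (dominated_horner_low dq low d0 (ltW sd)) _.
by rewrite mulrC ler_wpM2r // exprn_ge0.
Qed.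

(** If the function is not flat at t, its approximations have a nonzero coefficient
    of some degree; the one of least degree k makes the function comparable to
    s ^ k near t. *)
Lemma analytic1_isolated phi t : analytic1 phi t ->
  (exists e : R, 0 < e /\ forall s, `|s| < e -> phi (t + s) = 0) \/
  (exists e : R, 0 < e /\ forall s, 0 < `|s| -> `|s| < e -> phi (t + s) != 0).
Proof.
move=> an; have [flat|nflat] := pselect (forall N, exists K e : R, 0 < e /\
     forall s, 0 < s -> s < e -> cmod (phi (t + s)) <= K * s ^+ N).
  by left; apply: flat_eq0.
right; move/existsNP: nflat => [N nN].
have [d [M [d0 h]]] := an; have M0 := approximable_ge0 d0 h.
have [q [Q [dq hQ hq]]] := h N.
have ex : exists k, (k < N)%N && (q`_k != 0).
  apply: contrapT => nex; apply: nN; exists (2 * M / d ^+ N), d; split=> // s s0 sd.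
  have sn : `|s| = s by rewrite gtr0_norm.
  have low k : (k < N)%N -> q`_k = 0.
    by move=> kN; apply: contrapT => /eqP nk; apply: nex; exists k; rewrite kN.
  apply: le_trans (cmod_le_dist _ q.[rtoc s]) _.
  rewrite mulrAC -mulrA -expr_div_n -mulrA mulr_natl mulr2n; apply: lerD.
    have := dominated_horner_low dq low d0 (s := s); rewrite sn => /(_ (ltW sd)) /le_trans; apply.
    by rewrite mulrC ler_wpM2r // exprn_ge0 // divr_ge0 // ltW.
  by have := hq s; rewrite sn => /(_ sd).
pose k := ex_minn ex; have : (k < N)%N && (q`_k != 0) by rewrite /k; case: ex_minnP.
have kmin l : (l < k)%N -> q`_l = 0.
  rewrite /k; case: ex_minnP => j /andP [jN _] jmin lj; apply/eqP; apply: contraT => nl.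
  by have := jmin l; rewrite nl (ltn_trans lj jN) => /(_ isT); rewrite leqNgt lj.
move=> /andP [kN qk]; clearbody k.
have D0 : 0 < 2 * M / d ^+ k.+1 + 1.
  by rewrite ltr_wpDl // divr_ge0 ?mulr_ge0 // exprn_ge0 // ltW.
exists (Num.min d (cmod q`_k / (2 * M / d ^+ k.+1 + 1))); split.
  by rewrite lt_min d0 divr_gt0 // cmod_gt0.
move=> s s0; rewrite lt_min => /andP [sd]; rewrite ltr_pdivlMr // => sq.
apply/eqP => phi0.
pose q1 := q - (q`_k)%:P * 'X^k.
have dq1 : dominated q1 Q.
  move=> l; rewrite /q1 coefB coefCM coefXn; case: eqP => [->|_].
    by rewrite mulr1 subrr cmod0; apply: dominated_ge0 dq.
  by rewrite mulr0 subr0.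
have low1 l : (l < k.+1)%N -> q1`_l = 0.
  rewrite ltnS leq_eqVlt /q1 coefB coefCM coefXn => /orP [/eqP ->|lk].
    by rewrite eqxx mulr1 subrr.
  by rewrite (kmin l lk) ltn_eqF // mulr0 subr0.
have : cmod (q`_k * rtoc s ^+ k) <= 2 * M * (`|s| / d) ^+ k.+1.
  have -> : q`_k * rtoc s ^+ k = - ((phi (t + s) - q.[rtoc s]) + q1.[rtoc s]).
    by rewrite phi0 /q1 hornerD hornerN hornerM hornerC hornerXn; ring.
  rewrite cmodN; apply: le_trans (cmodD _ _) _.
  have t0 : 0 <= `|s| / d by rewrite divr_ge0 // ltW.
  rewrite -mulrA mulr_natl mulr2n; apply: lerD.
    apply: le_trans (hq _ sd) _; rewrite ler_wpM2l // ler_wiXn2l //.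
    by rewrite ler_pdivrMr // mul1r ltW.
  apply: le_trans (dominated_horner_low dq1 low1 d0 (ltW sd)) _.
  by rewrite mulrC ler_wpM2r // exprn_ge0.
apply/negP; rewrite -ltNge cmodM cmodX cmod_rtoc expr_div_n.
have -> : 2 * M * (`|s| ^+ k.+1 / d ^+ k.+1) = (2 * M / d ^+ k.+1 * `|s|) * `|s| ^+ k.
  by rewrite exprS; ring.
rewrite ltr_pM2r ?exprn_gt0 //; apply: le_lt_trans sq; rewrite [X in _ <= X]mulrC.
by rewrite ler_wpM2r // lerDl.
Qed.

(** Up to the supremum c of the times before which phi vanishes, the zeros of phi
    accumulate at c; so c is not an isolated zero, and phi also vanishes beyond c,
    unless c = b. *)
Lemma identity_segment phi (a b : R) : a <= b ->
  (forall s, a <= s <= b -> analytic1 phi s) ->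
  (exists e : R, 0 < e /\ forall s, `|s| < e -> phi (a + s) = 0) -> phi b = 0.
Proof.
move=> ab an [e [e0 he]].
pose S : set R := [set s | a <= s <= b /\ forall u, a <= u <= s -> phi u = 0].
have Sa : S a.
  split; first by rewrite lexx.
  by move=> u /le_anti <-; rewrite -[a]addr0 he // normr0.
have Sb : ubound S b by move=> s [/andP []].
have hS : has_sup S by split; [exists a|exists b].
pose c := sup S.
have ca : a <= c by apply: sup_upper_bound.
have cb : c <= b by apply: sup_le_ub => //; exists a.
have below u : a <= u -> u < c -> phi u = 0.
  move=> au uc; have uc0 : 0 < c - u by rewrite subr_gt0.
  have [s [_ sS] us] := sup_adherent uc0 hS.
  by apply: sS; rewrite au ltW //; move: us; rewrite -/c subKr.
have [|loc|[e1 [e10 h1]]] := analytic1_isolated (an c _); first by rewrite ca.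
  have [e1 [e10 h1]] := loc.
  have h2 u : c <= u -> u < c + e1 -> phi u = 0.
    move=> cu uc; rewrite -[u](subrKC c) h1 // ger0_norm ?subr_ge0 //.
    by rewrite ltrBlDl.
  suff : b <= c.
    move=> bc; apply: h2 => //; apply: le_lt_trans bc _; by rewrite ltrDl.
  have : S (Num.min b (c + e1 / 2)).
    split; first by rewrite le_min ab ge_min lexx /= (le_trans ca) // lerDl divr_ge0 // ltW.
    move=> u /andP [au]; rewrite le_min => /andP [_ uc].
    have [|cu] := ltP u c; first exact: below.
    apply: h2 => //; apply: le_lt_trans uc _; rewrite ltrD2l.
    by rewrite ltr_pdivrMr // mulr_natr mulr2n ltrDl.
  move=> /(sup_upper_bound hS); rewrite ge_min => /orP [//|].
  by rewrite -/c gerDl leNgt divr_gt0.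
exfalso; have [ac|nac] := eqVneq a c.
  pose s := Num.min e e1 / 2.
  have m0 : 0 < Num.min e e1 by rewrite !lt_min e0.
  have s0 : 0 < s by rewrite divr_gt0.
  have sm : s < Num.min e e1 by rewrite ltr_pdivrMr // mulr_natr mulr2n ltrDl.
  move: sm; rewrite lt_min => /andP [se se1].
  have := h1 s; rewrite -ac gtr0_norm // he ?gtr0_norm // eqxx.
  by move=> /(_ s0 se1).
have {}ac : a < c by rewrite lt_neqAle nac.
pose s := Num.min (c - a) e1 / 2.
have m0 : 0 < Num.min (c - a) e1 by rewrite !lt_min subr_gt0 ac.
have s0 : 0 < s by rewrite divr_gt0.
have sm : s < Num.min (c - a) e1 by rewrite ltr_pdivrMr // mulr_natr mulr2n ltrDl.
move: sm; rewrite lt_min => /andP [se se1].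
have := h1 (- s); rewrite normrN gtr0_norm // below ?eqxx; first by move=> /(_ s0 se1).
  by rewrite lerBrDr -lerBrDl ltW.
by rewrite ltrBlDr ltrDl.
Qed.

(** Times before a are reached by reflection. *)
Lemma identity_line phi (a : R) : (forall s, analytic1 phi s) ->
  (exists e : R, 0 < e /\ forall s, `|s| < e -> phi (a + s) = 0) ->
  forall b, phi b = 0.
Proof.
move=> an [e [e0 he]] b; have [ab|/ltW ba] := leP a b.
  by apply: (identity_segment ab) => //; exists e.
have := @identity_segment (fun s => phi (-1 * s + 0)) (- a) (- b).
rewrite mulN1r opprK addr0; apply; first by rewrite lerN2.
  by move=> s _; apply: analytic1_affine.
exists e; split=> // s se.
by rewrite mulN1r addr0 opprD opprK he // normrN.
Qed.

Lemma analytic1_qderiv phi t : analytic1 phi t -> exists l, qderiv phi t l.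
Proof.
move=> [d [M [d0 h]]]; have M0 := approximable_ge0 d0 h.
have [q [Q [dq hQ hq]]] := h 2%N.
have p0 : phi t = q`_0.
  have := hq 0; rewrite normr0 => /(_ d0); rewrite mul0r expr0n /= mulr0.
  move=> h0; apply/eqP; rewrite -subr_eq0 -cmod_eq0 eq_le cmod_ge0 andbT.
  by rewrite -horner_coef0; move: h0; rewrite addr0.
pose q1 := q - (q`_0)%:P - (q`_1)%:P * 'X.
exists q`_1, (2 * M / d ^+ 2), d; split=> // s sd.
have dq1 : dominated q1 Q.
  case=> [|[|k]]; rewrite /q1 !coefB coefCM coefC coefX /= ?mulr0 ?mulr1 ?subr0 ?subrr ?cmod0.
  - exact: dominated_ge0 dq.
  - exact: dominated_ge0 dq.
  - exact: dq.
have low1 l : (l < 2)%N -> q1`_l = 0.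
  by case: l => [|[|l]] // _; rewrite /q1 !coefB coefCM coefC coefX /= ?mulr0 ?mulr1 ?subr0 ?subrr.
have -> : phi (t + s) - phi t - q`_1 * rtoc s =
    (phi (t + s) - q.[rtoc s]) + q1.[rtoc s] by rewrite p0 /q1 !(hornerD, hornerN) hornerM !hornerC hornerX; ring.
apply: le_trans (cmodD _ _) _.
have -> : 2 * M / d ^+ 2 * s ^+ 2 = M * (`|s| / d) ^+ 2 + (`|s| / d) ^+ 2 * M.
  by rewrite expr_div_n real_normK ?num_real //; ring.
apply: lerD; first exact: hq.
apply: le_trans (dominated_horner_low dq1 low1 d0 (ltW sd)) _.
by rewrite ler_wpM2l // exprn_ge0 // divr_ge0 // ltW.
Qed.

End IdentityTheorem.

(** * Linear differential equations with analytic coefficients *)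

Section LinearODE.
Variable R : realType.
Local Notation C := (cplx R).

Lemma approximable_uniform (I : finType) (F : I -> R -> C) t :
  (forall i, analytic1 (F i) t) ->
  exists delta M : R, [/\ 0 < delta, 0 <= M & forall i, approximable (F i) t delta M].
Proof.
move=> h.
suff : forall r : seq I, exists delta M : R, [/\ 0 < delta, 0 <= M &
    forall i, i \in r -> approximable (F i) t delta M].
  by move=> /(_ (enum I)) [d [M [d0 M0 hr]]]; exists d, M; split=> // i; apply: hr; rewrite mem_enum.
elim=> [|i r [d [M [d0 M0 hr]]]]; first by exists 1, 0.
have [d1 [M1 [d10 h1]]] := h i; have M10 := approximable_ge0 d10 h1.
exists (Num.min d d1), (M + M1); split; first by rewrite lt_min d0.
  exact: addr_ge0.
have m0 : 0 < Num.min d d1 by rewrite lt_min d0.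
move=> j; rewrite inE => /orP [/eqP ->|jr].
  by apply: approximable_shrink h1 => //; rewrite ?ge_min ?lexx ?orbT // lerDr.
by apply: (approximable_shrink _ _ _ (hr j jr)) => //; rewrite ?ge_min ?lexx // lerDl.
Qed.

Lemma qderiv_horner (q : {poly C}) (t s : R) :
  qderiv (fun u => q.[rtoc (u - t)]) s q^`().[rtoc (s - t)].
Proof.
elim/poly_ind: q => [|q c ih].
  rewrite derivC horner0; apply: qderiv_ext (qderiv_cst 0 s) => u.
  by rewrite horner0.
have hX : qderiv (fun u : R => rtoc (u - t)) s 1.
  exists 0, 1; split=> // h _; rewrite mul1r mul0r.
  by rewrite -!rtocB [X in rtoc X](_ : _ = 0) ?rtoc0 ?cmod0 //; ring.
have := qderivD (qderivM ih hX) (qderiv_cst c s).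
rewrite derivD derivC derivM derivX !addr0 !mulr1 hornerD hornerM hornerX.
by apply: qderiv_ext => u; rewrite hornerD hornerM hornerX hornerC.
Qed.

Definition primitive (q : {poly C}) : {poly C} :=
  \poly_(k < (size q).+1) (if k is l.+1 then q`_l / (l.+1)%:R else 0).

Lemma coef_primitive q k :
  (primitive q)`_k = if k is l.+1 then q`_l / (l.+1)%:R else 0.
Proof.
rewrite coef_poly; case: k => [|k] //=.
by rewrite ltnS; case: ltnP => // hk; rewrite nth_default // mul0r.
Qed.

Lemma deriv_primitive q : (primitive q)^`() = q.
Proof.
apply/polyP => k; rewrite coef_deriv coef_primitive /=.
by rewrite -[LHS]mulr_natr mulfVK // pnatr_eq0.
Qed.

Lemma cmod_nat k : cmod (k%:R : C) = k%:R.
Proof.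
have -> : k%:R = rtoc (k%:R) :> C by apply/esym/(rmorph_nat (real_complex R)).
by rewrite cmod_rtoc normr_nat.
Qed.

Lemma dominated_primitive (q : {poly C}) (Q : {poly R}) : dominated q Q ->
  dominated (primitive q) ('X * Q).
Proof.
move=> h k; rewrite coef_primitive coefXM; case: k => [|k] /=; first by rewrite cmod0.
rewrite cmodM cmodV cmod_nat; apply: le_trans (h k).
by rewrite ler_pdivrMr ?ltr0n // ler_peMr ?cmod_ge0 // ler1n.
Qed.

Lemma tderivableB (u v : R -> C) s : tderivable u s -> tderivable v s ->
  tderivable (fun a => u a - v a) s /\
  tderive (fun a => u a - v a) s = tderive u s - tderive v s.
Proof.
move=> [u1 u2] [v1 v2].
have eR : (fun a => complex.Re (u a - v a) : R) =
    (fun a => complex.Re (u a)) - (fun a => complex.Re (v a)).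
  by apply/funext => a; rewrite Re_add Re_opp.
have eI : (fun a => complex.Im (u a - v a) : R) =
    (fun a => complex.Im (u a)) - (fun a => complex.Im (v a)).
  by apply/funext => a; rewrite Im_add Im_opp.
split; first by split; rewrite ?eR ?eI; apply: derivableB.
by rewrite /tderive eR eI !deriveB.
Qed.

Lemma tderivable_bounded (u : R -> C) t : tderivable u t ->
  exists K e : R, [/\ 0 <= K, 0 < e & forall s, `|s| < e -> cmod (u (t + s)) <= K].
Proof.
move=> [d1 d2].
have bnd (f : R -> R) : derivable f t 1 -> exists K e : R,
    [/\ 0 <= K, 0 < e & forall s, `|s| < e -> `|f (t + s)| <= K].
  move=> /derivable1_diffP /differentiable_continuous /cvgrPdist_lt /(_ 1 ltr01).
  rewrite near_nbhs => /nbhs_ballP [e /= e0 he].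
  exists (`|f t| + 1), e; split; [exact: addr_ge0|exact: e0|].
  move=> s se; have : ball t e (t + s) by rewrite /ball /= opprD addrA subrr sub0r normrN.
  move=> /he /= /ltW; rewrite distrC => h.
  by rewrite -[f (t + s)](subrKC (f t)); apply: le_trans (ler_normD _ _) _; rewrite lerD2l.
have [K1 [e1 [K10 e10 h1]]] := bnd _ d1; have [K2 [e2 [K20 e20 h2]]] := bnd _ d2.
exists (K1 + K2), (Num.min e1 e2); split; [exact: addr_ge0|by rewrite lt_min e10|].
move=> s; rewrite lt_min => /andP [s1 s2].
by apply: le_trans (cmod_le_ReIm _) _; rewrite lerD ?h1 ?h2.
Qed.

Variable n : nat.
Variables (A : 'I_n -> 'I_n -> R -> C) (x : 'I_n -> R -> C).
Hypothesis A_analytic : forall i j t, analytic1 (A i j) t.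
Hypothesis x_derivable : forall i t, tderivable (x i) t.
Hypothesis x_solution : forall i t, tderive (x i) t = \sum_j A i j t * x j t.

(** Picard iteration with polynomials: one more integration gains one more factor
    of |s| / delta, by the mean value inequality. *)
Lemma linear_ode_analytic i t : analytic1 (x i) t.
Proof.
have [d [M [d0 M0 hA]]] := @approximable_uniform ('I_n * 'I_n)%type
  (fun p => A p.1 p.2) t (fun p => A_analytic p.1 p.2 t).
have [K0 [e [K00 e0 hx]]] : exists K e : R, [/\ 0 <= K, 0 < e &
    forall i s, `|s| < e -> cmod (x i (t + s)) <= K].
  suff : forall r : seq 'I_n, exists K e : R, [/\ 0 <= K, 0 < e &
      forall i, i \in r -> forall s, `|s| < e -> cmod (x i (t + s)) <= K].
    by move=> /(_ (enum 'I_n)) [K [e [h1 h2 h3]]]; exists K, e; split=> // j; apply: h3; rewrite mem_enum.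
  elim=> [|j r [K [e [h1 h2 h3]]]]; first by exists 0, 1.
  have [K1 [e1 [K10 e10 h]]] := tderivable_bounded (x_derivable j t).
  exists (K + K1), (Num.min e e1); split; [exact: addr_ge0|by rewrite lt_min h2|].
  move=> l; rewrite inE => /orP [/eqP ->|lr] s; rewrite lt_min => /andP [s1 s2].
    by apply: le_trans (h s s2) _; rewrite lerDr.
  by apply: le_trans (h3 l lr s s1) _; rewrite lerDl.
(* On a radius smaller than 1 / (4 n M) the integral operator is a contraction,
   so all iterates satisfy the same bound K. *)
pose L := 4 * n%:R * M + 1.
have L0 : 0 < L by rewrite ltr_wpDl // !mulr_ge0.
pose d1 := Num.min (Num.min d e) (L^-1).
have d10 : 0 < d1 by rewrite !lt_min d0 e0 invr_gt0.
have d1d : d1 <= d by rewrite /d1 !ge_min lexx.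
have d1e : d1 <= e by rewrite /d1 !ge_min lexx orbT.
have d1L : d1 * (4 * n%:R * M) <= 1.
  apply: (@le_trans _ _ (L^-1 * (4 * n%:R * M))).
    by rewrite ler_wpM2r ?mulr_ge0 // /d1 ge_min lexx orbT.
  by rewrite mulrC ler_pdivrMr // mul1r lerDl.
have {}hA p : approximable (A p.1 p.2) t d1 M by apply: approximable_shrink (hA p).
pose K := 2 * K0.
have KK : 0 <= K by rewrite mulr_ge0.
suff H N : forall l, exists (q : {poly C}) (Q : {poly R}), [/\ dominated q Q, Q.[d1] <= K &
    forall s, `|s| < d1 -> cmod (x l (t + s) - q.[rtoc s]) <= K * (`|s| / d1) ^+ N].
  by exists d1, K; split=> // N; apply: H.
elim: N => [|N ih] l.
  exists 0, 0; split; [exact: dominated0|by rewrite horner0|].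
  move=> s sd; rewrite horner0 subr0 expr0 mulr1; apply: le_trans (hx _ _ (lt_le_trans sd d1e)) _.
  by rewrite ler_peMl // ler1n.
have [q hq] := choice ih.
have [Q {}hq] := choice hq.
have [B hB] := choice (fun j => hA (l, j) N).
have [P {}hB] := choice hB.
pose rhs := \sum_j B j * q j.
exists ((x l t)%:P + primitive rhs), ((cmod (x l t))%:P + 'X * \sum_j P j * Q j); split.
- apply: dominatedD; first exact: dominatedC.
  apply: dominated_primitive; apply: dominated_sum => j _.
  by apply: dominatedM; [have [] := hB j|have [] := hq j].
- rewrite hornerD hornerC hornerM hornerX horner_sum.
  have x0 : cmod (x l t) <= K0 by rewrite -[t]addr0; apply: hx; rewrite normr0.
  have hsum : \sum_j (P j * Q j).[d1] <= n%:R * (M * K).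
    rewrite mulr_natl -[n in X in _ <= X]card_ord -sumr_const; apply: ler_sum => j _.
    have [dB hP _] := hB j; have [dq hQ _] := hq j.
    rewrite hornerM ler_pM //; apply: horner_coefs_ge0 (ltW d10) => k.
      exact: dominated_ge0 dB.
    exact: dominated_ge0 dq.
  apply: (@le_trans _ _ (K0 + d1 * (n%:R * (M * K)))).
    by rewrite lerD // ler_wpM2l // ltW.
  have -> : d1 * (n%:R * (M * K)) = (d1 * (4 * n%:R * M)) * (K / 4) by field.
  apply: (@le_trans _ _ (K0 + 1 * (K / 4))).
    by rewrite lerD2l ler_wpM2r // divr_ge0.
  rewrite /K; lra.
move=> s sd; set q' := (_%:P + primitive _).
have q'0 : q'.[0] = x l t.
  by rewrite hornerD hornerC horner_coef0 coef_primitive addr0.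
pose phi u := x l u - q'.[rtoc (u - t)].
have phi_t : phi t = 0 by rewrite /phi subrr q'0 subrr.
have dphi u : tderivable phi u /\
    tderive phi u = \sum_j A l j u * x j u - rhs.[rtoc (u - t)].
  have [h1 h2] := qderiv_tderive (qderiv_horner q' t u).
  have [h3 h4] := tderivableB (x_derivable l u) h1; split=> //.
  rewrite h4 h2 x_solution; congr (_ - _).
  by rewrite /q' derivD derivC add0r deriv_primitive.
have bphi u : `|u - t| <= `|s| -> cmod (tderive phi u) <= 2 * n%:R * M * K * (`|s| / d1) ^+ N.
  move=> us; have [_ ->] := dphi u; rewrite /rhs horner_sum -sumrB.
  apply: le_trans (cmod_sum _ _ _) _.
  have -> : 2 * n%:R * M * K * (`|s| / d1) ^+ N =
      \sum_(j < n) (2 * M * K * (`|s| / d1) ^+ N).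
    by rewrite sumr_const card_ord -mulr_natl; ring.
  apply: ler_sum => j _; rewrite hornerM.
  have ud : `|u - t| < d1 by apply: le_lt_trans us sd.
  have mono : (`|u - t| / d1) ^+ N <= (`|s| / d1) ^+ N.
    have d1' := ltW d10.
    by apply: lerXn2r; rewrite ?nnegrE ?divr_ge0 // ler_wpM2r ?invr_ge0.
  have [dB hP hB'] := hB j; have [dq hQ hq'] := hq j.
  have := hB' _ ud; have := hq' _ ud; rewrite !subrKC /= => hx1 hA1.
  have -> : A l j u * x j u - (B j).[rtoc (u - t)] * (q j).[rtoc (u - t)] =
    (A l j u - (B j).[rtoc (u - t)]) * x j u +
    (B j).[rtoc (u - t)] * (x j u - (q j).[rtoc (u - t)]) by ring.
  apply: le_trans (cmodD _ _) _; rewrite !cmodM.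
  have -> : 2 * M * K * (`|s| / d1) ^+ N =
    (M * (`|s| / d1) ^+ N) * K + M * (K * (`|s| / d1) ^+ N) by ring.
  apply: lerD; apply: ler_pM; rewrite ?cmod_ge0 //.
  - by apply: le_trans hA1 _; rewrite ler_wpM2l.
  - rewrite -[u](subrKC t); apply: le_trans (hx _ _ (lt_le_trans ud d1e)) _.
    by rewrite ler_peMl // ler1n.
  - exact: le_trans (dominated_horner dB d10 (ltW ud)) hP.
  - by apply: le_trans hx1 _; rewrite ler_wpM2l.
have -> : x l (t + s) - q'.[rtoc s] = phi (t + s) - phi t.
  by rewrite phi_t subr0 /phi [t + s - t]addrAC subrr add0r.
have main : cmod (phi (t + s) - phi t) <= 2 * (2 * n%:R * M * K * (`|s| / d1) ^+ N) * `|s|.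
  have [s0|s0] := leP 0 s.
    have -> : `|s| = t + s - t by rewrite addrAC subrr add0r ger0_norm.
    apply: mean_value => [|u _|u /andP [u1 u2]]; first by rewrite lerDl.
      by have [] := dphi u.
    apply: le_trans (bphi u _) _; last by rewrite addrAC subrr add0r ger0_norm.
    by rewrite (ger0_norm s0) ger0_norm ?subr_ge0 // lerBlDl.
  have -> : `|s| = t - (t + s) by rewrite opprD addrA subrr add0r ltr0_norm.
  rewrite cmodB; apply: mean_value => [|u _|u /andP [u1 u2]]; first by rewrite gerDl ltW.
    by have [] := dphi u.
  apply: le_trans (bphi u _) _; last by rewrite opprD addrA subrr add0r ltr0_norm.
  rewrite (ltr0_norm s0) ler0_norm ?subr_le0 // opprB.
  by rewrite lerBlDl -lerBlDr opprK.
apply: le_trans main _.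
have -> : 2 * (2 * n%:R * M * K * (`|s| / d1) ^+ N) * `|s| =
  (d1 * (4 * n%:R * M)) * (K * (`|s| / d1) ^+ N.+1).
  by rewrite exprS; field; rewrite gt_eqF.
by apply: ler_piMl; rewrite // mulr_ge0 // exprn_ge0 // divr_ge0 // ltW.
Qed.

End LinearODE.

(** * Power series in time and space *)

Section PowerSeries.
Variables (R : realType) (n : nat).
Local Notation C := (cplx R).
Local Notation V := 'cV[C]_n.
Local Notation expo := {ffun 'I_n -> nat}.
Implicit Types (k : expo) (j : nat) (y : V).

Definition weight k : nat := (\sum_i k i)%N.

Definition natexp N (k : {ffun 'I_n -> 'I_N}) : expo := [ffun i => k i : nat].

Definition rbox (w : nat -> expo -> R) N : R :=
  \sum_(j < N) \sum_(k : {ffun 'I_n -> 'I_N}) w j (natexp k).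

Definition mon (tau : R) y j k : C := rtoc tau ^+ j * \prod_(i < n) y i 0 ^+ k i.

Lemma ps_termE c tau y j k : ps_term c tau y j k = c j k * mon tau y j k.
Proof. by rewrite /ps_term /mon mulrA. Qed.

Lemma box_sumB (a b : nat -> expo -> C) N :
  box_sum a N - box_sum b N = box_sum (fun j k => a j k - b j k) N.
Proof. by rewrite -sumrB; apply: eq_bigr => j _; rewrite -sumrB. Qed.

Lemma cmod_box_sum (a : nat -> expo -> C) (w : nat -> expo -> R) N :
  (forall j k, cmod (a j k) <= w j k) -> cmod (box_sum a N) <= rbox w N.
Proof.
move=> h; apply: le_trans (cmod_sum _ _ _) _; apply: ler_sum => j _.
by apply: le_trans (cmod_sum _ _ _) _; apply: ler_sum => k _; apply: h.
Qed.

Lemma rboxZ w (B : R) N : rbox (fun j k => B * w j k) N = B * rbox w N.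
Proof. by rewrite mulr_sumr; apply: eq_bigr => j _; rewrite mulr_sumr. Qed.

Definition summable (c : nat -> expo -> C) (rho M : R) :=
  forall N, rbox (fun j k => cmod (c j k) * rho ^+ (j + weight k)) N <= M.

Lemma summable_ge0 c rho M : summable c rho M -> 0 <= M.
Proof. by move=> /(_ 0%N); rewrite /rbox big_ord0. Qed.

Lemma weight_ge k i : (k i <= weight k)%N.
Proof. by rewrite /weight (bigD1 i) //= leq_addr. Qed.

(** Discarding the terms outside I costs at most B times the summability bound,
    if the monomials outside I are B times smaller than at distance rho. *)
Lemma box_remainder c rho M (e : nat -> expo -> C) (I : nat -> expo -> bool) (B : R) N :
  0 < rho -> summable c rho M -> 0 <= B ->
  (forall j k, ~~ I j k -> cmod (e j k) <= B * rho ^+ (j + weight k)) ->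
  cmod (box_sum (fun j k => c j k * e j k) N -
        box_sum (fun j k => if I j k then c j k * e j k else 0) N) <= B * M.
Proof.
move=> r0 hc B0 he; rewrite box_sumB.
apply: le_trans (@cmod_box_sum _ (fun j k => B * (cmod (c j k) * rho ^+ (j + weight k))) N _) _.
  move=> j k; case: ifP => [_|/negbT nI].
    by rewrite subrr cmod0 !mulr_ge0 ?cmod_ge0 // exprn_ge0 // ltW.
  by rewrite subr0 cmodM mulrCA ler_wpM2l ?cmod_ge0 // he.
by rewrite rboxZ ler_wpM2l.
Qed.

Definition insideb N k : bool := [forall i, (k i < N)%N].

Lemma sum_inside N1 N (b : expo -> C) : (N1 < N)%N ->
  \sum_(k : {ffun 'I_n -> 'I_N}) (if insideb N1.+1 (natexp k) then b (natexp k) else 0) =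
  \sum_(k : {ffun 'I_n -> 'I_N1.+1}) b (natexp k).
Proof.
move=> NN; rewrite -big_mkcond.
pose h (k : {ffun 'I_n -> 'I_N1.+1}) : {ffun 'I_n -> 'I_N} := [ffun i => widen_ord NN (k i)].
pose h' (k : {ffun 'I_n -> 'I_N}) : {ffun 'I_n -> 'I_N1.+1} := [ffun i => inord (k i)].
have hh (k : {ffun 'I_n -> 'I_N1.+1}) : natexp (h k) = natexp k by apply/ffunP => i; rewrite !ffunE.
rewrite (reindex_onto h h') /=; last first.
  move=> k /forallP hk; apply/ffunP => i; rewrite !ffunE; apply: val_inj => /=.
  by rewrite inordK //; have := hk i; rewrite ffunE.
apply: eq_big => [k|k _]; last by rewrite hh.
apply/andP; split; first by apply/forallP => i; rewrite hh ffunE.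
by apply/eqP/ffunP => i; rewrite !ffunE; apply: val_inj; rewrite /= inordK.
Qed.

Lemma box_sum_inside N1 N (a : nat -> expo -> C) : (N1 < N)%N ->
  box_sum (fun j k => if (j < N1.+1)%N && insideb N1.+1 k then a j k else 0) N =
  box_sum a N1.+1.
Proof.
move=> NN; rewrite /box_sum [RHS](big_ord_widen N (fun j =>
  \sum_(k : {ffun 'I_n -> 'I_N1.+1}) a j (natexp k)) NN) [RHS]big_mkcond.
apply: eq_bigr => j _; case: ltnP => hj /=; last by rewrite big1.
by rewrite -(sum_inside _ NN).
Qed.

Lemma out_weight N1 j k : ~~ ((j < N1.+1)%N && insideb N1.+1 k) ->
  (N1.+1 <= j + weight k)%N.
Proof.
rewrite negb_and -leqNgt => /orP [h|]; first by apply: leq_trans h (leq_addr _ _).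
rewrite /insideb negb_forall; case/existsP => i; rewrite -leqNgt => h.
exact: leq_trans h (leq_trans (weight_ge k i) (leq_addl _ _)).
Qed.

Lemma cmod_mon (tau sigma : R) y j k : `|tau| <= sigma -> vmod y <= sigma ->
  cmod (mon tau y j k) <= sigma ^+ (j + weight k).
Proof.
move=> ht hy; have s0 : 0 <= sigma by apply: le_trans ht.
rewrite /mon cmodM cmodX cmod_rtoc exprD ler_pM ?exprn_ge0 ?cmod_ge0 //.
  by apply: lerXn2r; rewrite ?nnegrE.
rewrite cmod_prod /weight expr_sum; apply: ler_prod => i _.
rewrite cmod_ge0 cmodX; apply: lerXn2r; rewrite ?nnegrE ?cmod_ge0 //.
exact: le_trans (cmod_le_vmod y i) hy.
Qed.

Lemma le_exp_ratio (sigma rho : R) a m : 0 <= sigma -> 0 < rho -> sigma <= rho ->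
  (a <= m)%N -> sigma ^+ m <= (sigma / rho) ^+ a * rho ^+ m.
Proof.
move=> s0 r0 sr am; have r0' := ltW r0.
have -> : sigma ^+ m = (sigma / rho) ^+ m * rho ^+ m.
  by rewrite -exprMn divfK // gt_eqF.
rewrite ler_wpM2r ?exprn_ge0 // ler_wiXn2l ?divr_ge0 //.
by rewrite ler_pdivrMr // mul1r.
Qed.

Lemma cvg_cmod (u : nat -> C) (l : C) : u N @[N --> \oo] --> l ->
  forall e : R, 0 < e -> exists N0, forall N, (N0 <= N)%N -> cmod (l - u N) < e.
Proof.
move=> /cvgrPdist_lt h e e0; have e0' : 0 < rtoc e by rewrite -rtoc0 lt_rtoc.
have [N0 _ hN] := h _ e0'; exists N0 => N NN.
by have := hN N NN; rewrite norm_cmod lt_rtoc.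
Qed.

(** Expansion data of a function at (t0, x0), normalized: the series is summable
    at distance rho, and converges to the function at smaller distance. *)
Definition expansion (F : R -> V -> C) (t0 : R) (x0 : V) c (rho M : R) :=
  [/\ 0 < rho, summable c rho M & forall tau y, `|tau| <= rho -> vmod y <= rho ->
    box_sum (fun j k => c j k * mon tau y j k) N @[N --> \oo] --> F (t0 + tau) (x0 + y)].

Lemma analytic_expansion F t0 x0 : analytic_at F t0 x0 ->
  exists c rho M, expansion F t0 x0 c rho M.
Proof.
move=> [c [d [d0 h]]]; pose rho := d / 2.
have r0 : 0 < rho by rewrite divr_gt0.
have rd : rho < d by rewrite ltr_pdivrMr // mulr_natr mulr2n ltrDl.
pose y : V := const_mx (rtoc rho).
have hy : vmod y <= rho.
  by apply: vmod_le; [exact: ltW|move=> i; rewrite mxE cmod_rtoc gtr0_norm].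
have := h (t0 + rho) (x0 + y).
rewrite addrAC subrr add0r gtr0_norm // addrAC subrr add0r lt_vmod.
move=> /(_ rd (le_lt_trans hy rd)) [[M hM] _].
exists c, rho, M; split=> //.
  move=> N; rewrite -le_rtoc; apply: le_trans (hM N); rewrite /rbox rtoc_sum.
  rewrite le_eqVlt; apply/orP; left; apply/eqP; apply: eq_bigr => j _; rewrite rtoc_sum; apply: eq_bigr => k _.
  rewrite norm_cmod /ps_term !cmodM cmodX cmod_rtoc gtr0_norm // -mulrA exprD.
  congr (rtoc (_ * (_ * _))); rewrite cmod_prod /weight expr_sum; apply: eq_bigr => i _.
  by rewrite cmodX mxE cmod_rtoc gtr0_norm.
move=> tau z ht hz; have := h (t0 + tau) (x0 + z).
rewrite addrAC subrr add0r addrAC subrr add0r lt_vmod.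
move=> /(_ (le_lt_trans ht rd) (le_lt_trans hz rd)) [_].
have -> // : (fun j k => c j k * mon tau z j k) = ps_term c tau z.
by apply/funext => j; apply/funext => k; rewrite ps_termE.
Qed.

End PowerSeries.

Section ChainRule.
Variables (R : realType) (n : nat).
Local Notation C := (cplx R).
Local Notation V := 'cV[C]_n.

Definition chain_at (X : R -> V) (dX : V) t (p : mpoly n C) :=
  qderiv (fun s => pev p (X s)) t (\sum_i pev (mderiv i p) (X t) * dX i 0).

Section Chain.
Variables (X : R -> V) (dX : V) (t : R).
Hypothesis hX : forall i, qderiv (fun s => X s i 0) t (dX i 0).
Local Notation T := (chain_at X dX t).

Lemma chain_atC (c : C) : T (mpolyC n c).
Proof.
rewrite /chain_at big1 => [|i _]; last by rewrite mderivC pev0 mul0r.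
by apply: qderiv_ext (qderiv_cst c t) => s; rewrite /pev mevalC.
Qed.

Lemma chain_atM p q : T p -> T q -> T (p * q).
Proof.
move=> h1 h2; have := qderivM h1 h2.
have -> : (\sum_i pev (mderiv i p) (X t) * dX i 0) * pev q (X t) +
    pev p (X t) * (\sum_i pev (mderiv i q) (X t) * dX i 0) =
    \sum_i pev (mderiv i (p * q)) (X t) * dX i 0.
  rewrite mulr_suml mulr_sumr -big_split; apply: eq_bigr => i _ /=.
  by rewrite mderivM pevD !pevM mulrDl -!mulrA [dX i 0 * _]mulrC.
by apply: qderiv_ext => s; rewrite pevM.
Qed.

Lemma chain_atD p q : T p -> T q -> T (p + q).
Proof.
move=> h1 h2; have := qderivD h1 h2; rewrite -big_split /=.
rewrite (eq_bigr (fun i => pev (mderiv i (p + q)) (X t) * dX i 0)).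
  by apply: qderiv_ext => s; rewrite pevD.
by move=> i _; rewrite mderivD pevD mulrDl.
Qed.

Lemma chain_at_var i : T (mpolyX C (mnm1 i)).
Proof.
rewrite /chain_at (bigD1 i) //= big1 => [|l nl]; last first.
  by rewrite mderivX mnm1E eq_sym (negPf nl) scale0r pev0 mul0r.
have -> : mderiv i (mpolyX C (mnm1 i)) = 1.
  rewrite mderivX mnm1E eqxx scale1r -(mpolyX0 n C); congr mpolyX.
  by apply/mnmP => l; rewrite !mnmE subnn.
rewrite pev1 mul1r addr0.
by apply: qderiv_ext (hX i) => s; rewrite /pev mevalXU.
Qed.

Lemma chain_at1 : T 1. Proof. by rewrite -mpolyC1; apply: chain_atC. Qed.

Lemma chain_atX p b : T p -> T (p ^+ b).
Proof.
move=> hp; elim: b => [|b ih]; first by rewrite expr0; apply: chain_at1.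
by rewrite exprS; apply: chain_atM.
Qed.

Lemma qderiv_pev_const p : T p.
Proof.
rewrite (mpolyE p); apply: big_ind => [|p1 p2|a _]; [|exact: chain_atD|].
  by rewrite -(mpolyC0 n C); apply: chain_atC.
rewrite -mul_mpolyC; apply: chain_atM; first exact: chain_atC.
rewrite mpolyXE_id; apply: big_ind => [|p1 p2|i _]; [exact: chain_at1|exact: chain_atM|].
exact/chain_atX/chain_at_var.
Qed.

End Chain.

Lemma qderiv_pev (p : R -> mpoly n C) (dp : mpoly n C) (X : R -> V) (dX : V) t B :
  (forall s, msize (p s) <= B)%N -> (msize dp <= B)%N ->
  (forall m, qderiv (fun s => (p s)@_m) t dp@_m) ->
  (forall i, qderiv (fun s => X s i 0) t (dX i 0)) ->
  qderiv (fun s => pev (p s) (X s)) t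
    (pev dp (X t) + \sum_i pev (mderiv i (p t)) (X t) * dX i 0).
Proof.
move=> sp sd hp hX.
pose xa (a : multinom n) := mpolyX C a.
have h : qderiv (fun s => \sum_(a : bmultinom n B) (p s)@_a * pev (xa a) (X s)) t
  (\sum_(a : bmultinom n B) (dp@_a * pev (xa a) (X t) +
     (p t)@_a * \sum_i pev (mderiv i (xa a)) (X t) * dX i 0)).
  by apply: qderiv_sum => a; apply: qderivM (hp a) (qderiv_pev_const hX _).
have -> : pev dp (X t) + \sum_i pev (mderiv i (p t)) (X t) * dX i 0 =
  \sum_(a : bmultinom n B) (dp@_a * pev (xa a) (X t) +
     (p t)@_a * \sum_i pev (mderiv i (xa a)) (X t) * dX i 0).
  rewrite big_split /=; congr (_ + _).
    by rewrite {1}(mpolywE sd) pev_sum; apply: eq_bigr => a _; rewrite pevZ.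
  under [RHS]eq_bigr => a _ do rewrite mulr_sumr.
  rewrite exchange_big; apply: eq_bigr => i _ /=.
  rewrite {1}(mpolywE (sp t)) linear_sum pev_sum mulr_suml; apply: eq_bigr => a _.
  by rewrite /= mderivZ pevZ mulrA.
apply: qderiv_ext h => s.
by rewrite [in RHS](mpolywE (sp s)) pev_sum; apply: eq_bigr => a _; rewrite pevZ.
Qed.

End ChainRule.

Section Expansion.
Variables (R : realType) (n : nat).
Local Notation C := (cplx R).
Local Notation V := 'cV[C]_n.
Local Notation expo := {ffun 'I_n -> nat}.
Implicit Types (F : R -> V -> C) (k : expo) (j : nat) (y v : V).

Lemma cvg_bound (u : nat -> C) (l z : C) (B : R) N0 : u N @[N --> \oo] --> l ->
  (forall N, (N0 <= N)%N -> cmod (u N - z) <= B) -> cmod (l - z) <= B.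
Proof.
move=> hu hB; apply/ler_addgt0Pr => e e0.
have [N1 hN] := cvg_cmod hu e0.
apply: le_trans (cmod_triangle _ (u (maxn N0 N1)) _) _; rewrite addrC; apply: lerD.
  by apply: hB; rewrite leq_maxl.
by apply: ltW; apply: hN; rewrite leq_maxr.
Qed.

Section AtPoint.
Variables (F : R -> V -> C) (t0 : R) (x0 : V) (c : nat -> expo -> C) (rho M : R).
Hypothesis ex : expansion F t0 x0 c rho M.

Definition box N tau y : C := box_sum (fun j k => c j k * mon tau y j k) N.

Lemma expansion_gt0 : 0 < rho. Proof. by case: ex. Qed.
Lemma expansion_ge0 : 0 <= M. Proof. by case: ex => _ /summable_ge0. Qed.
Let rho_gt0 := expansion_gt0.
Let M_ge0 := expansion_ge0.

(** The monomials outside the box have a degree greater than N. *)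
Lemma expansion_box N tau y (sigma : R) : `|tau| <= sigma -> vmod y <= sigma ->
  sigma <= rho ->
  cmod (F (t0 + tau) (x0 + y) - box N.+1 tau y) <= (sigma / rho) ^+ N.+1 * M.
Proof.
move=> ht hy sr; have s0 : 0 <= sigma by apply: le_trans ht.
have [_ hs hF] := ex; apply: (cvg_bound (hF _ _ (le_trans ht sr) (le_trans hy sr)) (N0 := N.+1)).
move=> N' NN; rewrite /box -(box_sum_inside _ NN).
apply: box_remainder rho_gt0 hs _ _ => [|j k /out_weight hw].
  by rewrite exprn_ge0 // divr_ge0 // ltW.
apply: le_trans (cmod_mon j k ht hy) _.
exact: le_exp_ratio.
Qed.

(** One factor is replaced at a time. *)
Lemma mon_lipschitz (tau tau' : R) y y' (sigma h : R) j k : 0 <= h ->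
  `|tau| <= sigma -> `|tau'| <= sigma -> vmod y <= sigma -> vmod y' <= sigma ->
  `|tau - tau'| <= h -> vmod (y - y') <= h ->
  cmod (mon tau y j k - mon tau' y' j k) <=
    h * ((j + weight k)%:R * sigma ^+ (j + weight k).-1).
Proof.
move=> h0 t1 t2 y1 y2 dt dy; have s0 : 0 <= sigma by apply: le_trans t1.
pose lip m (u w : C) := [/\ cmod u <= sigma ^+ m, cmod w <= sigma ^+ m &
  cmod (u - w) <= h * (m%:R * sigma ^+ m.-1)].
have lip1 : lip 0%N 1 1.
  by split; rewrite ?cmod1 ?expr0 // subrr cmod0 mul0r mulr0.
have lipM m m' u w u' w' : lip m u w -> lip m' u' w' -> lip (m + m')%N (u * u') (w * w').
  move=> [a1 a2 a3] [b1 b2 b3]; split; try by rewrite cmodM exprD ler_pM ?cmod_ge0.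
  have -> : u * u' - w * w' = (u - w) * u' + w * (u' - w') by ring.
  apply: le_trans (cmodD _ _) _; rewrite !cmodM.
  have -> : h * ((m + m')%:R * sigma ^+ (m + m').-1) =
      h * (m%:R * sigma ^+ m.-1) * sigma ^+ m' + sigma ^+ m * (h * (m'%:R * sigma ^+ m'.-1)).
    rewrite natrD; case: m {a1 a2 a3} => [|m].
      by rewrite add0n expr0 !mul0r mulr0 mul0r !add0r mul1r.
    case: m' {b1 b2 b3} => [|m'].
      by rewrite addn0 expr0 mul0r !mulr0 !addr0 mulr1.
    by rewrite addSn addnS /= !exprS exprD; ring.
  by apply: lerD; apply: ler_pM; rewrite ?cmod_ge0.
have lipX m u w : lip 1%N u w -> lip m (u ^+ m) (w ^+ m).
  by move=> hl; elim: m => [|m ih]; rewrite ?expr0 // !exprS -add1n; apply: lipM.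
suff : lip (j + weight k)%N (mon tau y j k) (mon tau' y' j k) by case.
apply: (lipM).
  by apply: (lipX); split; rewrite ?expr1 ?cmod_rtoc // expr0 mulr1 mulr1 -rtocB cmod_rtoc.
rewrite /weight; elim: (index_enum 'I_n) => [|i r ih]; first by rewrite !big_nil.
rewrite !big_cons; apply: (lipM) ih; apply: lipX.
split; rewrite ?expr1; [exact: le_trans (cmod_le_vmod _ _) y1|exact: le_trans (cmod_le_vmod _ _) y2|].
rewrite expr0 !mulr1; apply: le_trans dy.
by have := cmod_le_vmod (y - y') i; rewrite !mxE.
Qed.

Lemma weight_exp_ratio (sigma : R) N m : 0 <= sigma -> 2 * sigma <= rho -> (N < m)%N ->
  m%:R * sigma ^+ m.-1 <= 2 / rho * (2 * sigma / rho) ^+ N * rho ^+ m.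
Proof.
move=> s0 sr; case: m => // m Nm /=.
have s20 : 0 <= 2 * sigma by rewrite mulr_ge0.
have m2 : (m.+1)%:R <= 2 * 2 ^+ m :> R.
  rewrite -exprS -natrX ler_nat; apply: ltnW; exact: ltn_expl.
apply: (@le_trans _ _ (2 * (2 * sigma) ^+ m)).
  by rewrite exprMn mulrA ler_wpM2r // exprn_ge0.
have -> : 2 / rho * (2 * sigma / rho) ^+ N * rho ^+ m.+1 =
   2 * ((2 * sigma / rho) ^+ N * rho ^+ m).
  by rewrite exprS; field; rewrite gt_eqF.
by rewrite ler_wpM2l //; apply: le_exp_ratio.
Qed.

(** The Lipschitz constants of the monomials grow linearly with their degree; the
    factor 2 in the ratio of the radii absorbs this growth. *)
Lemma expansion_lipschitz N tau tau' y y' (sigma h : R) : 0 <= h ->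
  `|tau| <= sigma -> `|tau'| <= sigma -> vmod y <= sigma -> vmod y' <= sigma ->
  `|tau - tau'| <= h -> vmod (y - y') <= h -> 2 * sigma <= rho ->
  cmod ((F (t0 + tau) (x0 + y) - F (t0 + tau') (x0 + y')) -
        (box N.+1 tau y - box N.+1 tau' y')) <=
    h * (2 / rho * (2 * sigma / rho) ^+ N) * M.
Proof.
move=> h0 t1 t2 y1 y2 dt dy sr; have s0 : 0 <= sigma by apply: le_trans t1.
have sr' : sigma <= rho by apply: le_trans sr; rewrite mulr_natl mulr2n lerDl.
have [_ hs hF] := ex.
have c1 := hF _ _ (le_trans t1 sr') (le_trans y1 sr').
have c2 := hF _ _ (le_trans t2 sr') (le_trans y2 sr').
have cd : box N' tau y - box N' tau' y' @[N' --> \oo] -->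
    F (t0 + tau) (x0 + y) - F (t0 + tau') (x0 + y') by exact: cvgB c1 c2.
apply: (@cvg_bound (fun N' => box N' tau y - box N' tau' y') _ _ _ N.+1 cd) => N' NN.
rewrite /box -!(box_sum_inside _ NN) !box_sumB.
have e1 (a b : nat -> expo -> C) : (forall j k, a j k = b j k) -> box_sum a N' = box_sum b N'.
  by move=> ab; apply: eq_bigr => j _; apply: eq_bigr => k _; apply: ab.
have := box_remainder (c := c) (e := fun j k => mon tau y j k - mon tau' y' j k)
  (I := fun j k => (j < N.+1)%N && insideb N.+1 k)
  (B := h * (2 / rho * (2 * sigma / rho) ^+ N)) N' rho_gt0 hs _ _.
rewrite box_sumB; set S := box_sum _ _; set S' := box_sum _ _ => hS.
have -> : S' = S.
  by apply: e1 => j k; case: ifP => _; ring.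
apply: hS; first by rewrite !mulr_ge0 ?invr_ge0 ?exprn_ge0 ?divr_ge0 ?mulr_ge0 // ltW.
move=> j k /out_weight hw; apply: le_trans (mon_lipschitz _ _ h0 t1 t2 y1 y2 dt dy) _.
by rewrite -mulrA ler_wpM2l //; apply: weight_exp_ratio.
Qed.

Lemma monZ (s a : R) v j k :
  mon (s * a) (rtoc s *: v) j k = rtoc s ^+ (j + weight k) * mon a v j k.
Proof.
rewrite /mon rtocM exprMn exprD -!mulrA; congr (_ * _).
rewrite mulrCA; congr (_ * _); rewrite /weight expr_sum -big_split.
by apply: eq_bigr => i _; rewrite !mxE exprMn.
Qed.

(** The truncations of the series to boxes restrict to polynomials on the line. *)
Lemma expansion_line (a : R) v :
  analytic1 (fun s => F (t0 + s * a) (x0 + rtoc s *: v)) 0.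
Proof.
pose L := `|a| + vmod v + 1.
have L0 : 0 < L by rewrite ltr_wpDl // addr_ge0 // vmod_ge0.
have aL : `|a| <= L by rewrite /L -addrA lerDl addr_ge0 // vmod_ge0.
have vL : vmod v <= L by rewrite /L addrAC lerDr addr_ge0.
exists (rho / L), M; split; first by rewrite divr_gt0.
move=> N; exists (\sum_(j < N.+1) \sum_(k : {ffun 'I_n -> 'I_N.+1})
    (c j (natexp k) * mon a v j (natexp k))%:P * 'X^(j + weight (natexp k))),
  (\sum_(j < N.+1) \sum_(k : {ffun 'I_n -> 'I_N.+1})
    (cmod (c j (natexp k)) * L ^+ (j + weight (natexp k)))%:P * 'X^(j + weight (natexp k))).
split.
- apply: dominated_sum => j _; apply: dominated_sum => k _; apply: dominatedM.
    move=> i; rewrite !coefC; case: eqP => _; last by rewrite cmod0.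
    by rewrite cmodM ler_wpM2l ?cmod_ge0 //; apply: cmod_mon.
  exact: dominatedXn.
- have [_ hs _] := ex; apply: le_trans (hs N.+1); rewrite horner_sum.
  apply: ler_sum => j _; rewrite horner_sum; apply: ler_sum => k _.
  rewrite hornerM hornerC hornerXn -mulrA -exprMn mulrC.
  by rewrite mulrCA divff ?gt_eqF // mulr1 mulrC.
move=> s; rewrite ltr_pdivlMr // => sd; rewrite add0r.
have h1 : `|s * a| <= `|s| * L by rewrite normrM ler_wpM2l.
have h2 : vmod (rtoc s *: v) <= `|s| * L by rewrite vmodZ cmod_rtoc ler_wpM2l.
have := expansion_box N h1 h2 (ltW sd).
have -> : box N.+1 (s * a) (rtoc s *: v) = (\sum_(j < N.+1) \sum_(k : {ffun 'I_n -> 'I_N.+1})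
    (c j (natexp k) * mon a v j (natexp k))%:P * 'X^(j + weight (natexp k))).[rtoc s].
  rewrite horner_sum; apply: eq_bigr => j _; rewrite horner_sum; apply: eq_bigr => k _.
  by rewrite hornerM hornerC hornerXn monZ; ring.
move=> /le_trans; apply; rewrite mulrC ler_wpM2l //.
have -> : `|s| / (rho / L) = `|s| * L / rho.
  by field; rewrite !gt_eqF.
have th0 : 0 <= `|s| * L / rho by rewrite divr_ge0 ?mulr_ge0 // ltW.
by rewrite exprS ler_piMl ?exprn_ge0 // ler_pdivrMr // mul1r ltW.
Qed.

End AtPoint.
End Expansion.

(** * Derivatives in time and space *)

Section QuadraticDerivatives.
Variables (R : realType).
Local Notation C := (cplx R).

(** Derivative at 0 with quadratic error, for increments in S: all complex numbers
    for the derivatives in space, the real ones for the derivative in time. *)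
Definition gderiv (S : C -> Prop) (phi : C -> C) (D : C) := exists K e : R,
  [/\ 0 <= K, 0 < e & forall h, S h -> cmod h < e ->
    cmod (phi h - phi 0 - D * h) <= K * cmod h ^+ 2].

Definition cderiv := gderiv (fun=> True).
Definition is_rtoc (h : C) := h = rtoc (complex.Re h).

Lemma qderiv_gderiv (phi : R -> C) t D : qderiv phi t D <->
  gderiv is_rtoc (fun h => phi (t + complex.Re h)) D.
Proof.
split=> [/qderiv_pos [K [e [K0 e0 _ h]]]|[K [e [K0 e0 h]]]].
  exists K, e; split=> // z -> ze; rewrite /= addr0.
  by rewrite cmod_rtoc real_normK ?num_real //; apply: h; rewrite -cmod_rtoc.
exists K, e; split=> // s se; have := h (rtoc s) erefl.
by rewrite cmod_rtoc real_normK ?num_real //= addr0; apply.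
Qed.

Section Rules.
Variable S : C -> Prop.
Local Notation deriv := (gderiv S).

Lemma gderiv_ext phi psi D (e : R) : 0 < e ->
  (forall h, cmod h < e -> phi h = psi h) -> deriv phi D -> deriv psi D.
Proof.
move=> e0 he [K [d [K0 d0 h]]]; exists K, (Num.min e d); split=> //.
  by rewrite lt_min e0.
move=> z zS; rewrite lt_min => /andP [z1 z2].
by rewrite -!he ?cmod0 //; apply: h.
Qed.

Lemma gderiv_cst (a : C) : deriv (fun=> a) 0.
Proof. by exists 0, 1; split=> // h _ _; rewrite subrr mul0r subrr cmod0 mul0r. Qed.

Lemma gderivD phi psi D E : deriv phi D -> deriv psi E ->
  deriv (fun h => phi h + psi h) (D + E).
Proof.
move=> [K1 [e1 [K10 e10 h1]]] [K2 [e2 [K20 e20 h2]]].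
exists (K1 + K2), (Num.min e1 e2); split; [exact: addr_ge0|by rewrite lt_min e10|].
move=> s sS; rewrite lt_min => /andP [s1 s2].
have -> : phi s + psi s - (phi 0 + psi 0) - (D + E) * s =
  (phi s - phi 0 - D * s) + (psi s - psi 0 - E * s) by ring.
by apply: le_trans (cmodD _ _) _; rewrite mulrDl lerD ?h1 ?h2.
Qed.

Lemma gderiv_sum (I : Type) (r : seq I) (f : I -> C -> C) (D : I -> C) :
  (forall i, deriv (f i) (D i)) ->
  deriv (fun h => \sum_(i <- r) f i h) (\sum_(i <- r) D i).
Proof.
move=> hf; elim: r => [|i r ih].
  by rewrite big_nil; apply: (gderiv_ext ltr01 _ (gderiv_cst 0)) => h _; rewrite big_nil.
rewrite big_cons; apply: (gderiv_ext ltr01 _ (gderivD (hf i) ih)) => h _.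
by rewrite big_cons.
Qed.

Lemma gderiv_lipschitz phi D : deriv phi D -> exists K e : R,
  [/\ 0 <= K, 0 < e & forall h, S h -> cmod h < e -> cmod (phi h - phi 0) <= K * cmod h].
Proof.
move=> [K [e [K0 e0 he]]]; exists (K + cmod D), (Num.min e 1); split.
- by rewrite addr_ge0 // cmod_ge0.
- by rewrite lt_min e0 ltr01.
move=> h hS; rewrite lt_min => /andP [h1 h2].
apply: le_trans (cmod_le_dist _ (D * h)) _; rewrite cmodM mulrDl addrC lerD2r.
apply: le_trans (he h hS h1) _; rewrite expr2 ler_wpM2l // ler_piMr ?cmod_ge0 //.
exact: ltW.
Qed.

Lemma gderivM phi psi D E : deriv phi D -> deriv psi E ->
  deriv (fun h => phi h * psi h) (D * psi 0 + phi 0 * E).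
Proof.
move=> d1 d2; have [L1 [f1 [L10 f10 g1]]] := gderiv_lipschitz d1.
have [L2 [f2 [L20 f20 g2]]] := gderiv_lipschitz d2.
have [K1 [e1 [K10 e10 h1]]] := d1; have [K2 [e2 [K20 e20 h2]]] := d2.
exists (K1 * cmod (psi 0) + cmod (phi 0) * K2 + L1 * L2),
  (Num.min (Num.min e1 e2) (Num.min f1 f2)); split.
- by rewrite !addr_ge0 // mulr_ge0 // cmod_ge0.
- by rewrite !lt_min e10 e20 f10 f20.
move=> s sS; rewrite !lt_min => /andP [/andP [s1 s2] /andP [s3 s4]].
set a := phi s; set b := psi s; set a0 := phi 0; set b0 := psi 0.
have -> : a * b - a0 * b0 - (D * b0 + a0 * E) * s =
  (a - a0 - D * s) * b0 + a0 * (b - b0 - E * s) + (a - a0) * (b - b0).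
  by ring.
apply: le_trans (cmodD _ _) _; rewrite [X in _ <= X]mulrDl [X in _ <= X + _]mulrDl.
apply: lerD.
  apply: le_trans (cmodD _ _) _; apply: lerD.
    by rewrite cmodM -mulrA [cmod b0 * _]mulrC mulrA ler_wpM2r ?cmod_ge0 ?h1.
  by rewrite cmodM -mulrA ler_wpM2l ?cmod_ge0 ?h2.
rewrite cmodM; have -> : L1 * L2 * cmod s ^+ 2 = (L1 * cmod s) * (L2 * cmod s) by ring.
by rewrite ler_pM ?cmod_ge0 ?g1 ?g2.
Qed.

Lemma gderivV phi D : deriv phi D -> phi 0 != 0 ->
  deriv (fun h => (phi h)^-1) (- D / phi 0 ^+ 2).
Proof.
move=> d1 n0; have [L [f [L0 f0 g]]] := gderiv_lipschitz d1.
have [K [e [K0 e0 h1]]] := d1.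
set a0 := phi 0; have a00 : 0 < cmod a0 by rewrite cmod_gt0.
pose Q := (cmod a0 * K + cmod D * L) * 2 / cmod a0 ^+ 3.
exists Q, (Num.min (Num.min e f) (cmod a0 / 2 / (L + 1))).
have L1 : 0 < L + 1 by rewrite ltr_wpDl.
have Q0 : 0 <= Q.
  by rewrite /Q divr_ge0 ?exprn_ge0 ?cmod_ge0 // mulr_ge0 // addr_ge0 // mulr_ge0 // cmod_ge0.
split=> //; first by rewrite !lt_min e0 f0 !divr_gt0.
move=> s sS; rewrite !lt_min => /andP [/andP [s1 s2] s3].
set a := phi s.
have half : cmod a0 / 2 <= cmod a.
  have : cmod a0 <= cmod a + cmod (a - a0) by rewrite cmodB; apply: cmod_le_dist.
  have := g s sS s2; rewrite -/a -/a0 => h2 h3.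
  have h4 : L * cmod s <= cmod a0 / 2.
    move: s3; rewrite ltr_pdivlMr // => /ltW; apply: le_trans.
    by rewrite mulrC ler_wpM2l ?cmod_ge0 // lerDl.
  by lra.
have a_gt0 : 0 < cmod a by apply: lt_le_trans half; rewrite divr_gt0.
have an0 : a != 0 by rewrite -cmod_gt0.
have -> : a^-1 - a0^-1 - - D / a0 ^+ 2 * s =
  (- a0 * (a - a0 - D * s) + D * s * (a - a0)) / (a * a0 ^+ 2).
  by field; rewrite ?an0 ?n0 /a0 ?n0.
rewrite cmodM cmodV cmodM cmodX.
have num : cmod (- a0 * (a - a0 - D * s) + D * s * (a - a0)) <=
    (cmod a0 * K + cmod D * L) * cmod s ^+ 2.
  apply: le_trans (cmodD _ _) _; rewrite mulrDl !cmodM cmodN; apply: lerD.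
    by rewrite -mulrA ler_wpM2l ?cmod_ge0 //; apply: h1.
  have -> : cmod D * L * cmod s ^+ 2 = cmod D * cmod s * (L * cmod s) by ring.
  by rewrite ler_wpM2l ?mulr_ge0 ?cmod_ge0 //; apply: g.
have den : (cmod a * cmod a0 ^+ 2)^-1 <= 2 / cmod a0 ^+ 3.
  rewrite -[X in _ <= X]invrK lef_pV2 ?posrE; last first.
  - by rewrite invr_gt0 divr_gt0 // exprn_gt0.
  - by rewrite mulr_gt0 // exprn_gt0.
  rewrite invfM invrK exprS mulrA [2^-1 * _]mulrC.
  by rewrite ler_wpM2r // exprn_ge0 // ltW.
have -> : Q * cmod s ^+ 2 = (cmod a0 * K + cmod D * L) * cmod s ^+ 2 * (2 / cmod a0 ^+ 3).
  by rewrite /Q; ring.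
by apply: ler_pM => //; rewrite ?cmod_ge0 // invr_ge0 mulr_ge0 ?exprn_ge0 ?cmod_ge0.
Qed.

Lemma gderiv_quotient f phi psi D E (e : R) : deriv phi D -> deriv psi E -> psi 0 != 0 ->
  0 < e -> (forall h, cmod h < e -> f h = phi h / psi h) ->
  deriv f ((psi 0 * D - phi 0 * E) / psi 0 ^+ 2).
Proof.
move=> d1 d2 n0 e0 he; have := gderivM d1 (gderivV d2 n0).
have -> : D * (psi 0)^-1 + phi 0 * (- E / psi 0 ^+ 2) =
  (psi 0 * D - phi 0 * E) / psi 0 ^+ 2 by field.
by apply: gderiv_ext e0 _ => h hh; rewrite he.
Qed.

Lemma gderiv_monomial (a : C) m : exists D, deriv (fun h => a * h ^+ m) D.
Proof.
case: m => [|[|m]].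
- by exists 0; apply: (gderiv_ext ltr01 _ (gderiv_cst a)) => h _; rewrite expr0 mulr1.
- by exists a, 0, 1; split=> // h _ _; rewrite !expr1 mulr0 subr0 subrr cmod0 mul0r.
- exists 0, (cmod a), 1; split=> //; first exact: cmod_ge0.
  move=> h _ h1; rewrite [0 ^+ _]exprS mul0r mulr0 mul0r !subr0 cmodM ler_wpM2l ?cmod_ge0 //.
  rewrite -addn2 exprD cmodM !cmodX ler_piMl ?exprn_ge0 ?cmod_ge0 //.
  by rewrite exprn_ile1 ?cmod_ge0 // ltW.
Qed.

End Rules.

Lemma qderiv_quotient (f phi psi : R -> C) t D E (e : R) :
  qderiv phi t D -> qderiv psi t E -> psi t != 0 -> 0 < e ->
  (forall s, `|s| < e -> f (t + s) = phi (t + s) / psi (t + s)) ->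
  qderiv f t ((psi t * D - phi t * E) / psi t ^+ 2).
Proof.
move=> /qderiv_gderiv d1 /qderiv_gderiv d2 n0 e0 he; apply/qderiv_gderiv.
have := @gderiv_quotient _ (fun h => f (t + complex.Re h)) _ _ _ _ e d1 d2.
rewrite /= addr0; apply=> // h hh; apply: he.
exact: le_lt_trans (Re_le_cmod h) hh.
Qed.

End QuadraticDerivatives.

Section PartialDerivatives.
Variables (R : realType) (n : nat).
Local Notation C := (cplx R).
Local Notation V := 'cV[C]_n.
Local Notation expo := {ffun 'I_n -> nat}.
Implicit Types (F : R -> V -> C) (k : expo) (j : nat) (y v : V).

(** The quadratic error bounds the difference quotients that define the partial
    derivative. *)
Lemma cderiv_xpartial F l t x D :
  cderiv (fun h => F t (x + h *: delta_mx l 0)) D -> xpartial F l t x = D.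
Proof.
move=> [K [e [K0 e0 he]]]; rewrite /xpartial /derive.
apply: cvg_lim => //; apply/cvgrPdist_le => eps eps0.
have epsE := rtoc_ge0 (ltW eps0); set d := complex.Re eps in epsE.
have d0 : 0 < d by rewrite -lt_rtoc -epsE.
have K1 : 0 < K + 1 by rewrite ltr_wpDl.
near=> h.
have hn0 : h != 0 by near: h; exact: nbhs_dnbhs_neq.
have h1 : cmod h < e.
  by rewrite -lt_rtoc -norm_cmod; near: h; apply: dnbhs0_lt; rewrite -rtoc0 lt_rtoc.
have h2 : cmod h < d / (K + 1).
  rewrite -lt_rtoc -norm_cmod; near: h; apply: dnbhs0_lt.
  by rewrite -rtoc0 lt_rtoc divr_gt0.
rewrite norm_cmod epsE le_rtoc /=.
have -> : D - h^-1 *: (F t (h *: delta_mx l 0 + x) - F t x) =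
    - (h^-1 * (F t (x + h *: delta_mx l 0) - F t (x + 0 *: delta_mx l 0) - D * h)).
  by rewrite scale0r addr0 [x + _]addrC /GRing.scale /=; field.
rewrite cmodN cmodM cmodV ler_pdivrMl ?cmod_gt0 //.
apply: le_trans (he _ I h1) _; rewrite expr2 mulrCA ler_wpM2l ?cmod_ge0 //.
move: h2; rewrite ltr_pdivlMr // => /ltW; apply: le_trans.
by rewrite mulrC ler_wpM2l ?cmod_ge0 // lerDl.
Unshelve. all: by end_near.
Qed.

Lemma cderiv_qderiv F t x v D : cderiv (fun h => F t (x + h *: v)) D ->
  qderiv (fun s => F t (x + rtoc s *: v)) 0 D.
Proof.
move=> [K [e [K0 e0 he]]]; exists K, e; split=> // s se; rewrite add0r.
by have := he (rtoc s) I; rewrite cmod_rtoc real_normK ?num_real //; apply.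
Qed.

Section AtPoint.
Variables (F : R -> V -> C) (t0 : R) (x0 : V) (c : nat -> expo -> C) (rho M : R).
Hypothesis ex : expansion F t0 x0 c rho M.

Lemma vmod_delta l : vmod (delta_mx l 0 : V) <= 1.
Proof.
apply: vmod_le => // i; rewrite mxE eqxx andbT.
by case: eqP; rewrite ?cmod1 ?cmod0.
Qed.

Lemma expansion_cderiv l : exists D, cderiv (fun h => F t0 (x0 + h *: delta_mx l 0)) D.
Proof.
have r0 := expansion_gt0 ex; have M0 := expansion_ge0 ex.
have monE (h : C) j k : mon 0 (h *: delta_mx l 0 : V) j k =
    (0 ^+ j * \prod_(i < n | i != l) 0 ^+ k i) * h ^+ k l.
  rewrite /mon rtoc0 -mulrA; congr (_ * _); rewrite (bigD1 l) //= mulrC; congr (_ * _).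
    by apply: eq_bigr => i ni; rewrite !mxE (negPf ni) mulr0.
  by rewrite !mxE !eqxx mulr1.
have [D hD] : exists D, cderiv (fun h => box c 2 0 (h *: delta_mx l 0)) D.
  have [D0 hD0] := choice (fun jk : nat * expo => gderiv_monomial (fun=> True)
     (c jk.1 jk.2 * (0 ^+ jk.1 * \prod_(i < n | i != l) 0 ^+ jk.2 i)) (jk.2 l)).
  exists (\sum_(j < 2) \sum_(k : {ffun 'I_n -> 'I_2}) D0 (j : nat, natexp k)).
  apply: gderiv_sum => j; apply: gderiv_sum => k.
  apply: (gderiv_ext ltr01 _ (hD0 (j : nat, natexp k))) => h _.
  by rewrite monE !mulrA.
exists D; have [K [e [K0 e0 he]]] := hD.
exists (M / rho ^+ 2 + K), (Num.min e rho); split.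
- by rewrite addr_ge0 // divr_ge0 // exprn_ge0 // ltW.
- by rewrite lt_min e0.
move=> h _; rewrite lt_min => /andP [h1 h2].
have B z : cmod z <= rho ->
    cmod (F t0 (x0 + z *: delta_mx l 0) - box c 2 0 (z *: delta_mx l 0)) <= M / rho ^+ 2 * cmod z ^+ 2.
  move=> hz; have := @expansion_box _ _ _ _ _ _ _ _ ex 1 0 (z *: delta_mx l 0) (cmod z).
  rewrite normr0 addr0 cmod_ge0 vmodZ => /(_ isT) h3.
  apply: le_trans (h3 _ hz) _; first by rewrite ler_piMr ?cmod_ge0 // vmod_delta.
  by rewrite expr_div_n mulrAC [X in _ <= X]mulrC mulrA.
have B0 : F t0 (x0 + 0 *: delta_mx l 0) = box c 2 0 (0 *: delta_mx l 0).
  apply/eqP; rewrite -subr_eq0 -cmod_eq0 eq_le cmod_ge0 andbT.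
  by have := B 0; rewrite cmod0 expr0n /= mulr0; apply; rewrite ltW.
rewrite B0.
have -> : F t0 (x0 + h *: delta_mx l 0) - box c 2 0 (0 *: delta_mx l 0) - D * h =
  (F t0 (x0 + h *: delta_mx l 0) - box c 2 0 (h *: delta_mx l 0)) +
  (box c 2 0 (h *: delta_mx l 0) - box c 2 0 (0 *: delta_mx l 0) - D * h) by ring.
by apply: le_trans (cmodD _ _) _; rewrite mulrDl lerD ?he // B // ltW.
Qed.

End AtPoint.
End PartialDerivatives.

Section DerivativeExpansions.
Variables (R : realType) (n : nat).
Local Notation C := (cplx R).
Local Notation V := 'cV[C]_n.
Local Notation expo := {ffun 'I_n -> nat}.
Implicit Types (F : R -> V -> C) (k : expo) (j : nat) (y v : V).

Definition mnm_of k : multinom n := Multinom [tuple k i | i < n].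
Definition expo_of (m : multinom n) : expo := [ffun i => m i].

Lemma mnm_ofE k i : mnm_of k i = k i.
Proof. by rewrite multinomE tnth_mktuple. Qed.

Lemma mnm_ofK k : expo_of (mnm_of k) = k.
Proof. by apply/ffunP => i; rewrite ffunE mnm_ofE. Qed.

Lemma expo_ofK m : mnm_of (expo_of m) = m.
Proof. by apply/mnmP => i; rewrite mnm_ofE ffunE. Qed.

Lemma mdeg_mnm_of k : mdeg (mnm_of k) = weight k.
Proof. by rewrite mdegE; apply: eq_bigr => i _; rewrite mnm_ofE. Qed.

Lemma weight_expo_of m : weight (expo_of m) = mdeg m.
Proof. by rewrite -mdeg_mnm_of expo_ofK. Qed.

Definition boxpoly (b : expo -> C) N : mpoly n C :=
  \sum_(k : {ffun 'I_n -> 'I_N}) b (natexp k) *: mpolyX C (mnm_of (natexp k)).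

Lemma pev_boxpoly b N y : pev (boxpoly b N) y =
  \sum_(k : {ffun 'I_n -> 'I_N}) b (natexp k) * \prod_i y i 0 ^+ natexp k i.
Proof.
rewrite pev_sum; apply: eq_bigr => k _; rewrite pevZ pevX; congr (_ * _).
by apply: eq_bigr => i _; rewrite mnm_ofE.
Qed.

Lemma mcoeff_boxpoly b N m :
  (boxpoly b N)@_m = if insideb N (expo_of m) then b (expo_of m) else 0.
Proof.
rewrite raddf_sum /=; case: ifP => [/forallP hm|/negbT hm]; last first.
  rewrite big1 // => k _; rewrite mcoeffZ mcoeffX; case: eqP => [e|]; last by rewrite mulr0.
  by case/negP: hm; apply/forallP => i; rewrite -e mnm_ofK ffunE.
have hm' i : (m i < N)%N by have := hm i; rewrite ffunE.
pose k0 : {ffun 'I_n -> 'I_N} := [ffun i => Ordinal (hm' i)].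
have ek0 : natexp k0 = expo_of m by apply/ffunP => i; rewrite !ffunE.
rewrite (bigD1 k0) //= mcoeffZ mcoeffX ek0 expo_ofK eqxx mulr1 big1 ?addr0 // => k nk.
rewrite mcoeffZ mcoeffX; case: eqP => [e|]; last by rewrite mulr0.
case/eqP: nk; apply/ffunP => i; apply: val_inj; rewrite /= ffunE /=.
by rewrite -[m]e mnm_ofE ffunE.
Qed.

Lemma insideb_mdeg N m : (mdeg m < N)%N -> insideb N (expo_of m).
Proof.
move=> h; apply/forallP => i; apply: leq_ltn_trans h.
by rewrite -weight_expo_of weight_ge.
Qed.

Lemma box0E c N y : box c N.+1 0 y = pev (boxpoly (c 0%N) N.+1) y.
Proof.
rewrite /box /box_sum big_ord_recl [X in _ + X]big1 => [|j _]; last first.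
  by rewrite big1 // => k _; rewrite /mon rtoc0 expr0n /= mul0r mulr0.
rewrite addr0 pev_boxpoly; apply: eq_bigr => k _.
by rewrite /mon expr0 mul1r.
Qed.

(** Two increments that are B-close relative to their length have B-close slopes. *)
Lemma qderiv_close (phi psi : R -> C) t l1 l2 (B K e : R) :
  qderiv phi t l1 -> qderiv psi t l2 -> 0 < e -> 0 <= K ->
  (forall s, 0 < s -> s < e ->
    cmod ((phi (t + s) - phi t) - (psi (t + s) - psi t)) <= s * (B + K * s)) ->
  cmod (l1 - l2) <= B.
Proof.
move=> /qderiv_pos [K1 [e1 [K10 e10 _ h1]]] /qderiv_pos [K2 [e2 [K20 e20 _ h2]]] e0 K0 h.
apply/ler_addgt0Pr => eps eps0.
pose L := K + K1 + K2 + 1.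
have L0 : 0 < L by rewrite ltr_wpDl // !addr_ge0.
pose m := Num.min (Num.min e (eps / L)) (Num.min e1 e2).
have m0 : 0 < m by rewrite /m !lt_min e0 e10 e20 divr_gt0.
pose s := m / 2.
have s0 : 0 < s by rewrite divr_gt0.
have sm : s < m by rewrite ltr_pdivrMr // mulr_natr mulr2n ltrDl.
move: sm; rewrite /m !lt_min => /andP [/andP [se sL] /andP [s1 s2]].
have sn : `|s| = s by rewrite gtr0_norm.
have key : cmod (l1 - l2) * s <= s * (B + K * s) + K1 * s ^+ 2 + K2 * s ^+ 2.
  have -> : cmod (l1 - l2) * s = cmod ((l1 - l2) * rtoc s) by rewrite cmodM cmod_rtoc sn.
  have -> : (l1 - l2) * rtoc s = ((phi (t + s) - phi t) - (psi (t + s) - psi t))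
     - (phi (t + s) - phi t - l1 * rtoc s) + (psi (t + s) - psi t - l2 * rtoc s) by ring.
  apply: le_trans (cmodD _ _) _; apply: lerD; last by apply: h2; rewrite sn.
  apply: le_trans (cmodD _ _) _; rewrite cmodN; apply: lerD; first exact: h.
  by apply: h1; rewrite sn.
have : cmod (l1 - l2) <= B + (K + K1 + K2) * s.
  rewrite -(ler_pM2r s0); apply: le_trans key _.
  by rewrite le_eqVlt; apply/orP; left; apply/eqP; ring.
move=> /le_trans; apply; rewrite lerD2l.
move: sL; rewrite ltr_pdivlMr // => /ltW; apply: le_trans.
by rewrite mulrC ler_wpM2l ?(ltW s0) // lerDl.
Qed.

Lemma qderiv_affine (a b : C) t : qderiv (fun s => a + rtoc s * b) t b.
Proof.
exists 0, 1; split=> // s _; rewrite mul0r rtocD.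
have -> : a + (rtoc t + rtoc s) * b - (a + rtoc t * b) - b * rtoc s = 0 by ring.
by rewrite cmod0.
Qed.

Lemma exprD_small (a b : R) N : 0 <= a -> 0 <= b -> exists2 K, 0 <= K &
  forall s, 0 < s -> s < 1 -> (a + b * s) ^+ N <= a ^+ N + K * s.
Proof.
move=> a0 b0; elim: N => [|N [K K0 ih]].
  by exists 0 => // s _ _; rewrite !expr0 mul0r addr0.
exists (b * a ^+ N + (a + b) * K).
  by rewrite addr_ge0 // mulr_ge0 ?exprn_ge0 ?addr_ge0.
move=> s s0 s1; rewrite !exprS.
have s0' := ltW s0.
have bs : b * s <= b by rewrite ler_piMr // ltW.
apply: (@le_trans _ _ ((a + b * s) * (a ^+ N + K * s))).
  by rewrite ler_wpM2l ?ih // addr_ge0 // mulr_ge0.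
have -> : (a + b * s) * (a ^+ N + K * s) =
  a * a ^+ N + (b * a ^+ N + (a + b * s) * K) * s by ring.
by rewrite lerD2l ler_wpM2r // lerD2l ler_wpM2r // lerD2l.
Qed.

Section AtPoint.
Variables (F : R -> V -> C) (t0 : R) (x0 : V) (c : nat -> expo -> C) (rho M : R).
Hypothesis ex : expansion F t0 x0 c rho M.
Let rho_gt0 : 0 < rho := expansion_gt0 ex.
Let M_ge0 : 0 <= M := expansion_ge0 ex.

(** Both derivatives are controlled by comparing increments of F and of its Taylor
    polynomial, which differ by a multiple of the increment of the argument. *)
Lemma expansion_direction N (a : R) v y D D' : `|a| <= 1 -> vmod v <= 1 ->
  2 * vmod y < rho ->
  qderiv (fun s => F (t0 + s * a) (x0 + (y + rtoc s *: v))) 0 D ->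
  qderiv (fun s => box c N.+1 (s * a) (y + rtoc s *: v)) 0 D' ->
  cmod (D - D') <= 2 / rho * (2 * vmod y / rho) ^+ N * M.
Proof.
move=> a1 v1 yr d1 d2.
have [K K0 hK] := exprD_small N (a := 2 * vmod y / rho) (b := 2 / rho)
  (divr_ge0 (mulr_ge0 (ler0n _ 2) (vmod_ge0 y)) (ltW rho_gt0)) (divr_ge0 (ler0n _ 2) (ltW rho_gt0)).
have r20 : 0 <= 2 / rho by rewrite divr_ge0 // ltW.
apply: (@qderiv_close _ _ 0 D D' _ (2 / rho * K * M) (Num.min 1 ((rho - 2 * vmod y) / 2)) d1 d2).
- by rewrite lt_min ltr01 divr_gt0 // subr_gt0.
- by rewrite mulr_ge0 // mulr_ge0.
move=> s s0; rewrite lt_min ltr_pdivlMr // => /andP [s1 s2].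
have s0' := ltW s0.
have := @expansion_lipschitz _ _ F t0 x0 c rho M ex N (s * a) (0 * a) (y + rtoc s *: v)
  (y + rtoc 0 *: v) (vmod y + s) s s0'.
rewrite add0r !mul0r !rtoc0 !scale0r !addr0 normr0 subr0.
have as1 : `|s * a| <= s by rewrite normrM gtr0_norm // ler_piMr.
have vs1 : vmod (rtoc s *: v) <= s by rewrite vmodZ cmod_rtoc gtr0_norm // ler_piMr.
rewrite [y + _ - y]addrC addKr => H; apply: le_trans (H _ _ _ _ _ _ _) _ => {H} //.
- by apply: le_trans as1 _; rewrite lerDr vmod_ge0.
- by rewrite addr_ge0 // vmod_ge0.
- by apply: le_trans (vmodD _ _) _; rewrite lerD2l.
- by rewrite lerDl.
- by move: s2; lra.
rewrite -mulrA ler_wpM2l //.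
have -> : 2 * (vmod y + s) / rho = 2 * vmod y / rho + 2 / rho * s by ring.
have -> : 2 / rho * (2 * vmod y / rho) ^+ N * M + 2 / rho * K * M * s =
  2 / rho * ((2 * vmod y / rho) ^+ N + K * s) * M by ring.
by rewrite ler_wpM2r // ler_wpM2l //; apply: hK.
Qed.

Lemma expansion_partial N l y D : 2 * vmod y < rho ->
  cderiv (fun h => F t0 (x0 + y + h *: delta_mx l 0)) D ->
  cmod (D - pev (mderiv l (boxpoly (c 0%N) N.+1)) y) <=
    2 / rho * (2 * vmod y / rho) ^+ N * M.
Proof.
move=> yr /cderiv_qderiv d1.
apply: (@expansion_direction N 0 (delta_mx l 0)) => //; rewrite ?normr0 // ?vmod_delta //.
  by apply: qderiv_ext d1 => s; rewrite mulr0 addr0 addrA.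
have -> : pev (mderiv l (boxpoly (c 0%N) N.+1)) y =
    \sum_i pev (mderiv i (boxpoly (c 0%N) N.+1)) (y + rtoc 0 *: delta_mx l 0)
      * (delta_mx l 0 : V) i 0.
  rewrite (bigD1 l) //= big1 => [|i nl]; last by rewrite mxE (negPf nl) mulr0.
  by rewrite mxE !eqxx mulr1 addr0 rtoc0 scale0r addr0.
apply: qderiv_ext (@qderiv_pev_const _ _ (fun s => y + rtoc s *: delta_mx l 0)
  (delta_mx l 0) 0 _ _) => [s|i]; first by rewrite mulr0 box0E.
have hl := qderiv_affine (y i 0) ((delta_mx l 0 : V) i 0) 0.
by apply: qderiv_ext hl => s; rewrite [RHS]mxE [in RHS]mxE.
Qed.

Lemma expansion_time N y D : 2 * vmod y < rho ->
  qderiv (fun s => F s (x0 + y)) t0 D ->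
  cmod (D - pev (boxpoly (c 1%N) N.+2) y) <=
    2 / rho * (2 * vmod y / rho) ^+ N.+1 * M.
Proof.
move=> yr [K [e [e0 he]]].
apply: (@expansion_direction N.+1 1 0) => //; rewrite ?normr1 // ?vmod0 //.
  exists K, e; split=> // s se.
  by rewrite add0r mul0r !scaler0 !addr0 mulr1; apply: he.
have hpow j : qderiv (fun s : R => rtoc s ^+ j) 0 (j == 1%N)%:R :> Prop.
  case: j => [|[|j]]; first exact: qderiv_cst.
    exists 0, 1; split=> // s _; rewrite add0r rtoc0 !expr1 subr0 mul1r subrr cmod0 mul0r //.
  exists 1, 1; split=> // s s1; rewrite add0r rtoc0 [0 ^+ _]exprS mul0r mul0r !subr0 mul1r.
  rewrite cmodX cmod_rtoc -(real_normK (num_real s)) -addn2 exprD.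
  by rewrite ler_piMl ?exprn_ge0 // exprn_ile1 // ltW.
have -> : pev (boxpoly (c 1%N) N.+2) y = \sum_(j < N.+2)
   \sum_(k : {ffun 'I_n -> 'I_N.+2}) (j == 1%N :> nat)%:R *
      (c j (natexp k) * \prod_i y i 0 ^+ natexp k i).
  rewrite (bigD1 (Ordinal (isT : (1 < N.+2)%N))) //= [X in _ + X]big1 => [|j nj]; last first.
    rewrite big1 // => k _; case: eqP => [e1|]; last by rewrite mul0r.
    by case/eqP: nj; apply: val_inj.
  by rewrite addr0 pev_boxpoly; apply: eq_bigr => k _; rewrite mul1r.
apply: (qderiv_ext (phi := fun s => \sum_(j < N.+2) \sum_(k : {ffun 'I_n -> 'I_N.+2})
    rtoc s ^+ j * (c j (natexp k) * \prod_i y i 0 ^+ natexp k i))).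
  move=> s; apply: eq_bigr => j _; apply: eq_bigr => k _.
  by rewrite mulr1 scaler0 addr0 /mon mulrCA.
apply: qderiv_sum => j; apply: qderiv_sum => k.
have := qderivM (hpow j) (qderiv_cst (c j (natexp k) * \prod_i y i 0 ^+ natexp k i) 0).
by rewrite mulr0 addr0.
Qed.

End AtPoint.
End DerivativeExpansions.

(** * Asymptotic expansions at the equilibrium *)

Section Approximation.
Variables (R : realType) (n : nat).
Local Notation C := (cplx R).
Local Notation V := 'cV[C]_n.
Implicit Types (u w : V -> C) (p q : mpoly n C) (N : nat) (x : V).

Definition approx N u p := exists K delta : R, 0 < delta /\
  forall x, vmod x < delta -> cmod (u x - pev p x) <= K * vmod x ^+ N.

Lemma approx_pos N u p : approx N u p -> exists K delta : R,
  [/\ 0 <= K, 0 < delta, delta <= 1 &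
  forall x, vmod x < delta -> cmod (u x - pev p x) <= K * vmod x ^+ N].
Proof.
move=> [K [d [d0 h]]]; exists `|K|, (Num.min d 1); split=> //.
- by rewrite lt_min d0 ltr01.
- by rewrite ge_min lexx orbT.
move=> x; rewrite lt_min => /andP [xd _]; apply: le_trans (h _ xd) _.
by rewrite ler_wpM2r ?ler_norm // exprn_ge0 // vmod_ge0.
Qed.

Lemma pev_bounded p : exists2 B : R, 0 <= B & forall x, vmod x <= 1 -> cmod (pev p x) <= B.
Proof.
exists (\sum_(m <- msupp p) cmod p@_m); first by apply: sumr_ge0 => m _; apply: cmod_ge0.
move=> x x1; rewrite {1}(mpolyE p) pev_sum; apply: le_trans (cmod_sum _ _ _) _.
apply: ler_sum => m _; rewrite pevZ pevX cmodM ler_piMr ?cmod_ge0 //.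
rewrite cmod_prod; apply: prodr_ile1 => i _; rewrite cmod_ge0 cmodX exprn_ile1 ?cmod_ge0 //.
exact: le_trans (cmod_le_vmod _ _) x1.
Qed.

Lemma ordge_approx N p : ordge N p -> approx N (pev p) 0.
Proof.
move=> /ordgeP hp; exists (\sum_(m <- msupp p) cmod p@_m), 1; split=> // x /ltW x1.
rewrite pev0 subr0 {1}(mpolyE p) pev_sum; apply: le_trans (cmod_sum _ _ _) _.
rewrite mulr_suml; apply: ler_sum => m _; rewrite pevZ pevX cmodM.
have [lt|ge] := ltnP (mdeg m) N; first by rewrite hp // cmod0 !mul0r.
rewrite ler_wpM2l ?cmod_ge0 //; apply: (@le_trans _ _ (vmod x ^+ mdeg m)).
  rewrite cmod_prod mdegE expr_sum; apply: ler_prod => i _; rewrite cmod_ge0 cmodX.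
  by apply: lerXn2r; rewrite ?nnegrE ?cmod_ge0 ?vmod_ge0 // cmod_le_vmod.
by apply: ler_wiXn2l => //; apply: vmod_ge0.
Qed.

Lemma approxD N u w p q : approx N u p -> approx N w q ->
  approx N (fun x => u x + w x) (p + q).
Proof.
move=> [K1 [d1 [d10 h1]]] [K2 [d2 [d20 h2]]].
exists (K1 + K2), (Num.min d1 d2); split; first by rewrite lt_min d10.
move=> x; rewrite lt_min => /andP [x1 x2]; rewrite pevD.
have -> : u x + w x - (pev p x + pev q x) = (u x - pev p x) + (w x - pev q x) by ring.
by apply: le_trans (cmodD _ _) _; rewrite mulrDl lerD ?h1 ?h2.
Qed.

Lemma approxM N u w p q : approx N u p -> approx N w q ->
  approx N (fun x => u x * w x) (p * q).
Proof.
move=> /approx_pos [K1 [d1 [K10 d10 d11 h1]]] /approx_pos [K2 [d2 [K20 d20 d21 h2]]].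
have [B1 B10 hB1] := pev_bounded p; have [B2 B20 hB2] := pev_bounded q.
exists (K1 * (B2 + K2) + B1 * K2), (Num.min d1 d2); split; first by rewrite lt_min d10.
move=> x; rewrite lt_min => /andP [x1 x2]; rewrite pevM.
have x_le1 : vmod x <= 1 by apply: ltW; apply: lt_le_trans x1 d11.
have xN : 0 <= vmod x ^+ N by rewrite exprn_ge0 // vmod_ge0.
have xN1 : vmod x ^+ N <= 1 by rewrite exprn_ile1 // vmod_ge0.
have -> : u x * w x - pev p x * pev q x =
  (u x - pev p x) * w x + pev p x * (w x - pev q x) by ring.
apply: le_trans (cmodD _ _) _; rewrite [X in _ <= X]mulrDl !cmodM; apply: lerD.
  rewrite mulrAC; apply: ler_pM; rewrite ?cmod_ge0 ?h1 //.
  apply: le_trans (cmod_le_dist _ (pev q x)) _; apply: lerD; first exact: hB2.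
  by apply: le_trans (h2 _ x2) _; rewrite ler_piMr.
by rewrite -mulrA; apply: ler_pM; rewrite ?cmod_ge0 ?h2 ?hB1.
Qed.

Lemma approx_pev N p : approx N (pev p) p.
Proof. by exists 0, 1; split=> // x _; rewrite subrr cmod0 mul0r. Qed.

Lemma approx_ext N u w p (d : R) : 0 < d -> (forall x, vmod x < d -> u x = w x) ->
  approx N u p -> approx N w p.
Proof.
move=> d0 huw [K [e [e0 h]]]; exists K, (Num.min d e); split.
  by rewrite lt_min d0.
by move=> x; rewrite lt_min => /andP [x1 x2]; rewrite -huw //; apply: h.
Qed.

Lemma approx_ext' N u w p : (forall x, u x = w x) -> approx N u p -> approx N w p.
Proof. by move=> h; apply: approx_ext ltr01 _ => x _. Qed.

Lemma approxN N u p : approx N u p -> approx N (fun x => - u x) (- p).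
Proof.
move=> h; have := approxM (approx_pev N (-1)) h; rewrite mulN1r.
by apply: approx_ext' => x; rewrite pevN pev1 mulN1r.
Qed.

Lemma approxB N u w p q : approx N u p -> approx N w q ->
  approx N (fun x => u x - w x) (p - q).
Proof. by move=> h1 h2; exact: approxD h1 (approxN h2). Qed.

Lemma approx_sum N (I : Type) (r : seq I) (u : I -> V -> C) (p : I -> mpoly n C) :
  (forall i, approx N (u i) (p i)) ->
  approx N (fun x => \sum_(i <- r) u i x) (\sum_(i <- r) p i).
Proof.
move=> h; elim: r => [|i r ih].
  by rewrite big_nil; apply: approx_ext' (approx_pev N 0) => x; rewrite big_nil pev0.
by rewrite big_cons; apply: approx_ext' (approxD (h i) ih) => x; rewrite big_cons.
Qed.

Lemma approx_prod N (I : Type) (r : seq I) (P : pred I) (u : I -> V -> C) (p : I -> mpoly n C) :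
  (forall i, approx N (u i) (p i)) ->
  approx N (fun x => \prod_(i <- r | P i) u i x) (\prod_(i <- r | P i) p i).
Proof.
move=> h; elim: r => [|i r ih].
  by rewrite big_nil; apply: approx_ext' (approx_pev N 1) => x; rewrite big_nil pev1.
rewrite big_cons; case: ifP => Pi; last first.
  by apply: approx_ext' ih => x; rewrite big_cons Pi.
by apply: approx_ext' (approxM (h i) ih) => x; rewrite big_cons Pi.
Qed.

Lemma approx_det N k (u : 'I_k -> 'I_k -> V -> C) (p : 'I_k -> 'I_k -> mpoly n C) :
  (forall i j, approx N (u i j) (p i j)) ->
  approx N (fun x => \det (\matrix_(i, j) u i j x)) (\det (\matrix_(i, j) p i j)).
Proof.
move=> h; rewrite /determinant; apply: approx_sum => sg; apply: approxM.
  by apply: approx_ext' (approx_pev N _) => x; rewrite pev_exp pevN pev1.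
apply: (approx_ext' _ (_ : approx N (fun x => \prod_i u i (perm.fun_of_perm sg i) x) _)).
  by move=> x; apply: eq_bigr => i _; rewrite mxE.
under [X in approx _ _ X]eq_bigr => i _ do rewrite mxE.
by apply: approx_prod => i.
Qed.

Lemma approx_leq N N' u p : (N' <= N)%N -> approx N u p -> approx N' u p.
Proof.
move=> NN /approx_pos [K [d [K0 d0 d1 h]]]; exists K, d; split=> // x xd.
apply: le_trans (h _ xd) _; rewrite ler_wpM2l // ler_wiXn2l ?vmod_ge0 //.
by apply: ltW; apply: lt_le_trans xd d1.
Qed.

Lemma pev_hpartZ k p (c : C) x : pev (hpart k p) (c *: x) = c ^+ k * pev (hpart k p) x.
Proof.
rewrite (mpolyE (hpart k p)) !pev_sum mulr_sumr; apply: eq_big_seq => m.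
rewrite mcoeff_msupp => hm; have em : mdeg m = k.
  by apply/eqP; apply: contraNT hm; rewrite mcoeff_hpart => /negPf ->.
rewrite !pevZ !pevX mulrCA; congr (_ * _).
rewrite -em mdegE expr_sum -big_split; apply: eq_bigr => i _ /=.
by rewrite mxE exprMn.
Qed.

(** Along a ray the lowest homogeneous part of p dominates, so it vanishes if its
    degree is less than N; hence expansions are unique. *)
Lemma approx_ordge N p : approx N (pev p) 0 -> ordge N p.
Proof.
move=> /approx_pos [K [d [K0 d0 d1 h]]]; apply: contraT => /order_exists [k [kN ok nok]].
have [x hx] : exists x, pev (hpart k p) x != 0.
  apply: contrapT => nex; case/negP: nok; apply: hpart_eq0 => //; apply: pev_eq0 => x.
  by apply: contrapT => /eqP hx; apply: nex; exists x.
have /approx_pos [K' [d' [K'0 d'0 d'1 h']]] := ordge_approx (ordge_sub_hpart ok).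
have X0 : 0 < vmod x + 1 by rewrite ltr_wpDl // vmod_ge0.
suff : pev (hpart k p) x = 0 by move/eqP: hx.
apply: (@cmod_small_eq0 _ _ (K * vmod x ^+ N + K' * vmod x ^+ k.+1)) => e e0.
pose mi := Num.min (Num.min 1 e) (Num.min (d / (vmod x + 1)) (d' / (vmod x + 1))).
have m0 : 0 < mi by rewrite /mi !lt_min ltr01 e0 !divr_gt0.
pose s := mi / 2.
have s0 : 0 < s by rewrite divr_gt0.
have sm : s < mi by rewrite ltr_pdivrMr // mulr_natr mulr2n ltrDl.
move: sm; rewrite /mi !lt_min !ltr_pdivlMr // => /andP [/andP [s1 se] /andP [sd sd']].
have s0' := ltW s0.
have vs : vmod (rtoc s *: x) = s * vmod x by rewrite vmodZ cmod_rtoc gtr0_norm.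
have b1 : vmod (rtoc s *: x) < d.
  by apply: le_lt_trans sd; rewrite vs ler_wpM2l // lerDl.
have b2 : vmod (rtoc s *: x) < d'.
  by apply: le_lt_trans sd'; rewrite vs ler_wpM2l // lerDl.
have := h _ b1; have := h' _ b2; rewrite !pev0 !subr0 vs pevB pev_hpartZ.
set a := pev (hpart k p) x; set b := pev p _ => h2 h1.
have key : cmod a * s ^+ k <= (K * vmod x ^+ N + K' * vmod x ^+ k.+1) * s * s ^+ k.
  have -> : cmod a * s ^+ k = cmod (rtoc s ^+ k * a).
    by rewrite cmodM cmodX cmod_rtoc gtr0_norm // mulrC.
  have -> : rtoc s ^+ k * a = b - (b - rtoc s ^+ k * a) by ring.
  apply: le_trans (cmodD _ _) _; rewrite cmodN !mulrDl; apply: lerD.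
    have -> : K * vmod x ^+ N * s * s ^+ k = K * (s ^+ k.+1 * vmod x ^+ N) by rewrite exprS; ring.
    apply: le_trans h1 _; rewrite exprMn ler_wpM2l // ler_wpM2r ?exprn_ge0 ?vmod_ge0 //.
    by rewrite ler_wiXn2l // ltW.
  by apply: le_trans h2 _; rewrite exprMn exprS le_eqVlt; apply/orP; left; apply/eqP; ring.
have {}key : cmod a <= (K * vmod x ^+ N + K' * vmod x ^+ k.+1) * s.
  by move: key; rewrite ler_pM2r // exprn_gt0.
have E0 : 0 <= K * vmod x ^+ N + K' * vmod x ^+ k.+1.
  by rewrite addr_ge0 // mulr_ge0 // exprn_ge0 // vmod_ge0.
by apply: le_trans key _; rewrite ler_wpM2l // ltW.
Qed.

Lemma approx_unique N u p q : approx N u p -> approx N u q -> ordge N (p - q).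
Proof.
move=> h1 h2; apply: approx_ordge.
have := approxB (approxB h2 h1) (approx_pev N (q - p)).
rewrite subrr.
by apply: approx_ext' => x; rewrite !pevB; ring.
Qed.

Lemma approx_ordge_eq N u p q : ordge N (p - q) -> approx N u p -> approx N u q.
Proof.
move=> /ordge_approx h1 h2; have := approxD (approxB h2 (approx_pev N (p - q))) h1.
by rewrite addr0 subKr; apply: approx_ext' => x; rewrite subrK.
Qed.

Definition trunc N (b : multinom n -> C) : mpoly n C :=
  \sum_(m : bmultinom n N) b m *: mpolyX C m.

Lemma mcoeff_trunc N b m : (trunc N b)@_m = if (mdeg m < N)%N then b m else 0.
Proof.
rewrite raddf_sum /=; case: ltnP => hm.
  rewrite (bigD1 (BMultinom hm)) //= mcoeffZ mcoeffX eqxx mulr1 big1 ?addr0 // => a na.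
  rewrite mcoeffZ mcoeffX; case: eqP => [e|]; last by rewrite mulr0.
  by case/eqP: na; apply: val_inj.
rewrite big1 // => a _; rewrite mcoeffZ mcoeffX; case: eqP => [e|]; last by rewrite mulr0.
by have := bmdeg a; rewrite e ltnNge hm.
Qed.

Lemma approx_trunc N u p b : (forall m, (mdeg m < N)%N -> p@_m = b m) ->
  approx N u p -> approx N u (trunc N b).
Proof.
move=> h; apply: approx_ordge_eq; apply/ordgeP => m hm.
by rewrite mcoeffB mcoeff_trunc hm h // subrr.
Qed.

End Approximation.

(** * Expansions with coefficients analytic in time *)

Section GeometricSeries.
Variable R : realType.
Local Notation C := (cplx R).

(** The partial sums minus, respectively plus, the geometric bound of the tail form
    an increasing and a decreasing sequence enclosing the sum. *)
Lemma real_geometric_series (b : nat -> R) (K theta : R) : 0 <= K ->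
  0 <= theta -> theta < 1 -> (forall j, `|b j| <= K * theta ^+ j) ->
  exists l, forall J, `|l - \sum_(j < J) b j| <= K / (1 - theta) * theta ^+ J.
Proof.
move=> K0 t0 t1 hb; have t1' : 0 < 1 - theta by rewrite subr_gt0.
pose S J := \sum_(j < J) b j; pose T J := K / (1 - theta) * theta ^+ J.
have T0 J : 0 <= T J by rewrite mulr_ge0 ?exprn_ge0 ?divr_ge0 // ltW.
have TS J : T J = T J.+1 + K * theta ^+ J.
  by rewrite /T exprS; field; rewrite gt_eqF.
have SS J : S J.+1 = S J + b J by rewrite /S big_ord_recr.
have up J d : S J - T J <= S (J + d)%N - T (J + d)%N.
  elim: d => [|d ih]; first by rewrite addn0.
  apply: le_trans ih _; rewrite addnS SS (TS (J + d)%N).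
  have := hb (J + d)%N; rewrite ler_norml => /andP [h _]; lra.
have down J d : S (J + d)%N + T (J + d)%N <= S J + T J.
  elim: d => [|d ih]; first by rewrite addn0.
  apply: le_trans ih; rewrite addnS SS (TS (J + d)%N).
  have := hb (J + d)%N; rewrite ler_norml => /andP [_ h]; lra.
have UV i j : S i - T i <= S j + T j.
  apply: le_trans (up i j) _; apply: le_trans (down j i); rewrite addnC.
  by rewrite lerD2l; apply: (@le_trans _ _ 0); rewrite ?oppr_le0.
pose U : set R := [set x | exists J, x = S J - T J].
have hU : has_sup U.
  by split; [exists (S 0%N - T 0%N), 0%N|exists (S 0%N + T 0%N) => x [J ->]].
exists (sup U) => J; rewrite ler_norml -/(S J) -/(T J); apply/andP; split.
  rewrite lerBrDl addrC; have -> : - T J + S J = S J - T J by rewrite addrC.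
  by apply: sup_upper_bound => //; exists J.
rewrite lerBlDl addrC; have -> : T J + S J = S J + T J by rewrite addrC.
by apply: sup_le_ub => [|x [J' ->]] //; have [] := hU.
Qed.

Lemma geometric_series (a : nat -> C) (K theta : R) : 0 <= K ->
  0 <= theta -> theta < 1 -> (forall j, cmod (a j) <= K * theta ^+ j) ->
  exists l, forall J, cmod (l - \sum_(j < J) a j) <= 2 * K / (1 - theta) * theta ^+ J.
Proof.
move=> K0 t0 t1 ha.
have [x hx] := real_geometric_series K0 t0 t1 (fun j => le_trans (Re_le_cmod (a j)) (ha j)).
have [y hy] := real_geometric_series K0 t0 t1 (fun j => le_trans (Im_le_cmod (a j)) (ha j)).
exists (Complex x y) => J; apply: le_trans (cmod_le_ReIm _) _.
have -> : 2 * K / (1 - theta) * theta ^+ J =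
  K / (1 - theta) * theta ^+ J + K / (1 - theta) * theta ^+ J by ring.
rewrite Re_add Im_add Re_opp Im_opp; apply: lerD.
  have -> : complex.Re (\sum_(j < J) a j) = \sum_(j < J) complex.Re (a j).
    by elim/big_rec2: _ => // i u w _ <-; rewrite Re_add.
  exact: hx.
have -> : complex.Im (\sum_(j < J) a j) = \sum_(j < J) complex.Im (a j).
  by elim/big_rec2: _ => // i u w _ <-; rewrite Im_add.
exact: hy.
Qed.

End GeometricSeries.

Section Coefficients.
Variables (R : realType) (n : nat).
Local Notation C := (cplx R).
Local Notation V := 'cV[C]_n.
Local Notation expo := {ffun 'I_n -> nat}.
Implicit Types (k : expo) (j : nat) (y v : V).

Lemma summable_column (c : nat -> expo -> C) (rho M : R) k J : 0 < rho ->
  summable c rho M -> \sum_(j < J) cmod (c j k) * rho ^+ (j + weight k) <= M.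
Proof.
move=> r0 hs; pose N := (J + weight k).+1; apply: le_trans (hs N).
have JN : (J <= N)%N by rewrite /N -addnS leq_addr.
have pos j k' : 0 <= cmod (c j k') * rho ^+ (j + weight k').
  by rewrite mulr_ge0 ?cmod_ge0 // exprn_ge0 // ltW.
rewrite (big_ord_widen N (fun j => cmod (c j k) * rho ^+ (j + weight k)) JN) big_mkcond.
apply: ler_sum => j _; have kN i : (k i < N)%N.
  by rewrite ltnS; apply: leq_trans (weight_ge k i) (leq_addl _ _).
pose k0 : {ffun 'I_n -> 'I_N} := [ffun i => Ordinal (kN i)].
have ek : natexp k0 = k by apply/ffunP => i; rewrite !ffunE.
rewrite (bigD1 k0) //= ek; case: ifP => _.
  by rewrite lerDl; apply: sumr_ge0 => k' _; apply: pos.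
by rewrite addr_ge0 // sumr_ge0.
Qed.

Lemma summable_term (c : nat -> expo -> C) (rho M : R) j k : 0 < rho ->
  summable c rho M -> cmod (c j k) * rho ^+ (j + weight k) <= M.
Proof.
move=> r0 hs; apply: le_trans (summable_column k j.+1 r0 hs).
rewrite big_ord_recr /= lerDr; apply: sumr_ge0 => i _.
by rewrite mulr_ge0 ?cmod_ge0 // exprn_ge0 // ltW.
Qed.

Section AtPoint.
Variables (F : R -> V -> C) (t0 : R) (x0 : V) (c : nat -> expo -> C) (rho M : R).
Hypothesis ex : expansion F t0 x0 c rho M.
Let rho_gt0 : 0 < rho := expansion_gt0 ex.
Let M_ge0 : 0 <= M := expansion_ge0 ex.

(** The coefficients of the expansion in space at a nearby time are obtained by
    summing the expansion in time. *)
Lemma expansion_coefficients (tau : R) : 2 * `|tau| <= rho ->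
  exists b : expo -> C,
    (forall k J, cmod (b k - \sum_(j < J) c j k * rtoc tau ^+ j) <=
       4 * (M / rho ^+ weight k) * (`|tau| / rho) ^+ J) /\
    (forall N y, vmod y <= rho ->
       cmod (F (t0 + tau) (x0 + y) - pev (boxpoly b N.+1) y) <=
         (vmod y / rho) ^+ N.+1 * M).
Proof.
move=> ht; have [_ hs hF] := ex.
set theta := `|tau| / rho.
have th0 : 0 <= theta by rewrite divr_ge0 // ltW.
have th2 : theta <= 2^-1 by rewrite /theta ler_pdivrMr // mulrC ler_pdivlMr // mulrC.
have th1 : theta < 1 by apply: le_lt_trans th2 _; rewrite invf_lt1 // ltr1n.
have tr : `|tau| <= rho by apply: le_trans ht; rewrite mulr_natl mulr2n lerDl.
have /choice [b hb] : forall k, exists l, forall J,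
    cmod (l - \sum_(j < J) c j k * rtoc tau ^+ j) <=
       4 * (M / rho ^+ weight k) * theta ^+ J.
  move=> k; have K0 : 0 <= M / rho ^+ weight k by rewrite divr_ge0 // exprn_ge0 // ltW.
  have [|l hl] := @geometric_series _ (fun j => c j k * rtoc tau ^+ j) _ theta K0 th0 th1.
    move=> j; rewrite cmodM cmodX cmod_rtoc.
    have -> : `|tau| ^+ j = theta ^+ j * rho ^+ j.
      by rewrite -exprMn divfK // gt_eqF.
    rewrite mulrCA mulrC ler_wpM2r ?exprn_ge0 //.
    rewrite ler_pdivlMr ?exprn_gt0 // -mulrA -exprD; exact: summable_term.
  exists l => J; apply: le_trans (hl J) _; rewrite ler_wpM2r ?exprn_ge0 //.
  rewrite mulrAC ler_wpM2r // ler_pdivrMr ?subr_gt0 //; lra.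
exists b; split=> // N y yr.
apply/ler_addgt0Pr => e e0.
pose D := \sum_(k : {ffun 'I_n -> 'I_N.+1}) 4 * M.
have D0 : 0 <= D by apply: sumr_ge0 => k _; rewrite mulr_ge0.
have e2 : 0 < e / 2 by rewrite divr_gt0.
have [N0 hN0] := cvg_cmod (hF tau y tr yr) e2.
have D1 : 0 < D + 1 by rewrite ltr_wpDl.
have [J0 hJ0] := expr_small th0 th1 (divr_gt0 e2 D1).
pose J := (N0 + J0 + N.+1)%N.
have NJ : (N < J)%N by rewrite /J addnS ltnS leq_addl.
have JN0 : (N0 <= J)%N by rewrite /J -addnA leq_addr.
have JJ0 : (J0 <= J)%N by rewrite /J addnAC leq_addl.
have thJ : D * theta ^+ J <= e / 2.
  apply: (@le_trans _ _ ((D + 1) * theta ^+ J0)).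
    by apply: ler_pM; rewrite ?exprn_ge0 ?lerDl // ler_wiXn2l // ltW.
  by move: hJ0; rewrite ltr_pdivlMr // mulrC => /ltW.
have vr0 : 0 <= vmod y / rho by rewrite divr_ge0 ?vmod_ge0 // ltW.
have h1 : cmod (box c J tau y - box_sum (fun j k => if insideb N.+1 k then
    c j k * mon tau y j k else 0) J) <= (vmod y / rho) ^+ N.+1 * M.
  apply: box_remainder rho_gt0 hs _ _ => [|j k nk]; first by rewrite exprn_ge0.
  have wk : (N.+1 <= weight k)%N by rewrite -(add0n (weight k)); apply: out_weight; rewrite negb_and nk orbT.
  rewrite /mon cmodM exprD mulrCA; apply: ler_pM; rewrite ?cmod_ge0 //.
    rewrite cmodX cmod_rtoc; apply: lerXn2r; rewrite ?nnegrE // ltW //.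
  apply: le_trans (le_exp_ratio (vmod_ge0 y) rho_gt0 yr wk).
  rewrite cmod_prod /weight expr_sum; apply: ler_prod => i _.
  rewrite cmod_ge0 cmodX; apply: lerXn2r; rewrite ?nnegrE ?cmod_ge0 ?vmod_ge0 //.
  exact: cmod_le_vmod.
have h2 : box_sum (fun j k => if insideb N.+1 k then c j k * mon tau y j k else 0) J =
    \sum_(k : {ffun 'I_n -> 'I_N.+1}) (\sum_(j < J) c j (natexp k) * rtoc tau ^+ j) *
      \prod_i y i 0 ^+ natexp k i.
  under [RHS]eq_bigr => k _ do rewrite mulr_suml.
  rewrite exchange_big; apply: eq_bigr => j _.
  rewrite (sum_inside (fun k => c j k * mon tau y j k) NJ); apply: eq_bigr => k _ /=.
  by rewrite /mon mulrA.
have h3 : cmod (\sum_(k : {ffun 'I_n -> 'I_N.+1}) (\sum_(j < J) c j (natexp k) * rtoc tau ^+ j) *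
      \prod_i y i 0 ^+ natexp k i - pev (boxpoly b N.+1) y) <= D * theta ^+ J.
  rewrite pev_boxpoly -sumrB; apply: le_trans (cmod_sum _ _ _) _.
  rewrite mulr_suml; apply: ler_sum => k _.
  rewrite -mulrBl cmodM cmodB.
  have -> : 4 * M * theta ^+ J =
      (4 * (M / rho ^+ weight (natexp k)) * theta ^+ J) * rho ^+ weight (natexp k).
    by field; rewrite gt_eqF // exprn_gt0.
  apply: ler_pM; rewrite ?cmod_ge0 //.
  rewrite cmod_prod /weight expr_sum; apply: ler_prod => i _.
  rewrite cmod_ge0 cmodX; apply: lerXn2r; rewrite ?nnegrE ?cmod_ge0 ?(ltW rho_gt0) //.
  exact: le_trans (cmod_le_vmod _ _) yr.
rewrite -h2 in h3.
have h4 := hN0 J JN0.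
apply: le_trans (cmod_triangle _ (box c J tau y) _) _.
have -> : (vmod y / rho) ^+ N.+1 * M + e = e / 2 + ((vmod y / rho) ^+ N.+1 * M + e / 2) by field.
apply: lerD; first exact: ltW.
apply: le_trans (cmod_triangle _ _ _) _; apply: lerD; first exact: h1.
exact: le_trans h3 thJ.
Qed.

End AtPoint.
End Coefficients.

Section Jets.
Variables (R : realType) (n : nat).
Local Notation C := (cplx R).
Local Notation V := 'cV[C]_n.
Local Notation expo := {ffun 'I_n -> nat}.
Implicit Types (F : R -> V -> C) (k : expo) (j : nat) (x y v : V).

Lemma analytic_line F t x (a : R) v : analytic_at F t x ->
  analytic1 (fun s => F (t + s * a) (x + rtoc s *: v)) 0.
Proof. by move=> /analytic_expansion [c [rho [M ex]]]; apply: expansion_line ex _ _. Qed.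

Lemma analytic_qderiv F t x : analytic_at F t x ->
  exists D, qderiv (fun s => F s x) t D.
Proof.
move=> /(analytic_line 1 0) /analytic1_qderiv [D [K [e [e0 he]]]].
exists D, K, e; split=> // s se; have := he s se.
by rewrite !scaler0 !addr0 add0r mul0r !mulr1 addr0.
Qed.

Lemma analytic_cderiv F t x l : analytic_at F t x ->
  cderiv (fun h => F t (x + h *: delta_mx l 0)) (xpartial F l t x).
Proof.
move=> /analytic_expansion [c [rho [M ex]]].
have [D hD] := expansion_cderiv ex l.
by rewrite (cderiv_xpartial hD).
Qed.

Lemma analytic_tderive F t x : analytic_at F t x ->
  qderiv (fun s => F s x) t (tderive (fun s => F s x) t).
Proof. by move=> /analytic_qderiv [D hD]; have [_ ->] := qderiv_tderive hD. Qed.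

(** The series is differentiated term by term; the degrees that appear as factors
    are absorbed by restricting to half the radius. *)
Lemma analytic_xpartial_line r F t x v l : analytic_on r F -> vmod x < r ->
  analytic1 (fun s => xpartial F l t (x + rtoc s *: v)) 0.
Proof.
move=> an xr; have at_x z : vmod z < r -> analytic_at F t z.
  by move=> zr; apply: an; rewrite lt_vmod.
have [c [rho [M ex]]] := analytic_expansion (at_x _ xr).
have r0 := expansion_gt0 ex; have M0 := expansion_ge0 ex; have [_ hs _] := ex.
pose L := vmod v + 1.
have L0 : 0 < L by rewrite ltr_wpDl // vmod_ge0.
have vL : vmod v <= L by rewrite lerDl.
pose d := Num.min (rho / (2 * L)) ((r - vmod x) / L).
have d0 : 0 < d by rewrite lt_min !divr_gt0 ?mulr_gt0 // subr_gt0.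
have d1 : 2 * (L * d) <= rho.
  rewrite mulrA -ler_pdivlMl ?mulr_gt0 // [_^-1 * _]mulrC /d ge_min lexx //.
have d2 : L * d <= r - vmod x.
  by rewrite -ler_pdivlMl // [_^-1 * _]mulrC /d ge_min lexx orbT.
exists d, (2 / rho * M); split=> // N.
pose sh k := mnm_sub (mnm_of k) (mnm1 l).
pose q := \sum_(k : {ffun 'I_n -> 'I_N.+1}) (c 0%N (natexp k) * (natexp k l)%:R *
   \prod_i v i 0 ^+ sh (natexp k) i)%:P * 'X^((weight (natexp k)).-1) : {poly C}.
pose Q := \sum_(k : {ffun 'I_n -> 'I_N.+1}) (cmod (c 0%N (natexp k)) * (natexp k l)%:R *
   L ^+ (weight (natexp k)).-1)%:P * 'X^((weight (natexp k)).-1) : {poly R}.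
have wsh k : (0 < k l)%N -> (\sum_i sh k i)%N = (weight k).-1.
  move=> kl; rewrite -mdegE -mdeg_mnm_of (@mdeg_subU _ l (mnm_of k)) ?mnm_ofE //.
exists q, Q; split.
- apply: dominated_sum => k _; apply: dominatedM; last exact: dominatedXn.
  move=> i; rewrite !coefC; case: eqP => _; last by rewrite cmod0.
  rewrite !cmodM cmod_nat; have [->|kl] := posnP (natexp k l); first by rewrite !mulr0 !mul0r.
  rewrite ler_wpM2l ?mulr_ge0 ?cmod_ge0 // -wsh // cmod_prod expr_sum.
  apply: ler_prod => i' _; rewrite cmod_ge0 cmodX.
  apply: lerXn2r; rewrite ?nnegrE ?cmod_ge0 ?(ltW L0) //.
  exact: le_trans (cmod_le_vmod _ _) vL.
- rewrite horner_sum; apply: (@le_trans _ _ (\sum_(k : {ffun 'I_n -> 'I_N.+1})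
      2 / rho * (cmod (c 0%N (natexp k)) * rho ^+ (0 + weight (natexp k))))).
    apply: ler_sum => k _; rewrite hornerM hornerC hornerXn -!mulrA -exprMn [X in _ <= X]mulrA.
    rewrite [X in _ <= X]mulrC -mulrA ler_wpM2l ?cmod_ge0 //.
    have [e|w0] := posnP (weight (natexp k)).
      have -> : natexp k l = 0%N by apply/eqP; rewrite -leqn0 -e weight_ge.
      by rewrite mul0r mulr_ge0 ?exprn_ge0 ?divr_ge0 // ltW.
    apply: (@le_trans _ _ ((weight (natexp k))%:R * (L * d) ^+ (weight (natexp k)).-1)).
      by rewrite ler_wpM2r ?exprn_ge0 ?mulr_ge0 ?ler_nat ?weight_ge // ltW.
    have Ld0 : 0 <= L * d by rewrite mulr_ge0 // ltW.
    have := weight_exp_ratio ex Ld0 d1 w0.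
    by rewrite expr0 mulr1 add0n [X in _ -> _ <= X]mulrC; apply.
  have r20 : 0 <= 2 / rho by rewrite divr_ge0 // ltW.
  rewrite -mulr_sumr ler_wpM2l //; apply: le_trans (hs N.+1).
  rewrite /rbox big_ord_recl /= lerDl; apply: sumr_ge0 => j _; apply: sumr_ge0 => k _.
  by rewrite mulr_ge0 ?cmod_ge0 // exprn_ge0 // ltW.
move=> s sd; rewrite add0r.
have vs : vmod (rtoc s *: v) <= `|s| * L.
  by rewrite vmodZ cmod_rtoc ler_wpM2l.
have sL : `|s| * L < L * d by rewrite mulrC ltr_pM2l.
have vr : 2 * vmod (rtoc s *: v) < rho.
  apply: lt_le_trans d1; rewrite ltr_pM2l //; exact: le_lt_trans vs sL.
have xs : vmod (x + rtoc s *: v) < r.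
  apply: le_lt_trans (vmodD _ _) _; rewrite -ltrBrDl; apply: lt_le_trans d2.
  exact: le_lt_trans vs sL.
have := @expansion_partial _ _ _ _ _ _ _ _ ex N l (rtoc s *: v) _ vr (analytic_cderiv l (at_x _ xs)).
have -> : pev (mderiv l (boxpoly (c 0%N) N.+1)) (rtoc s *: v) = q.[rtoc s].
  rewrite linear_sum pev_sum horner_sum; apply: eq_bigr => k _ /=.
  rewrite mderivZ mderivX !pevZ pevX hornerM hornerC hornerXn mnm_ofE.
  have [->|kl] := posnP (natexp k l); first by rewrite !(mul0r, mulr0).
  rewrite -!mulrA; congr (_ * (_ * _)).
  rewrite -wsh // mulrC expr_sum -big_split; apply: eq_bigr => i _ /=.
  by rewrite mxE exprMn.
have ri : 0 <= rho^-1 by rewrite invr_ge0 ltW.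
move=> /le_trans; apply; rewrite mulrAC ler_wpM2l ?mulr_ge0 //.
apply: lerXn2r; rewrite ?nnegrE ?divr_ge0 ?mulr_ge0 ?vmod_ge0 ?(ltW r0) ?(ltW d0) //.
rewrite ler_pdivlMr // mulrAC ler_pdivrMr //.
apply: (@le_trans _ _ (2 * (`|s| * L) * d)).
  by rewrite ler_wpM2r ?(ltW d0) // ler_wpM2l.
have -> : 2 * (`|s| * L) * d = `|s| * (2 * (L * d)) by ring.
by rewrite ler_wpM2l.
Qed.

(** The expansion of F at the equilibrium x = 0, with coefficients analytic in
    time, can be differentiated term by term; c' are the time derivatives of the
    coefficients. *)
Definition expands F (c c' : R -> multinom n -> C) : Prop :=
  [/\ forall t N, approx N (F t) (trunc N (c t)),
      forall m t, analytic1 (fun s => c s m) t,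
      forall t N l, approx N (xpartial F l t) (mderiv l (trunc N.+1 (c t))),
      forall m t, qderiv (fun s => c s m) t (c' t m) &
      forall t N, approx N (fun x => tderive (fun s => F s x) t) (trunc N (c' t))].

(** Each time t has its own power series.  At nearby times the coefficients in x
    are obtained by summing the series in time, since expansions in x are unique;
    this makes them analytic in time. *)
Lemma analytic_jets r F : 0 < r -> analytic_on r F -> exists c c', expands F c c'.
Proof.
move=> rgt0 an; have at_x t y : vmod y < r -> analytic_at F t y.
  by move=> yr; apply: an; rewrite lt_vmod.
have /choice [cc /choice [rho /choice [M ex]]] :
    forall t, exists c rho M, expansion F t 0 c rho M.
  by move=> t; apply: analytic_expansion; apply: at_x; rewrite vmod0.
have r0 t := expansion_gt0 (ex t); have M0 t := expansion_ge0 (ex t).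
have hs t : summable (cc t) (rho t) (M t) by have [] := ex t.
pose c t m := cc t 0%N (expo_of m); pose c' t m := cc t 1%N (expo_of m).
have coef_box (b : expo -> C) N m : (mdeg m < N.+1)%N -> (boxpoly b N.+1)@_m = b (expo_of m).
  by move=> hm; rewrite mcoeff_boxpoly insideb_mdeg.
have app_box t N : approx N.+1 (F t) (boxpoly (cc t 0%N) N.+1).
  exists (M t / rho t ^+ N.+1), (rho t); split=> // y yr.
  have := @expansion_box _ _ _ _ _ _ _ _ (ex t) N 0 y (vmod y).
  rewrite normr0 addr0 add0r box0E => /(_ (vmod_ge0 y) (lexx _) (ltW yr)) /le_trans; apply.
  by rewrite expr_div_n mulrAC [X in _ <= X]mulrAC [M t * _]mulrC.
have app_c t N : approx N (F t) (trunc N (c t)).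
  apply: (@approx_trunc _ _ N _ (boxpoly (cc t 0%N) N.+1)).
    by move=> m hm; rewrite coef_box // ltnW.
  exact: approx_leq (leqnSn N) (app_box t N).
have local t tau : 2 * `|tau| <= rho t -> forall m J,
    cmod (c (t + tau) m - \sum_(j < J) cc t j (expo_of m) * rtoc tau ^+ j) <=
       4 * (M t / rho t ^+ weight (expo_of m)) * (`|tau| / rho t) ^+ J.
  move=> ht m J; have [b [hb1 hb2]] := expansion_coefficients (ex t) ht.
  have : approx (mdeg m).+1 (F (t + tau)) (boxpoly b (mdeg m).+1).
    exists (M t / rho t ^+ (mdeg m).+1), (rho t); split=> // y /ltW yr.
    have := hb2 (mdeg m) y yr; rewrite add0r => /le_trans; apply.
    by rewrite expr_div_n mulrAC [X in _ <= X]mulrAC [M t * _]mulrC.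
  move=> /(approx_unique (app_c (t + tau) (mdeg m).+1)) /ordgeP /(_ m (ltnSn _)).
  rewrite mcoeffB mcoeff_trunc ltnSn coef_box // => /eqP; rewrite subr_eq0 => /eqP ->.
  exact: hb1.
have ri t : 0 <= (rho t)^-1 by rewrite invr_ge0 ltW.
exists c, c'; split; first exact: app_c.
- move=> m t; pose k := expo_of m.
  pose M1 := 4 * (M t / rho t ^+ weight k).
  have Mk : 0 <= M t / rho t ^+ weight k by rewrite divr_ge0 // exprn_ge0 // ltW.
  have d0 : 0 < rho t / 2 by rewrite divr_gt0.
  have dr : rho t / 2 <= rho t by rewrite ler_pdivrMr // mulr_natr mulr2n lerDl ltW.
  exists (rho t / 2), M1; split=> // N.
  exists (\sum_(j < N) (cc t j k)%:P * 'X^j), (\sum_(j < N) (cmod (cc t j k))%:P * 'X^j); split.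
  + apply: dominated_sum => j _; apply: dominatedM; [exact: dominatedC|exact: dominatedXn].
  + apply: (@le_trans _ _ (M t / rho t ^+ weight k)); last by rewrite ler_peMl // ler1n.
    rewrite ler_pdivlMr ?exprn_gt0 // horner_sum mulr_suml.
    apply: le_trans (summable_column k N (r0 t) (hs t)); apply: ler_sum => j _.
    rewrite hornerM hornerC hornerXn -mulrA ler_wpM2l ?cmod_ge0 // exprD.
    rewrite ler_wpM2r ?exprn_ge0 ?(ltW (r0 t)) //.
    by apply: lerXn2r; rewrite ?nnegrE ?(ltW d0) ?(ltW (r0 t)).
  move=> s sd; have s2 : 2 * `|s| <= rho t.
    by rewrite mulrC -ler_pdivlMr // ltW.
  have := local t s s2 m N; rewrite horner_sum.
  under [X in _ -> cmod (_ - X) <= _]eq_bigr => j _ do rewrite hornerM hornerC hornerXn.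
  have M10 : 0 <= M1 by rewrite mulr_ge0.
  move=> /le_trans; apply; rewrite -/M1 ler_wpM2l //.
  apply: lerXn2r; rewrite ?nnegrE ?mulr_ge0 ?invr_ge0 ?(ltW d0) ?(ltW (r0 t)) //.
  by rewrite ler_wpM2l // lef_pV2 ?posrE.
- move=> t N l.
  have h : approx N (xpartial F l t) (mderiv l (boxpoly (cc t 0%N) N.+1)).
    exists (2 / rho t * (2 / rho t) ^+ N * M t), (Num.min (rho t / 2) r).
    split; first by rewrite lt_min divr_gt0 // rgt0.
    move=> y; rewrite lt_min => /andP [y1 y2].
    have yr : 2 * vmod y < rho t by rewrite mulrC -ltr_pdivlMr.
    have := @expansion_partial _ _ _ _ _ _ _ _ (ex t) N l y (xpartial F l t y) yr.
    rewrite add0r => /(_ (analytic_cderiv l (at_x t y y2))) /le_trans; apply.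
    rewrite [2 * vmod y / _]mulrAC exprMn le_eqVlt; apply/orP; left; apply/eqP; ring.
  apply: approx_ordge_eq h; rewrite -linearB /=; apply: ordge_mderiv; apply/ordgeP => m hm.
  by rewrite mcoeffB mcoeff_trunc hm coef_box // subrr.
- move=> m t; pose k := expo_of m.
  exists (4 * (M t / rho t ^+ weight k) / rho t ^+ 2), (rho t / 2); split.
    by rewrite divr_gt0.
  move=> s sd; have s2 : 2 * `|s| <= rho t by rewrite mulrC -ler_pdivlMr // ltW.
  have := local t s s2 m 2%N; rewrite big_ord_recr big_ord1 /= expr0 mulr1 expr1.
  rewrite opprD addrA => /le_trans; apply.
  rewrite expr_div_n real_normK ?num_real // -/k le_eqVlt; apply/orP; left; apply/eqP; ring.
move=> t N.
apply: (@approx_trunc _ _ N _ (boxpoly (cc t 1%N) N.+2)).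
  by move=> m hm; rewrite coef_box // ltnW // ltnW.
apply: (@approx_leq _ _ N.+1) => //.
exists (2 / rho t * (2 / rho t) ^+ N.+1 * M t), (Num.min (rho t / 2) r).
split; first by rewrite lt_min divr_gt0 // rgt0.
move=> y; rewrite lt_min => /andP [y1 y2].
have yr : 2 * vmod y < rho t by rewrite mulrC -ltr_pdivlMr.
have := @expansion_time _ _ F t 0 _ _ _ (ex t) N y (tderive (fun s => F s y) t) yr.
have -> : (fun s : R => F s (0 + y)) = (fun s => F s y) by apply/funext => s; rewrite add0r.
move=> /(_ (analytic_tderive (at_x t y y2))) /le_trans; apply.
rewrite [2 * vmod y / _]mulrAC exprMn le_eqVlt; apply/orP; left; apply/eqP; ring.
Qed.

End Jets.

(** * Generic points *)

Section Generic.
Variables (R : realType) (n : nat) (r : R).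
Hypothesis r_gt0 : 0 < r.
Local Notation C := (cplx R).
Local Notation V := 'cV[C]_n.
Implicit Types (F : R -> V -> C) (P Q : R -> V -> Prop) (t s : R) (x : V).

(** P contains an open dense subset of the tube: every box contains a smaller
    one on which P holds.  Unlike density, this is stable under conjunction. *)
Definition generic P := forall t x (eta : R), 0 < eta -> vmod x + eta <= r ->
  exists t' x' eta', [/\ 0 < eta', `|t' - t| + eta' <= eta, vmod (x' - x) + eta' <= eta &
    forall s y, `|s - t'| < eta' -> vmod (y - x') < eta' -> P s y].

Lemma generic_and P Q : generic P -> generic Q -> generic (fun t x => P t x /\ Q t x).
Proof.
move=> gP gQ t x eta eta0 xr.
have [t1 [x1 [e1 [e10 ht1 hx1 hP]]]] := gP t x eta eta0 xr.
have [|t2 [x2 [e2 [e20 ht2 hx2 hQ]]]] := gQ t1 x1 e1 e10.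
  by have := vmodD (x1 - x) x; rewrite subrK; lra.
exists t2, x2, e2; split=> //.
- by have := ler_distD t1 t2 t; lra.
- by have := vmodD (x2 - x1) (x1 - x); rewrite addrA subrK; lra.
move=> s y hs hy; split; last exact: hQ.
apply: hP.
  by have := ler_distD t2 s t1; lra.
by have := vmodD (y - x2) (x2 - x1); rewrite addrA subrK; lra.
Qed.

Lemma generic_all k (P : 'I_k -> R -> V -> Prop) :
  (forall i, generic (P i)) -> generic (fun t x => forall i, P i t x).
Proof.
elim: k P => [|k IH] P gP t x eta eta0 xr.
  exists t, x, eta; split; rewrite ?subrr ?normr0 ?vmod0 ?add0r //.
  by move=> s y _ _ [].
have [t' [x' [e' [h1 h2 h3 h4]]]] :=
  generic_and (gP ord0) (IH (fun i => P (lift ord0 i)) (fun i => gP _)) t eta0 xr.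
exists t', x', e'; split=> // s y hs hy i; have [p0 pS] := h4 s y hs hy.
by case: (unliftP ord0 i) => [j|] ->.
Qed.

Lemma analytic_locally_neq0 F t x : analytic_at F t x -> F t x != 0 ->
  exists2 d : R, 0 < d & forall s y, `|s - t| < d -> vmod (y - x) < d -> F s y != 0.
Proof.
move=> /analytic_expansion [c [rho [M ex]]] Fn0.
have r0 := expansion_gt0 ex; have M0 := expansion_ge0 ex.
pose K := 2 / rho * M.
have K0 : 0 <= K by rewrite mulr_ge0 // divr_ge0 // ltW.
have F0 : 0 < cmod (F t x) by rewrite cmod_gt0.
pose d := Num.min (rho / 2) (cmod (F t x) / (K + 1)).
have d0 : 0 < d by rewrite lt_min !divr_gt0 // ltr_wpDl.
exists d => // s y hs hy; rewrite -cmod_gt0.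
have := @expansion_lipschitz _ _ _ _ _ _ _ _ ex 0 (s - t) 0 (y - x) 0 d d (ltW d0).
rewrite !addr0 normr0 vmod0 !subr0 ![_ + (_ - _)]addrC !subrK.
have d2 : 2 * d <= rho by rewrite mulrC -ler_pdivlMr // /d ge_min lexx.
move=> /(_ (ltW hs) (ltW d0) (ltW hy) (ltW d0) (ltW hs) (ltW hy) d2).
have -> : box c 1 (s - t) (y - x) - box c 1 0 0 = 0.
  rewrite /box /box_sum !big_ord1 -sumrB big1 // => k _; rewrite /mon !expr0 !mul1r.
  have p1 z : \prod_i (z : V) i 0 ^+ ([ffun i => k i : nat] : {ffun 'I_n -> nat}) i = 1.
    by apply: big1 => i _; rewrite ffunE ord1 expr0.
  by rewrite !p1 subrr.
rewrite subr0 expr0 mulr1 -mulrA -/K => hF.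
have dK : d * (K + 1) <= cmod (F t x).
  by rewrite -ler_pdivlMr ?ltr_wpDl // /d ge_min lexx orbT.
have := cmod_le_dist (F t x) (F s y); rewrite cmodB.
rewrite mulrDr in dK; lra.
Qed.

(** An analytic function that vanishes on a box vanishes along every segment
    that starts in the box. *)
Lemma generic_analytic F t1 x1 : analytic_on r F -> vmod x1 < r -> F t1 x1 != 0 ->
  generic (fun t x => F t x != 0).
Proof.
move=> an x1r Fn0 t x eta eta0 xr.
have at_x s y : vmod y < r -> analytic_at F s y by move=> yr; apply: an; rewrite lt_vmod.
have xr' : vmod x < r by lra.
have [t' [x' [ht' hx' Fn]]] : exists t' x', [/\ `|t' - t| < eta, vmod (x' - x) < eta & F t' x' != 0].
  apply: contrapT => no.
  pose phi (s : R) := F (t + s * (t1 - t)) (x + rtoc s *: (x1 - x)).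
  have phi1 : phi 1 = F t1 x1 by rewrite /phi mul1r scale1r ![_ + (_ - _)]addrC !subrK.
  have : phi 1 = 0; last by rewrite phi1 => e; rewrite e eqxx in Fn0.
  apply: (@identity_segment R phi 0 1) => // [s /andP [s0 s1]|].
    have xs : vmod (x + rtoc s *: (x1 - x)) < r.
      have -> : x + rtoc s *: (x1 - x) = rtoc (1 - s) *: x + rtoc s *: x1.
        by rewrite rtocB scalerBl scale1r scalerBr addrA addrAC.
      apply: le_lt_trans (vmodD _ _) _; rewrite !vmodZ !cmod_rtoc !ger0_norm ?subr_ge0 //.
      have [e|sn] := eqVneq s 0; first by rewrite e mul0r addr0 subr0 mul1r.
      have : s * vmod x1 < s * r by rewrite ltr_pM2l // lt_def sn.
      have : (1 - s) * vmod x <= (1 - s) * r by rewrite ler_wpM2l ?subr_ge0 // ltW.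
      by rewrite [(1 - s) * r]mulrBl mul1r; lra.
    pose psi a := F (t + s * (t1 - t) + a * (t1 - t)) (x + rtoc s *: (x1 - x) + rtoc a *: (x1 - x)).
    have psi_an : analytic1 psi (1 * s - s).
      by rewrite mul1r subrr; exact: analytic_line (at_x _ _ xs).
    refine (analytic1_ext (e := 1) ltr01 _ (analytic1_affine psi_an)) => a _.
    rewrite /phi /psi mul1r mulrBl rtocB !scalerBl; congr (F _ _).
      by rewrite addrCA addrK addrC.
    by rewrite addrCA addrK addrC.
  pose L := Num.max `|t1 - t| (vmod (x1 - x)) + 1.
  have Lt : `|t1 - t| < L by rewrite ltr_pwDr // le_max lexx.
  have Lx : vmod (x1 - x) < L by rewrite ltr_pwDr // le_max lexx orbT.
  have L0 : 0 < L by apply: le_lt_trans Lt.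
  exists (eta / L); split; first by rewrite divr_gt0.
  move=> s sL; rewrite add0r; have {}sL : `|s| * L < eta by rewrite -ltr_pdivlMr.
  apply/eqP; apply: contraT => Fs; case: no.
  exists (t + s * (t1 - t)), (x + rtoc s *: (x1 - x)); split=> //.
    rewrite addrC addKr normrM; apply: le_lt_trans sL.
    by rewrite ler_wpM2l // ltW.
  rewrite [x + _]addrC addrK vmodZ cmod_rtoc; apply: le_lt_trans sL.
  by rewrite ler_wpM2l // ltW.
have x'r : vmod x' < r by have := vmodD (x' - x) x; rewrite subrK; lra.
have [d d0 hd] := analytic_locally_neq0 (at_x t' x' x'r) Fn.
pose e := Num.min d (Num.min (eta - `|t' - t|) (eta - vmod (x' - x))).
have ed : e <= d by rewrite /e ge_min lexx.
exists t', x', e; split.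
- by rewrite !lt_min d0 !subr_gt0 ht'.
- by rewrite -lerBrDl /e !ge_min lexx !orbT.
- by rewrite -lerBrDl /e !ge_min lexx !orbT.
by move=> s y hs hy; apply: hd; apply: lt_le_trans ed.
Qed.

Lemma generic_analytic1 (phi : R -> C) t1 : (forall t, analytic1 phi t) -> phi t1 != 0 ->
  generic (fun t _ => phi t != 0).
Proof.
move=> an pn0 t x eta eta0 xr.
have [e [e0 he]] : exists e : R, 0 < e /\ forall s, 0 < `|s| -> `|s| < e -> phi (t + s) != 0.
  have [hz|//] := analytic1_isolated (an t).
  by rewrite (identity_line an hz) eqxx in pn0.
pose m := Num.min e eta.
have m0 : 0 < m by rewrite lt_min e0.
have me : m <= e by rewrite /m ge_min lexx.
have meta : m <= eta by rewrite /m ge_min lexx orbT.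
exists (t + m / 2), x, (m / 2); split.
- by rewrite divr_gt0.
- by rewrite [t + _]addrC addrK ger0_norm; lra.
- by rewrite subrr vmod0; lra.
move=> s y hs _; have -> : s = t + (s - t) by rewrite addrC subrK.
move: hs; rewrite ltr_norml => /andP [h1 h2].
have st : 0 < s - t by lra.
apply: he; rewrite gtr0_norm //; lra.
Qed.

(** A null set does not fill the box that genericity provides. *)
Lemma generic_off_null P (E : set (R * V)) t (eta : R) : generic P -> lebesgue_null E ->
  0 < eta -> exists s x, [/\ P s x, ~ E (s, x), `|s - t| < eta & vmod x < r].
Proof.
move=> gP nE eta0.
pose m := Num.min eta r.
have m0 : 0 < m by rewrite lt_min eta0.
have [|t' [x' [e [e0 ht hx hP]]]] := gP t 0 m m0.
  by rewrite vmod0 add0r /m ge_min lexx orbT.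
have [s [x [nEs hs hxs]]] := null_complement_dense t' x' nE e0.
have meta : m <= eta by rewrite /m ge_min lexx.
have mr : m <= r by rewrite /m ge_min lexx orbT.
exists s, x; split=> //; first exact: hP.
  by have := ler_distD t' s t; lra.
rewrite subr0 in hx.
by have := vmodD (x - x') x'; rewrite subrK; lra.
Qed.

End Generic.

(** * The linear equation *)

Section LinearEquation.
Variables (R : realType) (n : nat).
Local Notation C := (cplx R).
Local Notation V := 'cV[C]_n.
Variable A : R -> 'M[C]_n.
Hypothesis A_analytic : forall i j t, analytic1 (fun s => A s i j) t.

Lemma linear_solution_analytic (y : R -> V) : linear_solution A y ->
  forall i t, analytic1 (fun s => y s i 0) t.
Proof.
move=> hy i t.
apply: (@linear_ode_analytic R n (fun i j s => A s i j) (fun i s => y s i 0)) => // k s.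
  by have [] := hy s k.
by have [_ ->] := hy s k; rewrite mxE.
Qed.

(** A solution that vanishes at time a is flat there: integrating the equation
    improves a bound of order N to one of order N + 1.  Being analytic, it vanishes
    everywhere. *)
Lemma linear_solution_unique (y : R -> V) a : linear_solution A y -> y a = 0 ->
  forall t, y t = 0.
Proof.
move=> hy ya t; apply/colP => i; rewrite mxE.
have an := linear_solution_analytic hy.
pose F (p : 'I_n * 'I_n + 'I_n) (s : R) := match p with inl q => A s q.1 q.2 | inr k => y s k 0 end.
have F_an p : analytic1 (F p) a by case: p => [[k l]|k]; [exact: A_analytic|exact: an].
have [d [M [d0 M0 hM]]] := approximable_uniform F_an.
have bound p s : `|s| < d -> cmod (F p (a + s)) <= 2 * M.
  by move=> sd; apply: approximable_bound d0 (hM p) sd.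
have flat N : exists2 K : R, 0 <= K & forall k s, 0 <= s -> s < d ->
    cmod (y (a + s) k 0) <= K * s ^+ N.
  elim: N => [|N [K K0 hK]].
    exists (2 * M) => [|k s s0 sd]; first by rewrite mulr_ge0.
    by rewrite expr0 mulr1; apply: (bound (inr k)); rewrite ger0_norm.
  exists (2 * (n%:R * (2 * M * K))) => [|k s s0 sd]; first by rewrite !mulr_ge0.
  have -> : y (a + s) k 0 = y (a + s) k 0 - y a k 0 by rewrite ya mxE subr0.
  have -> : 2 * (n%:R * (2 * M * K)) * s ^+ N.+1 = 2 * (n%:R * (2 * M * (K * s ^+ N))) * (a + s - a).
    by rewrite exprS; ring.
  apply: (@mean_value R (fun u => y u k 0)); first by rewrite lerDl.
    by move=> u _; have [] := hy u k.
  move=> u /andP [u1 u2]; have [_ ->] := hy u k; rewrite mxE.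
  have -> : u = a + (u - a) by rewrite addrC subrK.
  have u0 : 0 <= u - a by rewrite subr_ge0.
  have us : u - a <= s by rewrite lerBlDl.
  apply: le_trans (cmod_sum _ _ _) _.
  rewrite -[n in n%:R]card_ord -sum1_card natr_sum mulr_suml; apply: ler_sum => l _.
  rewrite mul1r cmodM; apply: ler_pM; rewrite ?cmod_ge0 //.
    by apply: (bound (inl (k, l))); rewrite ger0_norm // (le_lt_trans us).
  apply: le_trans (hK l _ u0 (le_lt_trans us sd)) _.
  by rewrite ler_wpM2l //; apply: lerXn2r; rewrite ?nnegrE.
apply: (@identity_line R (fun s => y s i 0) a (an i)).
apply: flat_eq0 (an i a) _ => N; have [K K0 hK] := flat N.
by exists K, d; split=> // s /ltW s0 sd; apply: hK.
Qed.

(** The columns of X are solutions with initial values the basis vectors.  By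
    periodicity X (t + T) and the product of X t and P solve the same equation, and they agree at
    t = 0. *)
Lemma fundamental_matrix (T : R) (P : 'M[C]_n) : 
  (forall t, A (t + T) = A t) ->
  (forall x0 : V, exists y : R -> V, [/\ linear_solution A y, y 0 = x0 & P *m x0 = y T]) ->
  exists X : R -> 'M[C]_n,
  [/\ forall i j t, analytic1 (fun s => X s i j) t,
      forall i j t, qderiv (fun s => X s i j) t ((A t *m X t) i j),
      forall t, X t \in unitmx &
      forall t, X (t + T) = X t *m P].
Proof.
move=> A_per mono.
have /choice [y hy] : forall j : 'I_n, exists y : R -> V,
    [/\ linear_solution A y, y 0 = delta_mx j 0 & P *m delta_mx j 0 = y T].
  by move=> j; apply: mono.
pose X t : 'M[C]_n := \matrix_(i, j) y j t i 0.
have X0 : X 0 = 1%:M.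
  by apply/matrixP => i j; have [_ e _] := hy j; rewrite !mxE e mxE eqxx andbT.
have XT : X T = P.
  by apply/matrixP => i j; have [_ _ e] := hy j; rewrite mxE -e -colE mxE.
have X_an i j t : analytic1 (fun s => X s i j) t.
  have [h _ _] := hy j; have := linear_solution_analytic h i t.
  by apply: analytic1_ext ltr01 _ => s _; rewrite mxE.
have X_der i j t : qderiv (fun s => X s i j) t ((A t *m X t) i j).
  have [l hl] := analytic1_qderiv (X_an i j t); have [_ hl'] := qderiv_tderive hl.
  have [h _ _] := hy j; have [_ h'] := h t i.
  have <- : l = (A t *m X t) i j; last by [].
  rewrite -hl' (_ : (fun s => X s i j) = (fun s => y j s i 0)); last first.
    by apply/funext => s; rewrite mxE.
  by rewrite h' !mxE; apply: eq_bigr => k _; rewrite mxE.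
have sol (Y : R -> 'M[C]_n) (v : V) : (forall i j t, qderiv (fun s => Y s i j) t ((A t *m Y t) i j)) ->
    linear_solution A (fun t => Y t *m v).
  move=> Y_der t i.
  have h : qderiv (fun s => (Y s *m v) i 0) t ((A t *m (Y t *m v)) i 0).
    rewrite mulmxA mxE; apply: (@qderiv_ext _ (fun s => \sum_j Y s i j * v j 0)).
      by move=> s; rewrite mxE.
    apply: qderiv_sum => j; rewrite -[X in qderiv _ _ X]addr0 -[X in _ + X](mulr0 (Y t i j)).
    exact: qderivM (Y_der i j t) (qderiv_cst _ _).
  exact: qderiv_tderive h.
exists X; split=> //.
- move=> t; rewrite -unitmx_tr unitmxE unitfE; apply/negP => /det0P [v v0 vX].
  have Xv : X t *m v^T = 0 by rewrite -[X t]trmxK -trmx_mul vX trmx0.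
  have := linear_solution_unique (sol X v^T X_der) Xv 0.
  by rewrite X0 mul1mx => /(congr1 trmx); rewrite trmxK trmx0 => e; rewrite e eqxx in v0.
move=> t; apply/eqP; rewrite -subr_eq0; apply/eqP/matrixP => i j.
pose Y s := X (s + T) - X s *m P.
have Y_der k l u : qderiv (fun s => Y s k l) u ((A u *m Y u) k l).
  have d1 : qderiv (fun s => X (s + T) k l) u ((A u *m X (u + T)) k l).
    have [K [e [e0 h]]] := X_der k l (u + T); exists K, e; split; first exact: e0.
    by move=> s se; rewrite -[A u]A_per [u + s + T]addrAC; apply: h.
  have d2 : qderiv (fun s => (X s *m P) k l) u ((A u *m X u *m P) k l).
    rewrite mxE; apply: (@qderiv_ext _ (fun s => \sum_j X s k j * P j l)).
      by move=> s; rewrite mxE.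
    apply: qderiv_sum => m; rewrite -[X in qderiv _ _ X]addr0 -[X in _ + X](mulr0 (X u k m)).
    exact: qderivM (X_der k m u) (qderiv_cst _ _).
  apply: (@qderiv_ext _ (fun s => X (s + T) k l + (-1) * (X s *m P) k l)).
    by move=> s; rewrite !mxE mulN1r.
  have -> : (A u *m Y u) k l = (A u *m X (u + T)) k l +
      (0 * (X u *m P) k l + -1 * (A u *m X u *m P) k l).
    by rewrite mul0r add0r mulN1r /Y mulmxBr mulmxA !mxE.
  by apply: qderivD => //; apply: qderivM d2; apply: qderiv_cst.
have Y00 : Y 0 = 0 by rewrite /Y X0 mul1mx add0r XT subrr.
have Y0 : Y 0 *m (delta_mx j 0 : V) = 0 by rewrite Y00 mul0mx.
have := linear_solution_unique (sol Y (delta_mx j 0) Y_der) Y0 t.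
by move=> /(congr1 (fun M : V => M i 0)); rewrite -colE [RHS]mxE mxE => ->; rewrite mxE.
Qed.

End LinearEquation.

Lemma multipliers_neq0 (K : fieldType) n (P : 'M[K]_n) (mu : 'I_n -> K) :
  P \in unitmx -> char_poly P = \prod_(i < n) ('X - (mu i)%:P) -> forall i, mu i != 0.
Proof.
move=> Pu cP i; apply: contraL Pu => /eqP mi0.
have : root (char_poly P) 0.
  by rewrite cP (bigD1 i) //= rootM mi0 root_XsubC eqxx.
rewrite -eigenvalue_root_char => /eigenvalueP [v]; rewrite scale0r => vP v0.
by apply/negP => Pu; case/eqP: v0; rewrite -(mulmxK Pu v) vP mul0mx.
Qed.

(** * Transport of leading terms along the linear flow *)

Section Transport.
Variables (R : realType) (n : nat).
Local Notation C := (cplx R).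
Local Notation V := 'cV[C]_n.

(** The logarithmic derivative of a power, free of division. *)
Lemma qderivX (phi : R -> C) t l k : qderiv phi t l ->
  exists2 l', qderiv (fun s => phi s ^+ k) t l' & phi t * l' = k%:R * phi t ^+ k * l.
Proof.
move=> h; elim: k => [|k [l' h1 h2]].
  by exists 0; [exact: qderiv_cst|rewrite mulr0 !mul0r].
exists (l * phi t ^+ k + phi t * l').
  by apply: qderiv_ext (qderivM h h1) => s; rewrite exprS.
by rewrite h2 -natr1 exprS; ring.
Qed.

Lemma qderiv0_const (phi : R -> C) t0 (e : R) :
  (forall t, `|t - t0| < e -> qderiv phi t 0) ->
  forall t, `|t - t0| < e -> phi t = phi t0.
Proof.
move=> h; have h' t : `|t - t0| < e -> tderivable phi t /\ tderive phi t = 0.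
  by move=> /h /qderiv_tderive.
have main a b : a <= b -> (forall s, a <= s <= b -> `|s - t0| < e) -> phi a = phi b.
  move=> ab hs; apply/eqP; rewrite eq_sym -subr_eq0 -cmod_eq0 eq_le cmod_ge0 andbT.
  apply: le_trans (@mean_value R phi a b 0 ab _ _) _.
  - by move=> s /hs /h' [].
  - by move=> s /hs /h' [_ ->]; rewrite cmod0.
  by rewrite mulr0 mul0r.
move=> t te; have [tt|/ltW tt] := leP t t0; [|symmetry]; apply: main => // s /andP [s1 s2];
  move: te; rewrite !ltr_norml => /andP [h1 h2]; apply/andP; split; lra.
Qed.

(** After multiplication by a the identity also holds at the zeros of a. *)
Lemma poly_identity_off_zeros (a b c d : mpoly n C) (fa fb fc fd : V -> C) D : a != 0 ->
  (forall x, pev a x = fa x) -> (forall x, pev b x = fb x) ->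
  (forall x, pev c x = fc x) -> (forall x, pev d x = fd x) ->
  (forall x, fa x != 0 -> fb x * fa x ^+ D = fc x * fd x ^+ D) ->
  b * a ^+ D = c * d ^+ D.
Proof.
move=> a0 ha hb hc hd h.
suff key x : pev (a * (b * a ^+ D)) x = pev (a * (c * d ^+ D)) x.
  exact: (mulfI a0 (pev_inj key)).
have pevE p q r : pev (p * (q * r ^+ D)) x = pev p x * (pev q x * pev r x ^+ D).
  by rewrite pevM; congr (_ * _); rewrite pevM; congr (_ * _); exact: pev_exp.
apply: (eq_trans (pevE a b a)); apply: (eq_trans _ (esym (pevE a c d))).
rewrite ha hb hc hd.
by have [->|ax] := eqVneq (fa x) 0; [rewrite !mul0r|rewrite h].
Qed.

Lemma pev_relation (a b c d : mpoly n C) (k : C) (x : V) : a * b = k *: (c * d) ->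
  pev a x * pev b x = k * (pev c x * pev d x).
Proof. by move=> e; apply: eq_trans (esym (pevM a b x)) _; rewrite e pevZ; congr (_ * _); exact: pevM. Qed.

Variables (A : R -> 'M[C]_n) (X : R -> 'M[C]_n).
Hypothesis X_an : forall i j t, analytic1 (fun s => X s i j) t.
Hypothesis X_der : forall i j t, qderiv (fun s => X s i j) t ((A t *m X t) i j).

(** The derivative along the vector field phi of a polynomial in x whose
    coefficients depend on time and have the derivatives q. *)
Definition total_deriv (phi : 'I_n -> mpoly n C) (p q : mpoly n C) : mpoly n C :=
  q + \sum_l mderiv l p * phi l.

Lemma pev_linear_form (M : 'M[C]_n) l x : pev (linear_form M l) x = (M *m x) l 0.
Proof.
by rewrite pev_sum mxE; apply: eq_bigr => j _; rewrite pevZ /pev mevalXU.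
Qed.

Lemma pev_total_deriv (M : 'M[C]_n) p q x :
  pev (total_deriv (linear_form M) p q) x = pev q x + \sum_l pev (mderiv l p) x * (M *m x) l 0.
Proof.
by rewrite pevD pev_sum; congr (_ + _); apply: eq_bigr => l _; rewrite pevM pev_linear_form.
Qed.

Lemma analytic1_flow (B : nat) (p : R -> mpoly n C) xi t :
  (forall s, (msize (p s) <= B)%N) -> (forall m t, analytic1 (fun s => (p s)@_m) t) ->
  analytic1 (fun s => pev (p s) (X s *m xi)) t.
Proof.
move=> p_size p_an.
suff h : analytic1 (fun s => \sum_(a : bmultinom n B) (p s)@_a *
    \prod_(i < n) (X s *m xi) i 0 ^+ (a : multinom n) i) t.
  by apply: analytic1_ext ltr01 _ h => s _; rewrite (pevwE _ (p_size _)).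
apply: analytic1_sum => a _; apply: analytic1M => //.
apply: analytic1_prod => i _; apply: analytic1X.
suff h : analytic1 (fun s => \sum_j X s i j * xi j 0) t.
  by apply: analytic1_ext ltr01 _ h => s _; rewrite mxE.
by apply: analytic1_sum => j _; apply: analytic1M => //; apply: analytic1_cst.
Qed.

Lemma qderiv_flow (B : nat) (p : R -> mpoly n C) q xi t :
  (forall s, (msize (p s) <= B)%N) -> (msize q <= B)%N ->
  (forall m, qderiv (fun s => (p s)@_m) t q@_m) ->
  qderiv (fun s => pev (p s) (X s *m xi)) t (pev (total_deriv (linear_form (A t)) (p t) q) (X t *m xi)).
Proof.
move=> p_size q_size p_der; rewrite pev_total_deriv.
apply: (@qderiv_pev R n p q (fun s => X s *m xi) (A t *m (X t *m xi)) t B) => // i.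
rewrite mulmxA mxE; apply: (@qderiv_ext _ (fun s => \sum_j X s i j * xi j 0)).
  by move=> s; rewrite mxE.
apply: qderiv_sum => j; rewrite -[X in qderiv _ _ X]addr0 -[X in _ + X](mulr0 (X t i j)).
exact: qderivM (X_der i j t) (qderiv_cst _ _).
Qed.

Variables (B : nat) (u h : R -> mpoly n C) (D : nat) (t0 e : R).
Hypothesis e_gt0 : 0 < e.
Hypothesis u_size : forall t, (msize (u t) <= B)%N.
Hypothesis h_size : forall t, (msize (h t) <= B)%N.
Hypothesis u_an : forall m t, analytic1 (fun s => (u s)@_m) t.
Hypothesis h_an : forall m t, analytic1 (fun s => (h s)@_m) t.
Hypothesis h_neq0 : h t0 != 0.
Hypothesis X_unit : X t0 \in unitmx.
Hypothesis eqn : forall t, `|t - t0| < e -> exists qu qh,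
  [/\ (msize qu <= B)%N, (msize qh <= B)%N,
      forall m, qderiv (fun s => (u s)@_m) t qu@_m,
      forall m, qderiv (fun s => (h s)@_m) t qh@_m &
      h t * total_deriv (linear_form (A t)) (u t) qu =
        D%:R *: (u t * total_deriv (linear_form (A t)) (h t) qh)].

(** The quotient u / h^D is constant along the solutions of the linear equation:
    its derivative vanishes near t0, hence the identity holds for all times by
    analyticity. *)
Lemma transport t :
  lsubst (X t) (u t) * lsubst (X t0) (h t0) ^+ D =
  lsubst (X t0) (u t0) * lsubst (X t) (h t) ^+ D.
Proof.
have b0 : lsubst (X t0) (h t0) != 0.
  by apply: contraNneq h_neq0 => /(lsubst_eq0 X_unit) ->.
pose uf xi s := pev (u s) (X s *m xi); pose hf xi s := pev (h s) (X s *m xi).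
apply: (@poly_identity_off_zeros _ _ _ _ (hf^~ t0) (uf^~ t) (uf^~ t0) (hf^~ t) D b0);
  try by move=> xi; apply: pev_lsubst.
move=> xi; have [U uE] : exists U, U = uf xi by exists (uf xi).
have [H hE] : exists H, H = hf xi by exists (hf xi).
rewrite -uE -hE => hn0.
have hf_an s : analytic1 H s by rewrite hE; apply: analytic1_flow.
have uf_an s : analytic1 U s by rewrite uE; apply: analytic1_flow.
suff near0 : exists d : R, 0 < d /\ forall s, `|s| < d ->
    U (t0 + s) * H t0 ^+ D - U t0 * H (t0 + s) ^+ D = 0.
  apply/eqP; rewrite -subr_eq0; apply/eqP.
  apply: (@identity_line R (fun s => U s * H t0 ^+ D - U t0 * H s ^+ D) t0) near0 t => s.
  apply: analytic1B; apply: analytic1M => //; first exact: analytic1_cst.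
    exact: analytic1_cst.
  exact: analytic1X.
have [d [d0 hd]] : exists d : R, 0 < d /\ forall s, `|s| < d -> H (t0 + s) != 0.
  have [l /qderiv_lipschitz [K [d [K0 d0 hd]]]] := analytic1_qderiv (hf_an t0).
  have c0 : 0 < cmod (H t0) by rewrite cmod_gt0.
  exists (Num.min d (cmod (H t0) / (K + 1))).
  split; first by rewrite lt_min d0 divr_gt0 // ltr_wpDl.
  move=> s; rewrite lt_min ltr_pdivlMr ?ltr_wpDl // => /andP [sd sK].
  rewrite -cmod_gt0; have := cmod_le_dist (H t0) (H (t0 + s)).
  rewrite cmodB; have := hd s sd; have : 0 <= `|s| by []; rewrite mulrDr in sK.
  by rewrite [K * _]mulrC; lra.
pose d' := Num.min d e.
have d'd : d' <= d by rewrite /d' ge_min lexx.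
have d'e : d' <= e by rewrite /d' ge_min lexx orbT.
have d'0 : 0 < d' by rewrite lt_min d0.
have hfn s : `|s - t0| < d' -> H s != 0.
  by move=> sd; rewrite -(subrK t0 s) addrC; apply: hd; apply: lt_le_trans d'd.
have cst s : `|s - t0| < d' -> U s / H s ^+ D = U t0 / H t0 ^+ D.
  apply: (@qderiv0_const (fun s => U s / H s ^+ D)) => {}s sd.
  have [qu [qh [su sh du dh rel]]] := eqn (lt_le_trans sd d'e).
  have hu : qderiv U s (pev (total_deriv (linear_form (A s)) (u s) qu) (X s *m xi)).
    by rewrite uE; exact: qderiv_flow.
  have hh : qderiv H s (pev (total_deriv (linear_form (A s)) (h s) qh) (X s *m xi)).
    by rewrite hE; exact: qderiv_flow.
  have [l' hl' el'] := qderivX D hh.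
  have := @qderiv_quotient R (fun s => U s / H s ^+ D) _ _ _ _ _ _ hu hl' (expf_neq0 D (hfn s sd)) ltr01 (fun s _ => erefl).
  congr (qderiv _ _ _); apply/eqP; rewrite mulf_eq0 subr_eq0; apply/orP; left.
  apply/eqP; apply: (mulfI (hfn s sd)).
  have := pev_relation (X s *m xi) rel.
  rewrite -[pev (u s) _]/(uf xi s) -[pev (h s) _]/(hf xi s) -uE -hE => E.
  by rewrite mulrCA E [RHS]mulrCA el'; ring.
exists d'; split=> // s sd; apply/eqP; rewrite subr_eq0.
have sd' : `|t0 + s - t0| < d' by rewrite [t0 + _]addrC addrK.
have hD := expf_neq0 D (hfn _ sd'); have hD0 := expf_neq0 D hn0.
by rewrite -(divfK hD (U (t0 + s))) (cst _ sd') mulrAC divfK // mulrC.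
Qed.

End Transport.

(** * Derivation of homogenized polynomials *)

Section Derivation.
Variables (R : realType) (n : nat).
Local Notation C := (cplx R).
Implicit Types (p v w : R -> mpoly n C) (q z : mpoly n C) (t : R).

Definition coef_qderiv p q t := forall m, qderiv (fun s => (p s)@_m) t q@_m.

Lemma coef_qderiv_cst z t : coef_qderiv (fun=> z) 0 t.
Proof. by move=> m; rewrite mcoeff0; apply: qderiv_cst. Qed.

Lemma coef_qderivD v w q z t : coef_qderiv v q t -> coef_qderiv w z t ->
  coef_qderiv (fun s => v s + w s) (q + z) t.
Proof.
move=> hv hw m; rewrite mcoeffD; apply: qderiv_ext (qderivD (hv m) (hw m)) => s.
by rewrite mcoeffD.
Qed.

Lemma coef_qderivM v w q z t : coef_qderiv v q t -> coef_qderiv w z t ->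
  coef_qderiv (fun s => v s * w s) (q * w t + v t * z) t.
Proof.
have sum_cond (I : Type) (r : seq I) (P : pred I) (F : I -> R -> C) (l : I -> C) :
    (forall i, qderiv (F i) t (l i)) ->
    qderiv (fun s => \sum_(i <- r | P i) F i s) t (\sum_(i <- r | P i) l i).
  move=> h; rewrite -big_filter.
  by apply: qderiv_ext (qderiv_sum [seq i <- r | P i] h) => s; rewrite big_filter.
move=> hv hw m; rewrite mcoeffD !mcoeffM -big_split.
apply: (qderiv_ext (fun s => esym (mcoeffM (v s) (w s) m))).
by apply: sum_cond => k; apply: qderivM.
Qed.

Lemma coef_qderiv_prod (I : Type) (r : seq I) (v : I -> R -> mpoly n C) t :
  (forall i, exists q, coef_qderiv (v i) q t) ->
  exists q, coef_qderiv (fun s => \prod_(i <- r) v i s) q t.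
Proof.
move=> h; elim: r => [|i r [q ih]].
  by exists 0 => m; apply: qderiv_ext (coef_qderiv_cst 1 t m) => s; rewrite big_nil.
have [z hz] := h i; exists (z * (\prod_(j <- r) v j t) + v i t * q) => m.
by apply: qderiv_ext (coef_qderivM hz ih m) => s; rewrite big_cons.
Qed.

Variables (phi : 'I_n -> mpoly n C) (M : nat).
Local Notation der := (total_deriv phi).

Lemma total_derivD (p1 p2 q1 q2 : mpoly n C) : der (p1 + p2) (q1 + q2) = der p1 q1 + der p2 q2.
Proof.
rewrite /total_deriv addrACA -big_split; congr (_ + _); apply: eq_bigr => l _.
by rewrite linearD mulrDl.
Qed.

Lemma total_derivM (p1 p2 q1 q2 : mpoly n C) :
  der (p1 * p2) (q1 * p2 + p1 * q2) = der p1 q1 * p2 + p1 * der p2 q2.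
Proof.
rewrite /total_deriv mulrDl mulrDr addrACA mulr_suml mulr_sumr -big_split.
congr (_ + _); apply: eq_bigr => l _; rewrite mderivM mulrDl /=.
by rewrite mulrAC mulrA.
Qed.

Variables (E Ez : mpoly n C).

(** Modulo terms of order M, the logarithmic derivative of v is d times that of
    a common denominator E with derivative Ez; that is, v / E ^ d is a first
    integral up to order M. *)
Definition graded d v t := exists2 q, coef_qderiv v q t &
  ordge M (E * der (v t) q - d%:R * (v t * Ez)).

Lemma gradedC (c : C) t : graded 0 (fun=> mpolyC n c) t.
Proof.
exists 0; first exact: coef_qderiv_cst.
rewrite mul0r subr0 /total_deriv add0r big1 ?mulr0 ?ordge0 // => l _.
by rewrite mderivC mul0r.
Qed.

Lemma gradedD d v w t : graded d v t -> graded d w t -> graded d (fun s => v s + w s) t.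
Proof.
move=> [q hq oq] [z hz oz]; exists (q + z); first exact: coef_qderivD.
rewrite total_derivD.
have id (K : comNzRingType) (e a b c d' x y : K) :
    e * (a + b) - d' * ((x + y) * c) = (e * a - d' * (x * c)) + (e * b - d' * (y * c)).
  by ring.
by rewrite (id _ E (der (v t) q) (der (w t) z)); exact: ordgeD oq oz.
Qed.

Lemma gradedM c d v w t : graded c v t -> graded d w t ->
  graded (c + d) (fun s => v s * w s) t.
Proof.
move=> [q hq oq] [z hz oz]; exists (q * w t + v t * z); first exact: coef_qderivM.
rewrite total_derivM natrD.
have id (K : comNzRingType) (e a b c' d' x y f : K) : e * (a * y + x * b) - (c' + d') * (x * y * f) =
    (e * a - c' * (x * f)) * y + x * (e * b - d' * (y * f)).
  by ring.
rewrite (id _ E (der (v t) q) (der (w t) z) c%:R d%:R (v t) (w t) Ez).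
exact: ordgeD (ordgeMl _ oq) (ordgeMr _ oz).
Qed.

Lemma graded_ext d v w t : (forall s, v s = w s) -> graded d v t -> graded d w t.
Proof. by move=> h; have -> : v = w by apply/funext. Qed.

Lemma graded_deg c d v t : c = d -> graded c v t -> graded d v t.
Proof. by move=> ->. Qed.

Lemma graded1 t : graded 0 (fun=> 1) t.
Proof. by have := gradedC 1 t; rewrite mpolyC1. Qed.

Lemma gradedX v t k : graded 1 v t -> graded k (fun s => v s ^+ k) t.
Proof.
move=> hv; elim: k => [|k ih]; first exact: graded1.
by rewrite -add1n; apply: graded_ext (gradedM hv ih) => s; rewrite -exprS.
Qed.

Lemma graded_prod (I : Type) (r : seq I) (d : I -> nat) (v : I -> R -> mpoly n C) t :
  (forall i, graded (d i) (v i) t) ->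
  graded (\sum_(i <- r) d i) (fun s => \prod_(i <- r) v i s) t.
Proof.
move=> h; elim: r => [|i r ih].
  by rewrite big_nil; apply: graded_ext (graded1 t) => s; rewrite big_nil.
by rewrite big_cons; apply: graded_ext (gradedM (h i) ih) => s; rewrite big_cons.
Qed.

Lemma graded_sum (I : Type) (r : seq I) d (v : I -> R -> mpoly n C) t :
  (forall i, graded d (v i) t) -> graded d (fun s => \sum_(i <- r) v i s) t.
Proof.
move=> h; elim: r => [|i r ih].
  apply: (@graded_ext _ (fun=> 0)); first by move=> s; rewrite big_nil.
  exists 0; first exact: coef_qderiv_cst.
  rewrite mul0r mulr0 subr0 /total_deriv add0r big1 ?mulr0 ?ordge0 // => l _.
  by rewrite linear0 mul0r.
by apply: graded_ext (gradedD (h i) ih) => s; rewrite big_cons.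
Qed.

(** Each monomial of the homogenization is a product of D factors of degree one
    with a constant. *)
Lemma graded_homogenize m (G : R -> 'I_m -> mpoly n C) (H : R -> mpoly n C) D
    (p : mpoly m C) t :
  (forall i, graded 1 (G^~ i) t) -> graded 1 H t ->
  graded D (fun s => homogenize (G s) (H s) D p) t.
Proof.
move=> hG hH; apply: graded_sum => a.
have ha : (mdeg a <= D)%N by rewrite -ltnS bmdeg.
have hmonG : graded D (fun s => hmon (G s) (H s) D a) t.
  apply: (@graded_deg (mdeg a + (D - mdeg a))); first by rewrite subnKC.
  apply: gradedM (gradedX _ hH).
  apply: (@graded_deg (\sum_i (a : multinom m) i)%N); first by rewrite mdegE.
  exact: (@graded_prod _ _ (fun i => (a : multinom m) i) _ t (fun i => gradedX _ (hG i))).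
apply: (@graded_ext _ (fun s => mpolyC n p@_a * hmon (G s) (H s) D a)).
  by move=> s; rewrite mul_mpolyC.
exact: (gradedM (gradedC _ _) hmonG).
Qed.

End Derivation.

(** * The equation of a first integral at the equilibrium *)

Section FirstIntegral.
Variables (R : realType) (n : nat) (rho : R).
Local Notation C := (cplx R).
Local Notation V := 'cV[C]_n.
Variables (f : R -> V -> V) (F G H : R -> V -> C).
Hypothesis rho_gt0 : 0 < rho.
Hypothesis G_an : analytic_on rho G.
Hypothesis H_an : analytic_on rho H.
Hypothesis F_quotient : forall t x, vmod x < rho -> H t x != 0 -> F t x = G t x / H t x.
Hypothesis F_integral : forall t x, vmod x < rho -> H t x != 0 ->
  tderive (fun s => F s x) t + \sum_(j < n) xpartial F j t x * f t x j 0 = 0.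

Definition lie_deriv (u : R -> V -> C) t x : C :=
  tderive (fun s => u s x) t + \sum_(j < n) xpartial u j t x * f t x j 0.

Lemma quotient_tderive t x : vmod x < rho -> H t x != 0 ->
  tderive (fun s => F s x) t =
  (H t x * tderive (fun s => G s x) t - G t x * tderive (fun s => H s x) t) / H t x ^+ 2.
Proof.
move=> xr hn0; have at_x u : analytic_on rho u -> analytic_at u t x.
  by move=> an; apply: an; rewrite lt_vmod.
have [d d0 hd] := analytic_locally_neq0 (at_x _ H_an) hn0.
have := qderiv_quotient (f := fun s => F s x) (analytic_tderive (at_x _ G_an))
  (analytic_tderive (at_x _ H_an)) hn0 d0.
move=> h; have [s sd|_ ->] := qderiv_tderive (h _); last by [].
by rewrite F_quotient // hd ?subrr ?vmod0 // addrC addKr.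
Qed.

Lemma quotient_xpartial t x j : vmod x < rho -> H t x != 0 ->
  xpartial F j t x =
  (H t x * xpartial G j t x - G t x * xpartial H j t x) / H t x ^+ 2.
Proof.
move=> xr hn0; have at_x u : analytic_on rho u -> analytic_at u t x.
  by move=> an; apply: an; rewrite lt_vmod.
have [d d0 hd] := analytic_locally_neq0 (at_x _ H_an) hn0.
pose e := Num.min d (rho - vmod x).
have e0 : 0 < e by rewrite lt_min d0 subr_gt0.
have := gderiv_quotient (f := fun h => F t (x + h *: delta_mx j 0)) (e := e)
  (analytic_cderiv j (at_x _ G_an)) (analytic_cderiv j (at_x _ H_an)).
rewrite !scale0r !addr0 => h; apply: cderiv_xpartial; apply: h => // a.
rewrite lt_min => /andP [a1 a2].
have ha : vmod (a *: delta_mx j 0 : V) <= cmod a.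
  by rewrite vmodZ ler_piMr ?cmod_ge0 // vmod_delta.
rewrite F_quotient //.
  by apply: le_lt_trans (vmodD _ _) _; rewrite -ltrBrDl; apply: le_lt_trans ha a2.
apply: hd; rewrite ?subrr ?normr0 //.
by rewrite [x + _]addrC addrK; apply: le_lt_trans ha a1.
Qed.

(** Where H vanishes the identity is trivial, and elsewhere it is the equation
    of F = G / H multiplied by the denominators. *)
Lemma first_integral_identity t x : vmod x < rho ->
  H t x * (H t x * lie_deriv G t x - G t x * lie_deriv H t x) = 0.
Proof.
move=> xr; have [-> | hn0] := eqVneq (H t x) 0; first by rewrite mul0r.
have := F_integral xr hn0; rewrite quotient_tderive //.
under eq_bigr => j _ do rewrite quotient_xpartial // mulrAC.
rewrite -mulr_suml -mulrDl => /eqP; rewrite mulf_eq0 invr_eq0 expf_eq0 /= (negPf hn0) orbF.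
move=> /eqP e; rewrite [X in _ * X](_ : _ = 0) ?mulr0 // -[RHS]e /lie_deriv !mulrDr opprD.
rewrite addrACA; congr (_ + _); rewrite !mulr_sumr -sumrB.
by apply: eq_bigr => j _; rewrite mulrBl !mulrA.
Qed.

Variables (cf : 'I_n -> R -> multinom n -> C) (cg cg' ch ch' : R -> multinom n -> C).
Hypothesis f_approx : forall j t N, approx N (fun x => f t x j 0) (trunc N (cf j t)).
Hypothesis G_expands : expands G cg cg'.
Hypothesis H_expands : expands H ch ch'.

Lemma approx_lie_deriv (u : R -> V -> C) c c' N t : expands u c c' ->
  approx N (lie_deriv u t)
    (total_deriv (fun j => trunc N (cf j t)) (trunc N.+1 (c t)) (trunc N.+1 (c' t))).
Proof.
move=> [_ _ hx _ ht]; apply: approxD; first exact: approx_leq (leqnSn N) (ht t N.+1).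
by apply: approx_sum => j; apply: approxM.
Qed.

(** The identity of order N for the jets has the denominator as a factor; canceling
    it costs its order, which is at most kappa. *)
Lemma first_integral_jets N t kappa : (exists2 m, (mdeg m <= kappa)%N & ch t m != 0) ->
  (kappa <= N)%N ->
  ordge (N - kappa)
   (trunc N.+1 (ch t) * total_deriv (fun j => trunc N (cf j t)) (trunc N.+1 (cg t)) (trunc N.+1 (cg' t))
   - trunc N.+1 (cg t) * total_deriv (fun j => trunc N (cf j t)) (trunc N.+1 (ch t)) (trunc N.+1 (ch' t))).
Proof.
move=> [m mk chm] kN.
have aG : approx N (G t) (trunc N.+1 (cg t)).
  by have [h _ _ _ _] := G_expands; apply: approx_leq (leqnSn N) (h t N.+1).
have aH : approx N (H t) (trunc N.+1 (ch t)).
  by have [h _ _ _ _] := H_expands; apply: approx_leq (leqnSn N) (h t N.+1).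
have := approxM aH (approxB (approxM aH (approx_lie_deriv N t G_expands))
                            (approxM aG (approx_lie_deriv N t H_expands))).
move=> /(approx_ext rho_gt0 (fun x xr => first_integral_identity t xr)).
set K := _ - _ => h.
have : ordge N (trunc N.+1 (ch t) * K).
  have := approx_unique h (approx_ext' (fun x => pev0 x) (approx_pev N 0)).
  by rewrite subr0.
rewrite mulrC => hK; apply: (ordge_cancel hK).
apply/negP => /ordgeP /(_ m); rewrite mcoeff_trunc !ltnS (leq_trans mk kN) => /(_ mk) /eqP.
by apply/negP.
Qed.

End FirstIntegral.

(** * Leading forms *)

Section LeadingForms.
Variables (R : realType) (n : nat).
Local Notation C := (cplx R).
Local Notation V := 'cV[C]_n.
Implicit Types (p q : mpoly n C).

Lemma lsubstM (Q : 'M[C]_n) p q : lsubst Q (p * q) = lsubst Q p * lsubst Q q.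
Proof. exact: rmorphM. Qed.

Lemma lsubst_exp (Q : 'M[C]_n) p k : lsubst Q (p ^+ k) = lsubst Q p ^+ k.
Proof. exact: rmorphXn. Qed.

Lemma lsubst_comp (M Q : 'M[C]_n) p : lsubst Q (lsubst M p) = lsubst (M *m Q) p.
Proof.
apply: pev_inj => x; apply: eq_trans (pev_lsubst Q (lsubst M p) x) _.
apply: eq_trans (pev_lsubst M p (Q *m x)) _; rewrite mulmxA.
exact: esym (pev_lsubst (M *m Q) p x).
Qed.

Lemma lsubst_relation (Q : 'M[C]_n) (a b c d : mpoly n C) D : a * b ^+ D = c * d ^+ D ->
  lsubst Q a * lsubst Q b ^+ D = lsubst Q c * lsubst Q d ^+ D.
Proof.
have e (p q : mpoly n C) : lsubst Q (p * q ^+ D) = lsubst Q p * lsubst Q q ^+ D.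
  by apply: eq_trans (lsubstM _ _ _) _; congr (_ * _); exact: lsubst_exp.
by move=> h; apply: eq_trans (esym (e a b)) (eq_trans _ (e c d)); rewrite h.
Qed.

Lemma lsubst0 (Q : 'M[C]_n) : lsubst Q 0 = 0.
Proof. exact: rmorph0. Qed.

Lemma msize_hpart k p : (msize (hpart k p) <= k.+1)%N.
Proof.
rewrite msizeE; apply/bigmax_leqP_seq => m; rewrite mcoeff_msupp mcoeff_hpart.
by case: (mdeg m =P k) => [-> //|]; rewrite eqxx.
Qed.

Lemma hpart_mderiv k l p : hpart k (mderiv l p) = mderiv l (hpart k.+1 p).
Proof.
apply/mpolyP => m; rewrite mcoeff_hpart !mcoeff_mderiv mcoeff_hpart mdegD mdeg1 addn1 eqSS.
by case: (_ == _); rewrite ?mul0rn.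
Qed.

(** A vector field vanishing at the origin does not lower the degree, and only its
    linear part M preserves it. *)
Lemma hpart_total_deriv (phi : 'I_n -> mpoly n C) (M : 'M[C]_n) k p q :
  (forall l, ordge 1 (phi l)) -> (forall l, hpart 1 (phi l) = linear_form M l) ->
  ordge k p ->
  hpart k (total_deriv phi p q) = total_deriv (linear_form M) (hpart k p) (hpart k q).
Proof.
move=> o1 h1 op; rewrite /total_deriv hpartD; congr (_ + _).
rewrite /hpart raddf_sum; apply: eq_bigr => l _ /=; rewrite -/(hpart _ _) -/(hpart _ _).
case: k op => [|k] op; last first.
  have e := hpartM (ordge_mderiv l op) (o1 l); rewrite addn1 in e.
  by apply: eq_trans e _; rewrite hpart_mderiv h1.
have -> : hpart 0 (mderiv l p * phi l) = 0.
  by apply: hpart_ordge; exact: (@ordgeM _ _ 0 1 _ _ (ordge0n _) (o1 l)).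
suff -> : mderiv l (hpart 0 p) = 0 by rewrite mul0r.
apply/mpolyP => m; rewrite mcoeff_mderiv mcoeff_hpart mdegD mdeg1 addn1 /= mul0rn.
by rewrite mcoeff0.
Qed.

Lemma ordge_total_deriv (phi : 'I_n -> mpoly n C) k p q :
  (forall l, ordge 1 (phi l)) -> ordge k p -> ordge k q -> ordge k (total_deriv phi p q).
Proof.
move=> o1 op oq; apply: ordgeD => //; apply: ordge_sum => l _.
case: k op {oq} => [|k] op; first exact: ordge0n.
by rewrite -addn1; exact: ordgeM (ordge_mderiv l op) (o1 l).
Qed.

Lemma order_prod (I : Type) (r : seq I) (P : pred I) (a : I -> nat) (p : I -> mpoly n C) :
  (forall i, P i -> ~~ ordge (a i).+1 (p i)) ->
  ~~ ordge (\sum_(i <- r | P i) a i).+1 (\prod_(i <- r | P i) p i).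
Proof.
move=> h; elim: r => [|i r ih].
  by rewrite !big_nil -[1]/(1 ^+ 0); apply: (@order_exp _ _ 0 1 0); 
     apply/negP => /ordgeP /(_ (@mnm0 n)); rewrite mdeg0 mcoeff1 eqxx => /(_ isT) /eqP; rewrite oner_eq0.
by rewrite !big_cons; case: ifP => // Pi; apply: order_mul => //; apply: h.
Qed.

Lemma ordge_prod (I : Type) (r : seq I) (P : pred I) (a : I -> nat) (p : I -> mpoly n C) :
  (forall i, P i -> ordge (a i) (p i)) ->
  ordge (\sum_(i <- r | P i) a i) (\prod_(i <- r | P i) p i).
Proof.
move=> h; elim: r => [|i r ih]; first by rewrite !big_nil ordge0n.
by rewrite !big_cons; case: ifP => // Pi; apply: ordgeM => //; apply: h.
Qed.

Definition coef_analytic (p : R -> mpoly n C) := forall m t, analytic1 (fun s => (p s)@_m) t.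

Lemma coef_analytic_ext (p' p : R -> mpoly n C) : (forall s, p s = p' s) -> coef_analytic p -> coef_analytic p'.
Proof. by move=> e; have -> : p = p' by apply/funext. Qed.

Lemma coef_analyticC (c : mpoly n C) : coef_analytic (fun=> c).
Proof. by move=> m t; apply: analytic1_cst. Qed.

Lemma coef_analyticM (p q : R -> mpoly n C) : coef_analytic p -> coef_analytic q ->
  coef_analytic (fun s => p s * q s).
Proof.
move=> hp hq m t; have -> : (fun s => (p s * q s)@_m) = (fun s => _) := funext (fun s => mcoeffM (p s) (q s) m).
by apply: analytic1_sum => k _; apply: analytic1M.
Qed.

Lemma coef_analytic_prod (I : Type) (r : seq I) (P : pred I) (p : I -> R -> mpoly n C) :
  (forall i, coef_analytic (p i)) -> coef_analytic (fun s => \prod_(i <- r | P i) p i s).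
Proof.
move=> h; elim: r => [|i r ih].
  by apply: coef_analytic_ext (coef_analyticC 1) => s; rewrite big_nil.
case Pi: (P i); last by apply: coef_analytic_ext ih => s; rewrite big_cons Pi.
by apply: coef_analytic_ext (coef_analyticM (h i) ih) => s; rewrite big_cons Pi.
Qed.

Lemma coef_analyticX (p : R -> mpoly n C) k : coef_analytic p -> coef_analytic (fun s => p s ^+ k).
Proof.
move=> h; elim: k => [|k ih]; first exact: coef_analyticC 1.
by apply: coef_analytic_ext (coef_analyticM h ih) => s; rewrite exprS.
Qed.

Lemma coef_analytic_homogenize m (G : R -> 'I_m -> mpoly n C) (H : R -> mpoly n C) D
    (p : mpoly m C) :
  (forall i, coef_analytic (G^~ i)) -> coef_analytic H ->
  coef_analytic (fun s => homogenize (G s) (H s) D p).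
Proof.
move=> hG hH k t.
apply: (@analytic1_ext _ (fun s => \sum_(a : bmultinom m D.+1) p@_a * (hmon (G s) (H s) D a)@_k) _ _ 1) => //.
  by move=> s _; rewrite /homogenize linear_sum; apply: eq_bigr => a _ /=; rewrite mcoeffZ.
apply: analytic1_sum => a _; apply: analytic1M; first exact: analytic1_cst.
apply: (coef_analyticM _ (coef_analyticX _ hH)); apply: coef_analytic_prod => i.
exact: coef_analyticX.
Qed.

Lemma coef_analytic_trunc N (c : R -> multinom n -> C) :
  (forall m t, analytic1 (fun s => c s m) t) -> coef_analytic (fun s => trunc N (c s)).
Proof.
move=> h m t; case: (ltnP (mdeg m) N) => mN.
  by apply: analytic1_ext ltr01 _ (h m t) => s _; rewrite mcoeff_trunc mN.
apply: analytic1_ext ltr01 _ (analytic1_cst 0 t) => s _.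
by rewrite mcoeff_trunc ltnNge mN.
Qed.

Lemma coef_analytic_hpart k (p : R -> mpoly n C) : coef_analytic p ->
  coef_analytic (fun s => hpart k (p s)).
Proof.
move=> h m t; case E: (mdeg m == k).
  by apply: analytic1_ext ltr01 _ (h m t) => s _; rewrite mcoeff_hpart E.
by apply: analytic1_ext ltr01 _ (analytic1_cst 0 t) => s _; rewrite mcoeff_hpart E.
Qed.

Lemma coef_qderiv_hpart k (p : R -> mpoly n C) q t : coef_qderiv p q t ->
  coef_qderiv (fun s => hpart k (p s)) (hpart k q) t.
Proof.
move=> h m; rewrite mcoeff_hpart; case E: (mdeg m == k).
  by apply: qderiv_ext (h m) => s; rewrite mcoeff_hpart E.
by apply: qderiv_ext (qderiv_cst 0 t) => s; rewrite mcoeff_hpart E.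
Qed.

Lemma coef_qderiv_ordge k (p : R -> mpoly n C) q t : coef_qderiv p q t ->
  (forall s, ordge k (p s)) -> ordge k q.
Proof.
move=> h op; apply/ordgeP => m mk; apply: qderiv_unique (h m) _.
by apply: qderiv_ext (qderiv_cst 0 t) => s; have /ordgeP -> := op s.
Qed.

Lemma coef_qderiv_unique (p : R -> mpoly n C) (q1 q2 : mpoly n C) t :
  coef_qderiv p q1 t -> coef_qderiv p q2 t -> q1 = q2.
Proof. by move=> h1 h2; apply/mpolyP => m; apply: qderiv_unique (h1 m) (h2 m). Qed.

Lemma coef_qderiv_trunc N (c : R -> multinom n -> C) (c' : multinom n -> C) t :
  (forall m, qderiv (fun s => c s m) t (c' m)) ->
  coef_qderiv (fun s => trunc N (c s)) (trunc N c') t.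
Proof.
move=> h m; rewrite mcoeff_trunc; case: ltnP => mN.
  by apply: qderiv_ext (h m) => s; rewrite mcoeff_trunc mN.
by apply: qderiv_ext (qderiv_cst 0 t) => s; rewrite mcoeff_trunc ltnNge mN.
Qed.

End LeadingForms.

(** * Leading exponents of first integrals are resonant *)

Section LeadingExponents.
Variables (R : realType) (n m : nat).
Local Notation C := (cplx R).
Local Notation V := 'cV[C]_n.
Variables (cf : 'I_n -> R -> multinom n -> C) (cg cg' ch ch' : 'I_m -> R -> multinom n -> C).
Variables (A X : R -> 'M[C]_n) (P Q T : 'M[C]_n) (t0 tau : R).
Variables (kap : 'I_m -> nat) (lead : 'I_m -> multinom n).

Let field N t (j : 'I_n) := trunc N (cf j t).
Let num1 N t i := trunc N.+1 (cg i t).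
Let den1 N t i := trunc N.+1 (ch i t).

Hypothesis f_zero : forall j t, cf j t (@mnm0 n) = 0.
Hypothesis f_linear : forall j t l, cf j t (mnm1 l) = A t j l.
Hypothesis g_analytic : forall i k t, analytic1 (fun s => cg i s k) t.
Hypothesis h_analytic : forall i k t, analytic1 (fun s => ch i s k) t.
Hypothesis g_deriv : forall i k t, qderiv (fun s => cg i s k) t (cg' i t k).
Hypothesis h_deriv : forall i k t, qderiv (fun s => ch i s k) t (ch' i t k).
Hypothesis g_periodic : forall i k, cg i (t0 + tau) k = cg i t0 k.
Hypothesis h_periodic : forall i k, ch i (t0 + tau) k = ch i t0 k.
Hypothesis integral : forall i N t kappa,
  (exists2 k, (mdeg k <= kappa)%N & ch i t k != 0) -> (kappa <= N)%N ->
  ordge (N - kappa)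
    (den1 N t i * total_deriv (field N t) (num1 N t i) (trunc N.+1 (cg' i t)) -
     num1 N t i * total_deriv (field N t) (den1 N t i) (trunc N.+1 (ch' i t))).
Hypothesis lead_deg : forall i, mdeg (lead i) = kap i.
Hypothesis lead_neq0 : forall i, ch i t0 (lead i) != 0.
Hypothesis lead_min : forall i t k, (mdeg k < kap i)%N -> ch i t k = 0.
Hypothesis X_analytic : forall i j t, analytic1 (fun s => X s i j) t.
Hypothesis X_deriv : forall i j t, qderiv (fun s => X s i j) t ((A t *m X t) i j).
Hypothesis X_unit : forall t, X t \in unitmx.
Hypothesis X_period : X (t0 + tau) = X t0 *m P.
Hypothesis Q_unit : Q \in unitmx.
Hypothesis PQ : P *m Q = Q *m T.
Hypothesis T_upper : forall i j : 'I_n, (j < i)%N -> T i j = 0.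
Hypothesis T_diag : forall i, T i i != 0.

Let kappa := (\sum_i kap i)%N.

(** The jets of the first integrals, brought to a common denominator. *)
Definition common_den N t := \prod_i trunc N.+1 (ch i t).
Definition common_num N t i :=
  trunc N.+1 (cg i t) * \prod_(l | l != i) trunc N.+1 (ch l t).
Definition jet_poly N D (p : mpoly m C) t := homogenize (common_num N t) (common_den N t) D p.

Lemma ordge_common_den N t : ordge kappa (common_den N t).
Proof.
apply: ordge_prod => i _; apply/ordgeP => k kk; rewrite mcoeff_trunc.
by case: ifP => // _; apply: lead_min.
Qed.

Lemma kap_le i : (kap i <= kappa)%N.
Proof. by rewrite /kappa (bigD1 i) //= leq_addr. Qed.

Lemma order_den1 N i : (kappa <= N)%N -> ~~ ordge (kap i).+1 (trunc N.+1 (ch i t0)).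
Proof.
move=> kN; apply/negP => /ordgeP /(_ (lead i)); rewrite lead_deg => /(_ (ltnSn _)).
rewrite mcoeff_trunc lead_deg ltnS (leq_trans (kap_le i) kN) => /eqP.
exact/negP.
Qed.

Lemma order_common_den N : (kappa <= N)%N -> ~~ ordge kappa.+1 (common_den N t0).
Proof. by move=> kN; apply: order_prod => i _; apply: order_den1. Qed.

(** The leading coefficients of the denominators are continuous in time. *)
Lemma lead_near : exists2 e : R, 0 < e &
  forall t, `|t - t0| < e -> forall i, ch i t (lead i) != 0.
Proof.
have an : analytic1 (fun s => \prod_i ch i s (lead i)) t0 by apply: analytic1_prod.
have n0 : \prod_i ch i t0 (lead i) != 0 by apply/prodf_neq0.
case: (analytic1_isolated an) => [[e [e0 he]]|[e [e0 he]]].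
  by have := he 0; rewrite addr0 normr0 => /(_ e0) z; rewrite z eqxx in n0.
exists e => // t te i; have [->//|tn] := eqVneq t t0.
have := he (t - t0); rewrite (addrC t0) subrK normr_gt0 subr_eq0 tn => /(_ isT te).
by move=> /prodf_neq0; apply.
Qed.

(** The factor L by which numerator and denominator of a quotient are expanded
    multiplies their Wronskian by the square of L. *)
Lemma common_graded N t : (kappa <= N)%N -> (forall i, ch i t (lead i) != 0) ->
  exists2 q, coef_qderiv (common_den N) q t &
  let E := common_den N t in let Ez := total_deriv (field N t) E q in
  (forall i, graded (field N t) (N - kappa) E Ez 1 ((common_num N)^~ i) t) /\
  graded (field N t) (N - kappa) E Ez 1 (common_den N) t.
Proof.
move=> kN hl.
have dden i : coef_qderiv (fun s => trunc N.+1 (ch i s)) (trunc N.+1 (ch' i t)) t.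
  exact: coef_qderiv_trunc.
have dnum i : coef_qderiv (fun s => trunc N.+1 (cg i s)) (trunc N.+1 (cg' i t)) t.
  exact: coef_qderiv_trunc.
have [q hq] : exists q, coef_qderiv (common_den N) q t.
  by apply: coef_qderiv_prod => i; exists (trunc N.+1 (ch' i t)).
exists q => //=; split; last by exists q => //; rewrite mul1r subrr ordge0.
move=> i.
have [z hz] : exists z, coef_qderiv (fun s => \prod_(l <- [seq l <- index_enum 'I_m | l != i])
    trunc N.+1 (ch l s)) z t.
  by apply: coef_qderiv_prod => l; exists (trunc N.+1 (ch' l t)).
pose L s := \prod_(l | l != i) trunc N.+1 (ch l s).
have {}hz : coef_qderiv L z t.
  by move=> k; apply: qderiv_ext (hz k) => s; congr (mcoeff _ _); rewrite /L -[RHS]big_filter.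
have eD s : common_den N s = trunc N.+1 (ch i s) * L s by rewrite /common_den (bigD1 i).
have hq' : coef_qderiv (common_den N) (trunc N.+1 (ch' i t) * L t + trunc N.+1 (ch i t) * z) t.
  by move=> k; apply: qderiv_ext (coef_qderivM (dden i) hz k) => s; rewrite eD.
rewrite (coef_qderiv_unique hq hq') {hq q} eD total_derivM.
exists (trunc N.+1 (cg' i t) * L t + trunc N.+1 (cg i t) * z); first exact: coef_qderivM.
rewrite /common_num -/(L t) total_derivM mul1r.
have id (K : comNzRingType) (a b c d x y : K) :
  a * x * (b * x + c * y) - c * x * (d * x + a * y) = (a * b - c * d) * (x * x) by ring.
rewrite (id _ (trunc N.+1 (ch i t)) _ (trunc N.+1 (cg i t))).
apply: ordgeMl; apply: (@ordge_leq _ _ (N - kappa)) => //.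
apply: integral => //; exists (lead i) => //.
by rewrite lead_deg kap_le.
Qed.

Lemma field_order N t l : (1 < N)%N ->
  ordge 1 (field N t l) /\ hpart 1 (field N t l) = linear_form (A t) l.
Proof.
move=> N1; split.
  apply/ordgeP => k; rewrite ltnS leqn0 mdeg_eq0 => /eqP ->.
  by rewrite mcoeff_trunc f_zero if_same.
apply/mpolyP => k; rewrite mcoeff_hpart mcoeff_trunc /linear_form raddf_sum /=.
case: (mdeg k =P 1%N) => [k1|kn1]; last first.
  rewrite big1 // => j _; rewrite mcoeffZ mcoeffX; case: eqP => [e|]; last by rewrite mulr0.
  by case: kn1; rewrite -e mdeg1.
have [j ->] : exists j, k = mnm1 j.
  have /eqP/mdeg1P [j /eqP e] := k1; by exists j.
rewrite mdeg1 N1 f_linear (bigD1 j) //= mcoeffZ mcoeffX eqxx mulr1 big1 ?addr0 // => j' jj.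
rewrite mcoeffZ mcoeffX; case: eqP => [/(congr1 (fun a : multinom n => a j'))|]; last by rewrite mulr0.
by rewrite !mnm1E eqxx eq_sym (negPf jj).
Qed.

(** The leading forms u of a homogenized jet and h of the common denominator
    satisfy h (d/dt + A x . grad) u = D u (d/dt + A x . grad) h. *)
Lemma leading_equation N D p k t : (kappa + k + 1 < N - kappa)%N ->
  (forall s, ordge k (jet_poly N D p s)) -> (forall i, ch i t (lead i) != 0) ->
  let u s := hpart k (jet_poly N D p s) in let h s := hpart kappa (common_den N s) in
  exists qu qh, [/\ (msize qu <= (maxn k kappa).+1)%N, (msize qh <= (maxn k kappa).+1)%N,
      forall a, qderiv (fun s => (u s)@_a) t qu@_a,
      forall a, qderiv (fun s => (h s)@_a) t qh@_a &
      h t * total_deriv (linear_form (A t)) (u t) qu =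
        D%:R *: (u t * total_deriv (linear_form (A t)) (h t) qh)].
Proof.
move=> kN ou hl u h.
have kappaN : (kappa <= N)%N.
  by apply: ltnW; rewrite -subn_gt0; apply: leq_ltn_trans kN.
have N1 : (1 < N)%N.
  by apply: leq_trans (leq_subr kappa N); apply: leq_ltn_trans kN; rewrite leq_addl.
have kN' : (kappa + k < N - kappa)%N by apply: leq_ltn_trans kN; rewrite leq_addr.
have [qE hqE [hnum hden]] := common_graded kappaN hl.
have [q hq oq] := graded_homogenize D p hnum hden.
exists (hpart k q), (hpart kappa qE); split.
- by apply: leq_trans (msize_hpart _ _) _; rewrite ltnS leq_maxl.
- by apply: leq_trans (msize_hpart _ _) _; rewrite ltnS leq_maxr.
- exact: coef_qderiv_hpart.
- exact: coef_qderiv_hpart.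
have fo l := (field_order t l N1).1; have fh l := (field_order t l N1).2.
have oqq : ordge k q := coef_qderiv_ordge hq ou.
have oE := ordge_common_den N; have oqE : ordge kappa qE := coef_qderiv_ordge hqE oE.
have := hpart_ordge (ordge_leq kN' oq).
set Zu := total_deriv _ _ q; set ZE := total_deriv _ _ qE.
have eZu : hpart k Zu = total_deriv (linear_form (A t)) (u t) (hpart k q).
  exact: hpart_total_deriv fo fh (ou t).
have eZE : hpart kappa ZE = total_deriv (linear_form (A t)) (h t) (hpart kappa qE).
  exact: hpart_total_deriv fo fh (oE t).
have oZu : ordge k Zu := ordge_total_deriv fo (ou t) oqq.
have oZE : ordge kappa ZE := ordge_total_deriv fo (oE t) oqE.
have e1 := hpartM (oE t) oZu; have e2 := hpartM (ou t) oZE.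
rewrite addnC in e2; rewrite mulr_natl -scaler_nat -scaleN1r hpartD !hpartZ.
rewrite scaleN1r => /eqP; rewrite subr_eq0 => /eqP e.
rewrite -eZu -eZE; apply: eq_trans (esym e1) _; apply: eq_trans e _.
by congr (_ *: _).
Qed.

Lemma common_den_period N : common_den N (t0 + tau) = common_den N t0.
Proof.
have eh i : ch i (t0 + tau) = ch i t0 by apply/funext => k; apply: h_periodic.
rewrite /common_den; apply: eq_bigr => l _; by rewrite eh.
Qed.

Lemma jet_poly_period N D p : jet_poly N D p (t0 + tau) = jet_poly N D p t0.
Proof.
have eg i : cg i (t0 + tau) = cg i t0 by apply/funext => k; apply: g_periodic.
have eh i : ch i (t0 + tau) = ch i t0 by apply/funext => k; apply: h_periodic.
have en : common_num N (t0 + tau) = common_num N t0.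
  apply/funext => i; rewrite /common_num eg; congr (_ * _).
  by apply: eq_bigr => l _; rewrite eh.
by rewrite /jet_poly en common_den_period.
Qed.

(** The exponents of the leading terms of all first integrals of degree D, in
    coordinates that make the monodromy triangular, have the same eigenvalue
    under the monodromy as the D-th power of the denominator. *)
Lemma leading_exponent N N0 D : (kappa + kappa + N0 + 1 < N)%N ->
  exists c : C, forall p, ~~ ordge N0.+1 (jet_poly N D p t0) ->
  exists a : multinom n, [/\ (mdeg a <= N0)%N, \prod_i T i i ^+ a i = c &
    (lsubst (X t0 *m Q) (jet_poly N D p t0))@_a != 0].
Proof.
move=> NN; have kappaN : (kappa <= N)%N.
  by apply: leq_trans (ltnW NN); rewrite -!addnA leq_addr.
pose h s := hpart kappa (common_den N s).
pose M := X t0 *m Q; have M_unit : M \in unitmx by rewrite unitmx_mul X_unit.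
have h0 : h t0 != 0.
  apply: contra (order_common_den kappaN) => /eqP e.
  exact: hpart_eq0 (ordge_common_den N t0) e.
exists ((\prod_i T i i ^+ mlead (lsubst M (h t0)) i) ^+ D) => p np.
have [k0 [k0N ok0 nk0]] := order_exists np.
(* k is the least order over all times.  That it is the order at t0 is the claim
   u0 below: by transport, u t0 = 0 would imply u = 0 at all times. *)
have exk : exists k, `[< exists s, ~~ ordge k.+1 (jet_poly N D p s) >].
  by exists k0; apply/asboolP; exists t0.
pose k := ex_minn exk; have [s1 nk] : exists s, ~~ ordge k.+1 (jet_poly N D p s).
  by rewrite /k; case: ex_minnP => k' /asboolP.
have kk0 : (k <= k0)%N.
  by rewrite /k; case: ex_minnP => k' _; apply; apply/asboolP; exists t0.
have ok s : ordge k (jet_poly N D p s).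
  rewrite /k; case: ex_minnP => -[|k'] _ hmin; first exact: ordge0n.
  apply: contraT => no; have := hmin k'; rewrite ltnn => -> //.
  by apply/asboolP; exists s.
have kN0 : (k <= N0)%N by apply: leq_trans kk0 _; rewrite -ltnS.
pose u s := hpart k (jet_poly N D p s).
have [e e0 hnear] := lead_near.
have num_an : forall i, coef_analytic ((common_num N)^~ i).
  move=> i; apply: coef_analyticM; first by apply: coef_analytic_trunc => ? ?; exact: g_analytic.
  by apply: coef_analytic_prod => l; apply: coef_analytic_trunc => ? ?; exact: h_analytic.
have den_an : coef_analytic (common_den N).
  by apply: coef_analytic_prod => l; apply: coef_analytic_trunc => ? ?; exact: h_analytic.
have u_an : coef_analytic u.
  by apply: coef_analytic_hpart; apply: coef_analytic_homogenize.
have h_an : coef_analytic h by apply: coef_analytic_hpart.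
have kN : (kappa + k + 1 < N - kappa)%N.
  rewrite ltn_subRL !addnA; apply: leq_ltn_trans NN.
  by rewrite !addn1 ltnS leq_add2l.
pose B := (maxn k kappa).+1.
have u_size s : (msize (u s) <= B)%N.
  by apply: leq_trans (msize_hpart _ _) _; rewrite ltnS leq_maxl.
have h_size s : (msize (h s) <= B)%N.
  by apply: leq_trans (msize_hpart _ _) _; rewrite ltnS leq_maxr.
have tr := @transport R n A X X_analytic X_deriv B u h D t0 e e0 u_size h_size u_an h_an h0 (X_unit t0)
  (fun t te => leading_equation kN ok (hnear t te)).
have u0 : u t0 != 0.
  apply/negP => /eqP u0; have := tr s1; rewrite u0 lsubst0 mul0r => /eqP.
  rewrite mulf_eq0 expf_eq0 => /orP [/eqP|/andP [_ /eqP]].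
    move=> /(lsubst_eq0 (X_unit s1)) us1.
    by have := hpart_eq0 (ok s1) us1; apply/negP.
  by move=> /(lsubst_eq0 (X_unit t0)) /eqP; apply/negP.
pose a := lsubst M (u t0); pose b := lsubst M (h t0).
have a0 : a != 0 by apply: contraNneq u0 => /(lsubst_eq0 M_unit) ->.
have b0 : b != 0 by apply: contraNneq h0 => /(lsubst_eq0 M_unit) ->.
have period (v : mpoly n C) : lsubst Q (lsubst (X (t0 + tau)) v) = lsubst T (lsubst M v).
  apply: eq_trans (lsubst_comp _ _ _) _; apply: eq_trans _ (esym (lsubst_comp _ _ _)).
  by rewrite X_period /M -!mulmxA PQ.
(* The transported identity after one period, in triangular coordinates. *)
have trQ : lsubst T a * b ^+ D = a * lsubst T b ^+ D.
  have /(lsubst_relation Q) := tr (t0 + tau).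
  have -> : u (t0 + tau) = u t0 by rewrite /u jet_poly_period.
  have -> : h (t0 + tau) = h t0 by rewrite /h common_den_period.
  have eM (v : mpoly n C) : lsubst Q (lsubst (X t0) v) = lsubst M v by exact: lsubst_comp.
  have [pu ph] := (period (u t0), period (h t0)).
  have [eu eh] := (eM (u t0), eM (h t0)).
  move=> E; apply: eq_trans (eq_trans _ E) _.
    exact: (f_equal2 (fun x y : mpoly n C => x * y ^+ D) (esym pu) (esym eh)).
  exact: (f_equal2 (fun x y : mpoly n C => x * y ^+ D) eu ph).
have hk : hpart k a = a by apply: lsubst_homog; exact: hpart_id.
have ca : a@_(mlead a) != 0 by rewrite mleadc_eq0.
have dk : mdeg (mlead a) = k.
  apply/eqP; apply: contraNT ca => nd; have := congr1 (mcoeff (mlead a)) hk.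
  by rewrite mcoeff_hpart (negPf nd) => <-.
exists (mlead a); split; first by rewrite dk.
  exact: semi_invariant_mlead trQ.
have od : ordge k.+1 (lsubst M (jet_poly N D p t0 - u t0)) :=
  ordge_lsubst M (ordge_sub_hpart (ok t0)).
have eM := lsubstD M (jet_poly N D p t0 - u t0) (u t0); rewrite subrK in eM.
have c0 : (lsubst M (jet_poly N D p t0 - u t0))@_(mlead a) = 0.
  by have /ordgeP -> := od; rewrite ?dk.
have e2 : (lsubst M (jet_poly N D p t0))@_(mlead a) = a@_(mlead a).
  apply: eq_trans (congr1 (mcoeff (mlead a)) eM) _.
  apply: eq_trans (mcoeffD _ _ _) _.
  exact: eq_trans (f_equal2 +%R c0 (erefl (a@_(mlead a)))) (add0r _).
exact: (eq_ind_r (fun z => z != 0) ca e2).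
Qed.

End LeadingExponents.

(** * Counting *)

Section Counting.
Variables (R : realType) (n m : nat) (mu : 'I_n -> cplx R) (s : 'I_n -> 'I_n).
Local Notation C := (cplx R).
Hypothesis mu_neq0 : forall i, mu i != 0.
Hypothesis s_inj : injective s.
Let rk := max_linearly_independent R (resonances mu).

(** The monomials of degree at most d in each variable outnumber the exponents
    that can lead one of their images, unless m is at most the resonance rank:
    otherwise some nonzero combination of them has no leading exponent. *)
Lemma count_exponents d N0 (c : C) (L : mpoly m C -> mpoly n C) :
  (forall p q, L (p + q) = L p + L q) -> (forall a p, L (a *: p) = a *: L p) ->
  (forall p, p != 0 -> (msize p <= (m * d).+1)%N -> exists a : multinom n,
     [/\ (mdeg a <= N0)%N, \prod_i mu (s i) ^+ a i = c & (L p)@_a != 0]) ->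
  (d.+1 ^ m <= N0.+1 ^ rk)%N.
Proof.
move=> LD LZ hL.
pose Z := {ffun 'I_m -> 'I_d.+1}.
pose S := [pred a : bmultinom n N0.+1 | \prod_i mu i ^+ (a : multinom n) i == c].
apply: leq_trans (card_resonant_exponents mu_neq0 N0 c); rewrite -/S.
have -> : (d.+1 ^ m)%N = #|Z| by rewrite card_ffun !card_ord.
rewrite leqNgt; apply/negP => SZ.
pose expn (z : Z) : multinom m := mnm_of [ffun i => z i : nat].
have expn_inj : injective expn.
  move=> z1 z2 e; apply/ffunP => i; apply: val_inj.
  by have := congr1 (fun a : multinom m => a i) e; rewrite /expn !mnm_ofE !ffunE.
(* The triangular form lists the multipliers in the order s, whereas resonances
   refer to mu itself. *)
pose perm_exp (b : multinom n) : multinom n := mnm_of [ffun i => b (s i)].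
pose B := \matrix_(k < #|Z|, l < #|S|)
  (L (mpolyX C (expn (enum_val k))))@_(perm_exp (enum_val l : bmultinom n N0.+1)).
have [v v0 vB] := row_kernel B SZ.
pose p := \sum_k v 0 k *: mpolyX C (expn (enum_val k)).
have p0 : p != 0.
  apply: contraNneq v0 => pz; apply/eqP/rowP => k; rewrite mxE.
  have := congr1 (mcoeff (expn (enum_val k))) pz; rewrite mcoeff0 /p raddf_sum (bigD1 k) //=.
  rewrite mcoeffZ mcoeffX eqxx mulr1 big1 ?addr0 // => l lk.
  rewrite mcoeffZ mcoeffX; case: eqP => [/expn_inj /enum_val_inj e|]; last by rewrite mulr0.
  by rewrite e eqxx in lk.
have sp : (msize p <= (m * d).+1)%N.
  rewrite msizeE; apply/bigmax_leqP_seq => a; rewrite mcoeff_msupp => pa _.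
  have [k ea] : exists k : 'I_#|Z|, a = expn (enum_val k).
    apply: contrapT => no; move/negP: pa; apply; rewrite /p raddf_sum /= big1 // => k _.
    rewrite mcoeffZ mcoeffX; case: eqP => [e|]; last by rewrite mulr0.
    by case: no; exists k.
  rewrite ea ltnS mdeg_mnm_of /weight -[m in (m * d)%N]card_ord -sum_nat_const.
  by apply: leq_sum => i _; rewrite ffunE -ltnS.
have [a [aN ac]] := hL p p0 sp; apply/negP; rewrite negbK; apply/eqP.
pose sinv := invF s_inj.
pose b : multinom n := mnm_of [ffun i => a (sinv i)].
have bE i : b i = a (sinv i) by rewrite mnm_ofE ffunE.
have bs : perm_exp b = a.
  by apply/mnmP => i; rewrite mnm_ofE ffunE bE /sinv invF_f.
have bN : (mdeg b < N0.+1)%N.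
  rewrite ltnS; apply: leq_trans aN; rewrite !mdegE (reindex_inj s_inj) /=.
  by apply: eq_leq; apply: eq_bigr => i _; rewrite bE /sinv invF_f.
have bS : BMultinom bN \in S.
  rewrite inE /= -ac (reindex_inj s_inj) /=; apply/eqP.
  by apply: eq_bigr => i _; rewrite bE /sinv invF_f.
have := congr1 (fun M : 'rV_#|S| => M 0 (enum_rank_in bS (BMultinom bN))) vB.
rewrite !mxE => e; rewrite -[RHS]e -bs.
have Lsum (r : seq 'I_#|Z|) : L (\sum_(k <- r) v 0 k *: mpolyX C (expn (enum_val k))) =
    \sum_(k <- r) v 0 k *: L (mpolyX C (expn (enum_val k))).
  elim: r => [|k r ih]; last by rewrite !big_cons LD LZ ih.
  by rewrite !big_nil -(scale0r 0) LZ !scale0r.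
rewrite /p Lsum raddf_sum /=; apply: eq_bigr => k _.
by rewrite mcoeffZ !mxE enum_rankK_in.
Qed.

(** Otherwise the powers of d + 1 on the two sides differ; take d = q ^ rk. *)
Lemma exponent_comparison q : (forall d, d.+1 ^ m <= (d.+1 * q) ^ rk)%N -> (m <= rk)%N.
Proof.
move=> h; rewrite leqNgt; apply/negP => lt.
have := h (q ^ rk)%N; rewrite expnMn leqNgt => /negP; apply.
apply: (@leq_trans ((q ^ rk).+1 ^ rk.+1)%N); last by rewrite leq_pexp2l.
by rewrite expnSr ltn_pmul2l // expn_gt0.
Qed.

End Counting.

(** The columns of a matrix of full row rank contain a basis. *)
Lemma nonzero_minor (K : fieldType) m n (M : 'M[K]_(m, n)) : \rank M = m ->
  exists sigma : 'I_m -> 'I_n, \det (\matrix_(i, j) M i (sigma j)) != 0.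
Proof.
move=> rM; have full : row_full M^T by rewrite /row_full mxrank_tr rM.
exists (fullrankfun full); have := fullrowsub_unit full.
rewrite unitmxE unitfE -det_tr; congr (_ != 0); congr (\det _).
by apply/matrixP => i j; rewrite !mxE.
Qed.

(** * Jacobian minors of first integrals *)

Section Rays.
Variables (R : realType) (n : nat).
Local Notation C := (cplx R).
Local Notation V := 'cV[C]_n.
Implicit Types (W : V -> C) (x : V) (t s : R).

Lemma ray_shift W x s : analytic1 (fun a => W (rtoc s *: x + rtoc a *: x)) 0 ->
  analytic1 (fun a => W (rtoc a *: x)) s.
Proof.
move=> [d [M [d0 h]]]; exists d, M; split=> // N.
have [q [Q [h1 h2 h3]]] := h N; exists q, Q; split=> // a ad.
by have := h3 a ad; rewrite add0r rtocD scalerDl.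
Qed.

Lemma ray_in (rho : R) x s : vmod x < rho -> 0 <= s <= 1 -> vmod (rtoc s *: x) < rho.
Proof.
move=> xr /andP [s0 s1]; rewrite vmodZ cmod_rtoc ger0_norm //.
by apply: le_lt_trans xr; rewrite ler_piMl // vmod_ge0.
Qed.

Lemma ray_analytic (rho : R) (F : R -> V -> C) t x s : analytic_on rho F -> vmod x < rho ->
  0 <= s <= 1 -> analytic1 (fun a => F t (rtoc a *: x)) s.
Proof.
move=> an xr hs; apply: ray_shift.
have at_s : analytic_at F t (rtoc s *: x) by apply: an; rewrite lt_vmod; apply: ray_in.
apply: analytic1_ext ltr01 _ (analytic_line 0 x at_s) => a _.
by rewrite mulr0 addr0.
Qed.

Lemma ray_analytic_xpartial (rho : R) (F : R -> V -> C) t x s l : analytic_on rho F ->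
  vmod x < rho -> 0 <= s <= 1 -> analytic1 (fun a => xpartial F l t (rtoc a *: x)) s.
Proof.
by move=> an xr hs; apply: ray_shift; apply: analytic_xpartial_line an _; apply: ray_in.
Qed.

(** A function that is not zero at x is not flat at the origin along the segment
    to x, so the orders of its jets are bounded. *)
Lemma ray_order W x (p : nat -> mpoly n C) :
  (forall s, 0 <= s <= 1 -> analytic1 (fun a => W (rtoc a *: x)) s) ->
  (forall N, approx N W (p N)) -> W x != 0 ->
  exists e, forall N, (e < N)%N -> ~~ ordge e.+1 (p N).
Proof.
move=> an ap Wx; apply: contrapT => no.
have app0 e : approx e.+1 W 0.
  have [N [eN oN]] : exists N, (e < N)%N /\ ordge e.+1 (p N).
    apply: contrapT => no'; apply: no; exists e => N eN; apply/negP => oN.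
    by apply: no'; exists N.
  by apply: approx_ordge_eq (approx_leq eN (ap N)); rewrite subr0.
have an0 : analytic1 (fun a => W (rtoc a *: x)) 0 by apply: an; rewrite lexx ler01.
have := @identity_segment R (fun a => W (rtoc a *: x)) 0 1 ler01 an.
rewrite scale1r => /(_ _)/eqP; rewrite (negPf Wx) => h; suff : false by []; apply: h.
apply: flat_eq0 an0 _ => N.
have [K [d [K0 d0 d1 hK]]] := approx_pos (app0 N).
pose L := vmod x + 1.
have L0 : 0 < L by rewrite ltr_wpDl // vmod_ge0.
exists (K * L ^+ N.+1), (Num.min 1 (d / L)); split.
  by rewrite lt_min ltr01 divr_gt0.
move=> s s0; rewrite lt_min ltr_pdivlMr // => /andP [s1 sd]; rewrite add0r.
have hv : vmod (rtoc s *: x) <= s * L.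
  by rewrite vmodZ cmod_rtoc gtr0_norm // ler_wpM2l ?(ltW s0) // lerDl.
have := hK _ (le_lt_trans hv sd); rewrite pev0 subr0 => /le_trans; apply.
rewrite -mulrA ler_wpM2l //; apply: (@le_trans _ _ ((s * L) ^+ N.+1)).
  by apply: lerXn2r; rewrite ?nnegrE ?vmod_ge0 // mulr_ge0 // ltW.
rewrite exprMn mulrC ler_wpM2l ?exprn_ge0 ?(ltW L0) // exprS ler_piMl ?exprn_ge0 ?(ltW s0) //.
exact: ltW.
Qed.

Lemma expands_neq0 (rho : R) (F : R -> V -> C) c c' t x : analytic_on rho F -> vmod x < rho ->
  expands F c c' -> F t x != 0 -> exists k, c t k != 0.
Proof.
move=> an xr [ap _ _ _ _] Fx.
have [e he] := ray_order (fun s hs => ray_analytic t an xr hs) (fun N => ap t N) Fx.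
apply: contrapT => no; move/negP: (he e.+1 (ltnSn _)); apply.
apply/ordgeP => k _; rewrite mcoeff_trunc; case: ifP => // _.
by apply/eqP; apply: contraT => ck; case: no; exists k.
Qed.

(** The expansion at x = 0 is unique. *)
Lemma expands_periodic (rho tau : R) (F : R -> V -> C) c c' t : 0 < rho ->
  (forall x, vmod x < rho -> F (t + tau) x = F t x) ->
  expands F c c' -> forall k, c (t + tau) k = c t k.
Proof.
move=> rho0 per [ap _ _ _ _] k.
have := approx_unique (ap t (mdeg k).+1) (approx_ext rho0 per (ap (t + tau) (mdeg k).+1)).
move=> /ordgeP /(_ k (ltnSn _)); rewrite mcoeffB !mcoeff_trunc ltnSn => /eqP.
by rewrite subr_eq0 => /eqP ->.
Qed.

Variables (m : nat) (rho t : R) (x : V) (sigma : 'I_m -> 'I_n).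
Variables (F G H : 'I_m -> R -> V -> C) (cg cg' ch ch' : 'I_m -> R -> multinom n -> C).
Hypothesis x_in : vmod x < rho.
Hypothesis G_an : forall i, analytic_on rho (G i).
Hypothesis H_an : forall i, analytic_on rho (H i).
Hypothesis G_expands : forall i, expands (G i) (cg i) (cg' i).
Hypothesis H_expands : forall i, expands (H i) (ch i) (ch' i).
Hypothesis F_quotient : forall i s y, vmod y < rho -> H i s y != 0 -> F i s y = G i s y / H i s y.
Hypothesis H_neq0 : forall i, H i t x != 0.
Hypothesis minor : \det (\matrix_(i, j) xpartial (F i) (sigma j) t x) != 0.

(** The Wronskians of the jets approximate those of the functions, which at (t, x)
    are the partial derivatives of F i multiplied by the squares of H i. *)
Lemma wronskian_order : exists e, forall N, (e < N)%N ->
  ~~ ordge e.+1 (\det (\matrix_(i < m, j < m)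
     (trunc N.+1 (ch i t) * mderiv (sigma j) (trunc N.+1 (cg i t)) -
      trunc N.+1 (cg i t) * mderiv (sigma j) (trunc N.+1 (ch i t))))).
Proof.
pose W i j y := H i t y * xpartial (G i) (sigma j) t y - G i t y * xpartial (H i) (sigma j) t y.
apply: (@ray_order (fun y => \det (\matrix_(i, j) W i j y)) x) => [s hs|N|].
- apply: (@analytic1_det R m (fun i j a => W i j (rtoc a *: x)) s) => i j.
  apply: analytic1B; apply: analytic1M.
  + exact: ray_analytic (H_an i) _ hs.
  + exact: ray_analytic_xpartial (G_an i) _ hs.
  + exact: ray_analytic (G_an i) _ hs.
  + exact: ray_analytic_xpartial (H_an i) _ hs.
- apply: approx_det => i j; have [g1 _ g2 _ _] := G_expands i; have [h1 _ h2 _ _] := H_expands i.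
  have up u c : (forall N, approx N u (trunc N c)) -> approx N u (trunc N.+1 c).
    by move=> h; apply: approx_leq (leqnSn N) (h N.+1).
  apply: approxB; apply: approxM; [exact: up|exact: g2|exact: up|exact: h2].
have -> : \matrix_(i, j) W i j x =
    diag_mx (\row_i H i t x ^+ 2) *m \matrix_(i, j) xpartial (F i) (sigma j) t x.
  apply/matrixP => i j; rewrite mul_diag_mx !mxE.
  rewrite (quotient_xpartial (G_an i) (H_an i) (F_quotient (i := i))) //.
  by rewrite mulrC divfK // expf_neq0.
rewrite det_mulmx det_diag mulf_neq0 //; apply/prodf_neq0 => i _.
by rewrite mxE expf_neq0.
Qed.

End Rays.

(** * The linearization *)

Section Linearization.
Variables (R : realType) (n : nat) (r : R).
Local Notation C := (cplx R).
Local Notation V := 'cV[C]_n.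
Variables (f g : R -> V -> V) (A : R -> 'M[C]_n).
Hypothesis r_gt0 : 0 < r.
Hypothesis f_split : forall t x, `|x| < rtoc r -> f t x = A t *m x + g t x.
Hypothesis g_order2 : big_O_square g.

(** The remainder g is of second order, so the linear part of f is A. *)
Lemma linear_part_approx t j : approx 2 (fun x => f t x j 0) (linear_form (A t) j).
Proof.
have [K [d [d0 hK]]] := g_order2.
exists K, (Num.min r d); split; first by rewrite lt_min r_gt0.
move=> x; rewrite lt_min => /andP [xr xd].
rewrite pev_linear_form f_split ?lt_vmod // [(_ + _ : V) j 0]mxE [X in X - _]addrC addrK.
apply: le_trans (cmod_le_vmod _ _) _.
by have := hK t x; rewrite lt_vmod => /(_ xd); rewrite !norm_vmod -rtocX -rtocM le_rtoc.
Qed.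

Variables (cf cf' : 'I_n -> R -> multinom n -> C).
Hypothesis f_expands : forall j, expands (fun t x => f t x j 0) (cf j) (cf' j).

Lemma linear_part_coef t j (k : multinom n) : (mdeg k < 2)%N ->
  cf j t k = (linear_form (A t) j)@_k.
Proof.
move=> k2; have [ap _ _ _ _] := f_expands j.
have := approx_unique (ap t 2%N) (linear_part_approx t j).
move=> /ordgeP /(_ k k2); rewrite mcoeffB mcoeff_trunc k2 => /eqP.
by rewrite subr_eq0 => /eqP.
Qed.

Lemma linear_part_zero t j : cf j t (@mnm0 n) = 0.
Proof.
rewrite linear_part_coef ?mdeg0 // raddf_sum big1 // => l _ /=.
rewrite mcoeffZ mcoeffX; case: eqP => [/(congr1 (@mdeg n))|]; last by rewrite mulr0.
by rewrite mdeg1 mdeg0.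
Qed.

Lemma linear_part_entry t j l : cf j t (mnm1 l) = A t j l.
Proof.
rewrite linear_part_coef ?mdeg1 // raddf_sum (bigD1 l) //= mcoeffZ mcoeffX eqxx mulr1.
rewrite big1 ?addr0 // => i il; rewrite mcoeffZ mcoeffX.
case: eqP => [/(congr1 (fun a : multinom n => a i))|]; last by rewrite mulr0.
by rewrite !mnm1E eqxx eq_sym (negPf il).
Qed.

Lemma linear_part_analytic i j t : analytic1 (fun s => A s i j) t.
Proof.
have [_ an _ _ _] := f_expands i.
by apply: analytic1_ext ltr01 _ (an (mnm1 j) t) => s _; rewrite linear_part_entry.
Qed.

End Linearization.

(** * The bound by the number of independent resonances *)

Theorem theorem4 (R : realType) (n : nat) (r : R)
    (f g : R -> 'cV[cplx R]_n -> 'cV[cplx R]_n) (A : R -> 'M[cplx R]_n)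
    (P : 'M[cplx R]_n) (mu : 'I_n -> cplx R)
    (r_gt0 : 0 < r)
    (f_analytic : forall i, analytic_on r (fun t x => f t x i 0))
    (f_periodic : periodic_on r f)
    (f_zero : forall t, f t 0 = 0)
    (f_split : forall t x, `|x| < rtoc r -> f t x = A t *m x + g t x)
    (A_periodic : forall t, A (t + 2 * pi) = A t)
    (g_periodic : periodic_on r g)
    (g_order2 : big_O_square g)
    (P_monodromy : monodromy_operator A (mulmx P))
    (mu_eigenvalues : char_poly P = \prod_(i < n) ('X - (mu i)%:P)) :
  forall (rho : R) (m : nat) (F : 'I_m -> R -> 'cV[cplx R]_n -> cplx R),
    0 < rho -> rho <= r ->
    (forall i, generalized_rational_first_integral f rho (F i)) ->
    functionally_independent rho F ->
    (m <= max_linearly_independent R (resonances mu))%N.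
Proof.
move=> rho m F rho_gt0 rho_r FI indep.
have /choice [cf /choice [cf' f_exp]] := fun j => analytic_jets r_gt0 (f_analytic j).
have A_an := linear_part_analytic r_gt0 f_split g_order2 f_exp.
have [X [X_an X_der X_unit X_per]] := fundamental_matrix A_an A_periodic P_monodromy.
have P_unit : P \in unitmx.
  by have := X_unit (0 + 2 * pi); rewrite X_per unitmx_mul => /andP [].
have mu_neq0 := multipliers_neq0 P_unit mu_eigenvalues.
have [Q [T [s [Q_unit s_inj PQ T_upper T_mu]]]] := upper_triangularization mu_eigenvalues.
have T_diag i : T i i != 0 by rewrite T_mu.
have /choice [G /choice [H FGH]] := FI.
have G_an i : analytic_on rho (G i) by have [[]] := FGH i.
have H_an i : analytic_on rho (H i) by have [[]] := FGH i.
have F_quot i t x : vmod x < rho -> H i t x != 0 -> F i t x = G i t x / H i t x.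
  by move=> xr hn; have [_ _ h _ _] := FGH i; apply: h; rewrite lt_vmod.
have F_int i t x : vmod x < rho -> H i t x != 0 ->
    tderive (fun s => F i s x) t + \sum_(j < n) xpartial (F i) j t x * f t x j 0 = 0.
  by move=> xr hn; have [_ _ _ _ h] := FGH i; apply: h; rewrite lt_vmod.
have /choice [cg /choice [cg' g_exp]] := fun i => analytic_jets rho_gt0 (G_an i).
have /choice [ch /choice [ch' h_exp]] := fun i => analytic_jets rho_gt0 (H_an i).
(* The order of the denominator H i at x = 0 depends on time; its least value is
   attained at almost all times. *)
have lead_ex i : exists k : multinom n, (exists t, ch i t k != 0) /\
    forall t l, (mdeg l < mdeg k)%N -> ch i t l = 0.
  have [_ [t1 [x1 [x1r hn]]] _ _ _] := FGH i; rewrite lt_vmod in x1r.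
  have [k0 ck0] := expands_neq0 (H_an i) x1r (h_exp i) hn.
  have ex : exists d, `[< exists k t, mdeg k = d /\ ch i t k != 0 >].
    by exists (mdeg k0); apply/asboolP; exists k0, t1.
  case: (ex_minnP ex) => d /asboolP [k [t [dk ck]]] dmin.
  exists k; split; first by exists t.
  move=> t' l; rewrite dk => ld; apply/eqP; apply: contraT => cl.
  have := dmin (mdeg l); rewrite leqNgt ld /= => h; apply: h.
  by apply/asboolP; exists l, t'.
have /choice [lead hlead] := lead_ex.
have gen i : generic rho (fun t x => H i t x != 0 /\ ch i t (lead i) != 0).
  apply: generic_and.
    have [_ [t1 [x1 [x1r hn]]] _ _ _] := FGH i; rewrite lt_vmod in x1r.
    exact: generic_analytic (H_an i) x1r hn.
  have [[t1 ct1] _] := hlead i; have [_ an _ _ _] := h_exp i.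
  exact: generic_analytic1 (an (lead i)) ct1.
have pi0 : 0 < pi :> R := pi_gt0 R.
(* The ball of radius pi around pi is the interior of a fundamental domain. *)
have [t0 [x0 [hgen notE t0pi x0r]]] := @generic_off_null R n rho rho_gt0 _ _ pi pi (generic_all gen) indep pi0.
have rank_m : \rank (\matrix_(i < m, j < n) xpartial (F i) j t0 x0) = m.
  apply: contrapT => no; apply: notE; split=> //=; rewrite ?lt_vmod //;
    by move: t0pi; rewrite ltr_norml => /andP [a b]; lra.
have [sigma minor] := nonzero_minor rank_m.
have minor' : \det (\matrix_(i, j) xpartial (F i) (sigma j) t0 x0) != 0.
  move: minor; congr (\det _ != 0); by apply/matrixP => i j; rewrite !mxE.
have [e0 he0] := wronskian_order x0r G_an H_an g_exp h_exp F_quot (fun i => (hgen i).1) minor'.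
pose kap i := mdeg (lead i); pose kappa := (\sum_i kap i)%N.
(* The order of the Jacobian minor, and of the squares of the factors introduced
   by the common denominator. *)
pose e := (\sum_i 2 * \sum_(l | l != i) kap l + e0)%N.
have per i u : vmod u < rho -> forall t, G i (t + 2 * pi) u = G i t u /\ H i (t + 2 * pi) u = H i t u.
  move=> ur t; have [[_ _ gp hp] _ _ _ _] := FGH i.
  by rewrite gp ?hp ?lt_vmod.
have lexp N N0 D := @leading_exponent R n m cf cg cg' ch ch' A X P Q T t0 (2 * pi) kap lead
  (fun j t => linear_part_zero r_gt0 f_split g_order2 f_exp t j)
  (fun j t l => linear_part_entry r_gt0 f_split g_order2 f_exp t j l)
  (fun i k t => let: And5 _ an _ _ _ := g_exp i in an k t)
  (fun i k t => let: And5 _ an _ _ _ := h_exp i in an k t)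
  (fun i k t => let: And5 _ _ _ d _ := g_exp i in d k t)
  (fun i k t => let: And5 _ _ _ d _ := h_exp i in d k t)
  (fun i => expands_periodic rho_gt0 (fun x xr => (per i x xr t0).1) (g_exp i))
  (fun i => expands_periodic rho_gt0 (fun x xr => (per i x xr t0).2) (h_exp i))
  (fun i N t kp hk kN => first_integral_jets rho_gt0 (G_an i) (H_an i) (F_quot i) (F_int i)
     (fun j t N => let: And5 ap _ _ _ _ := f_exp j in ap t N) (g_exp i) (h_exp i) hk kN)
  (fun i => erefl) (fun i => (hgen i).2) (fun i => (hlead i).2)
  X_an X_der X_unit (X_per t0) Q_unit PQ T_upper T_diag N N0 D.
pose K := (1 + e + kappa)%N.
apply: (@exponent_comparison _ _ _ mu (m * K).+1) => d.
pose D := (m * d)%N; pose N0 := (D * K)%N.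
(* The truncation order N exceeds every order that occurs below. *)
pose N := (kappa + kappa + N0 + 1 + e).+1.
have NN : (kappa + kappa + N0 + 1 < N)%N by rewrite ltnS leq_addr.
have kN : (kappa <= N)%N by rewrite /N -!addnA leqW // leq_addr.
have eN : (e0 < N)%N by rewrite ltnS (leq_trans (leq_addl _ _ : (e0 <= e)%N)) // leq_addl.
have [c hc] := lexp N N0 D NN.
have order_den i : ~~ ordge (kap i).+1 (trunc N.+1 (ch i t0)).
  exact: (@order_den1 _ _ _ _ _ kap lead (fun i => erefl) (fun i => (hgen i).2) N i kN).
pose num := common_num cg ch N t0; pose den := common_den ch N t0.
have odet : ~~ ordge e.+1 (\det (\matrix_(i, j) wronskian num den (sigma j) i)).
  pose L i := \prod_(l | l != i) trunc N.+1 (ch l t0).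
  pose W := \matrix_(i < m, j < m)
     (trunc N.+1 (ch i t0) * mderiv (sigma j) (trunc N.+1 (cg i t0)) -
      trunc N.+1 (cg i t0) * mderiv (sigma j) (trunc N.+1 (ch i t0))).
  have -> : \matrix_(i, j) wronskian num den (sigma j) i = diag_mx (\row_i L i ^+ 2) *m W.
    apply/matrixP => i j; rewrite mul_diag_mx.
    rewrite [RHS]mxE.
    rewrite [LHS]mxE.
    rewrite [X in _ = X * _]mxE.
    rewrite [W i j]mxE.
    rewrite /wronskian.
    have -> : den = trunc N.+1 (ch i t0) * L i by rewrite /den /common_den (bigD1 i).
    rewrite /num /common_num -/(L i) !mderivM.
    have id (U : comNzRingType) (a a' b b' x x' : U) :
      a * x * (b' * x + b * x') - b * x * (a' * x + a * x') = x ^+ 2 * (a * b' - b * a') by ring.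
    exact: id.
  rewrite det_mulmx det_diag; apply: order_mul (he0 N eN).
  apply: order_prod => i _; rewrite mxE; apply: order_exp.
  by apply: order_prod => l _; apply: order_den.
have oden : ~~ ordge kappa.+1 den by apply: order_prod => i _; apply: order_den.
have count := @count_exponents R n m mu s mu_neq0 s_inj d N0 c
  (fun p => lsubst (X t0 *m Q) (jet_poly cg ch N D p t0)) _ _ _.
apply: leq_trans (count _ _ _) _.
- move=> p q; apply: eq_trans _ (lsubstD _ _ _); congr (lsubst _ _); exact: homogenizeD.
- move=> a p; apply: eq_trans _ (lsubstZ _ _ _); congr (lsubst _ _); exact: homogenizeZ.
- move=> p p0 sp.
  have [a [a1 a2 a3]] := hc p (zero_estimate oden odet p0 sp).
  exists a; split=> //; rewrite -a2; apply: eq_bigr => i _; by rewrite T_mu.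
have le : (N0.+1 <= d.+1 * (m * K).+1)%N.
  have -> : N0 = (d * (m * K))%N by rewrite /N0 /D [(m * d)%N]mulnC mulnA.
  by rewrite mulSn mulnS addSn ltnS addnA leq_addl.
by case: (posnP (max_linearly_independent R (resonances mu))) => [->|rk0]; rewrite ?expn0 ?leq_exp2r.
Qed.
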